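(* Let $(R,\mathfrak m)$ be a complete local Noetherian domain of mixed characteristic $p>0$. Then there exist a system of parameters $p,x_2,\ldots,x_d$ of $R$ and a weakly almost Cohen-Macaulay $R^+$-algebra $B$ satisfying the following conditions: (1) $(p,x_2,\ldots,x_d)B\neq B$; (2) $x_2,\ldots,x_d$ forms a regular sequence on $B/pB$; (3) $p$ is not nilpotent in $B$, and the ideal $(0:_B p)=\{b\in B: pb=0\}$ is annihilated by $p^{\epsilon}$ for every rational $\epsilon>0$.
   Context: A domain $A$ has mixed characteristic $p>0$ if $A$ has characteristic zero while $A/pA$ has characteristic $p>0$. $R^+$ denotes the absolute integral closure of $R$, i.e. the integral closure of $R$ in an algebraic closure of its field of fractions. For a rational $\epsilon=m/n>0$ (with $m,n$ positive integers), $p^{\epsilon}$ denotes an element of $R^+$ with $(p^{\epsilon})^n=p^m$. A sequence $y_1,\ldots,y_n$ in a ring $A$ is regular on an $A$-module $N$ if $(y_1,\ldots,y_n)N\ne N$ and $y_k$ is a nonzero divisor on $N/(y_1,\ldots,y_{k-1})N$ for all $1\le k\le n$. Fix a discrete valuation $v:R\to\mathbb Z\cup\{\infty\}$ that is non-negative on $R$ and strictly positive on $\mathfrak m$, and fix an extension of it to a valuation $v:R^+\to\mathbb Q\cup\{\infty\}$ (any fixed choice is allowed). Let $B$ be an $R^+$-algebra and $y_1,\ldots,y_d$ a system of parameters of $R$. The sequence $y_1,\ldots,y_d$ is weakly almost regular on $B$ if $\mathfrak mB\neq B$ and for every rational $\epsilon>0$ there exists $b\in R^+$ with $v(b)<\epsilon$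 and $b\cdot\frac{(y_1,\ldots,y_i)B:_B y_{i+1}}{(y_1,\ldots,y_i)B}=0$ for all $0\le i\le d-1$. An $R^+$-algebra $B$ is called weakly almost Cohen-Macaulay if there is a system of parameters of $R$ that is weakly almost regular on $B$. *)

(* Defs.v *)
From HB Require Import structures.
From mathcomp Require Import all_boot all_order all_algebra generic_quotient.
From mathcomp Require Import boolp classical_sets constructive_ereal.

Set Implicit Arguments.
Unset Strict Implicit.
Unset Printing Implicit Defensive.

Import Order.TTheory GRing.Theory Num.Theory.

Local Open Scope classical_set_scope.
Local Open Scope ring_scope.
Local Open Scope quotient_scope.

Definition gen_ideal (A : comNzRingType) (y : seq A) : set A :=
  [set z | exists c : 'I_(size y) -> A, z = \sum_(i < size y) c i * y`_i].

(* [smul I M] is the additive subgroup of N generated by the products a *: u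
   with a in I and u in M. It is I M when M is a submodule, and it is also the
   extension I N of an ideal I along a ring map f when applied to f @` I and
   M = N. *)
Definition smul (A : comNzRingType) (N : lmodType A) (I : set A) (M : set N) :
    set N :=
  [set z | exists2 s : seq (A * N),
     {in s, forall q, I q.1 /\ M q.2} & z = \sum_(q <- s) q.1 *: q.2].

Section QuotientModule.
Variables (A : comNzRingType) (N : lmodType A) (y : seq A).

Definition modq_pred : {pred N} :=
  [pred z : N | `[< smul (gen_ideal y) (setT : set N) z >]].

Lemma modq_pred_closed : submod_closed modq_pred.
Proof.
split=> [|a u w].
  by apply/asboolP; exists [::]; rewrite ?big_nil.
move=> /asboolP[s sI ->] /asboolP[t tI ->]; apply/asboolP.
exists ([seq (q.1, a *: q.2) | q <- s] ++ t).
  move=> q; rewrite mem_cat => /orP[/mapP[r /sI[rI _] ->]|/tI //].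
  by split.
rewrite big_cat big_map scaler_sumr /=; congr (_ + _).
by apply: eq_bigr => q _; rewrite !scalerA mulrC.
Qed.

HB.instance Definition _ :=
  GRing.isSubmodClosed.Build A N modq_pred modq_pred_closed.

(* N / (y)N *)
Definition modq := Quotient.quot modq_pred.
HB.instance Definition _ := GRing.Zmodule.on modq.
HB.instance Definition _ := EqQuotient.on modq.

Definition modq_scale (a : A) (z : modq) : modq := \pi_modq (a *: repr z).

Lemma modq_eq (u w : N) : (u - w \in modq_pred) = (\pi_modq u == \pi_modq w).
Proof. exact: Quotient.idealrBE. Qed.

Lemma modq_scale_pi a u : modq_scale a (\pi_modq u) = \pi_modq (a *: u).
Proof.
apply/eqP; rewrite -modq_eq -scalerBr rpredZ //.
by rewrite modq_eq reprK.
Qed.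

Let pi_add (u w : N) : \pi_modq u + \pi_modq w = \pi_modq (u + w).
Proof. by rewrite (raddfD (\pi_(Quotient.quot modq_pred))). Qed.

Lemma modq_scaleA a b z :
  modq_scale a (modq_scale b z) = modq_scale (a * b) z.
Proof. by rewrite modq_scale_pi scalerA. Qed.

Lemma modq_scale1 : left_id 1 modq_scale.
Proof. by move=> z; rewrite -[z]reprK modq_scale_pi scale1r. Qed.

Lemma modq_scaleDr : right_distributive modq_scale +%R.
Proof.
move=> a z t; rewrite -[z]reprK -[t]reprK.
by rewrite pi_add !modq_scale_pi pi_add scalerDr.
Qed.

Lemma modq_scaleDl z : {morph modq_scale^~ z : a b / a + b}.
Proof.
by move=> a b; rewrite -[z]reprK !modq_scale_pi pi_add scalerDl.
Qed.

HB.instance Definition _ := GRing.Zmodule_isLmodule.Build A modq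
  modq_scaleA modq_scale1 modq_scaleDr modq_scaleDl.

End QuotientModule.

Arguments modq {A} N y.

Definition regular_sequence (A : comNzRingType) (N : lmodType A) (y : seq A) :=
  smul (gen_ideal y) (setT : set N) <> setT /\
  forall k, (k < size y)%N ->
    forall z : modq N (take k y), y`_k *: z = 0 -> z = 0.

Section Ideals.
Variable A : comNzRingType.
Implicit Types I J P m : set A.

Definition is_ideal I :=
  [/\ I 0, forall a b, I a -> I b -> I (a + b) & forall a b, I b -> I (a * b)].

Definition prime_ideal P :=
  [/\ is_ideal P, P <> setT & forall a b, P (a * b) -> P a \/ P b].

Definition maximal_ideal m :=
  [/\ is_ideal m, m <> setT
    & forall J, is_ideal J -> m `<=` J -> J <> setT -> J = m].

Definition radical I : set A := [set a | exists n, I (a ^+ n)].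

Definition local_ring m :=
  maximal_ideal m /\ forall m', maximal_ideal m' -> m' = m.

Definition noetherian :=
  forall I, is_ideal I -> exists s : seq A, I = gen_ideal s.

Fixpoint ideal_exp I n : set A :=
  if n is n'.+1 then @smul A A^o I (ideal_exp I n') else setT.

(* Bijectivity of A -> lim A / I^n. *)
Definition adically_complete I :=
  (forall a, (forall n, ideal_exp I n a) -> a = 0) /\
  (forall u : nat -> A, (forall n, ideal_exp I n (u n.+1 - u n)) ->
     exists a, forall n, ideal_exp I n (a - u n)).

Definition prime_chain n (P : nat -> set A) :=
  (forall i, (i <= n)%N -> prime_ideal (P i)) /\
  (forall i, (i < n)%N -> P i `<` P i.+1).

Definition krull_dim d :=
  (exists P : nat -> set A, prime_chain d P) /\
  forall n (P : nat -> set A), prime_chain n P -> (n <= d)%N.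

Definition system_of_parameters m (y : seq A) :=
  krull_dim (size y) /\ radical (gen_ideal y) = m.

(* n = 0 in A/pA exactly when p divides n: A/pA has characteristic p. *)
Definition mixed_characteristic (p : nat) :=
  [/\ prime p, forall n, (n%:R : A) = 0 -> n = 0%N
    & forall n, gen_ideal [:: p%:R : A] n%:R <-> (p %| n)%N].

(* [c] is a choice of [a ^ eps]. *)
Definition is_rat_power (a : A) (eps : rat) (c : A) :=
  exists m n : nat, [/\ (0 < m)%N, (0 < n)%N, eps = m%:R / n%:R
                      & c ^+ n = a ^+ m].

(* A valuation with values in the totally ordered group G together with +oo;
   the value -oo of [\bar G] is excluded. *)
Definition valuation (G : realDomainType) (v : A -> \bar G) :=
  [/\ forall a, v a <> -oo%E,
      forall a, v a = +oo%E <-> a = 0,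
      forall a b, v (a * b) = (v a + v b)%E
    & forall a b, (Order.min (v a) (v b) <= v (a + b)%R)%E].

End Ideals.

Section AbsoluteIntegralClosure.
Variables (R : idomainType) (K : closedFieldType).
Variable iota : {rmorphism {fraction R} -> K}.

Definition RtoK : R -> K := iota \o @FracField.tofrac R.
HB.instance Definition _ := GRing.RMorphism.on RtoK.

Definition is_alg_closure := forall z : K, algebraicOver iota z.

Definition int_closed : {pred K} := [pred z | `[< integralOver RtoK z >]].

Lemma int_closed_subring : subring_closed int_closed.
Proof.
split=> [|x y|x y].
- by apply/asboolP/integral1.
- by move=> /asboolP xI /asboolP yI; apply/asboolP/integral_sub.
- by move=> /asboolP xI /asboolP yI; apply/asboolP/integral_mul.
Qed.

HB.instance Definition _ :=
  GRing.isSubringClosed.Build K int_closed int_closed_subring.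

(* R^+ once [is_alg_closure] holds. *)
Record Rplus := MkRplus { Rplus_val :> K; _ : Rplus_val \in int_closed }.
HB.instance Definition _ := [isSub for Rplus_val].
HB.instance Definition _ := [Choice of Rplus by <:].
HB.instance Definition _ := [SubChoice_isSubComNzRing of Rplus by <:].

Lemma RtoK_int (x : R) : RtoK x \in int_closed.
Proof. by apply/asboolP/integral_id. Qed.

Definition to_plus (x : R) : Rplus := MkRplus (RtoK_int x).

Lemma to_plus_is_zmod_morphism : zmod_morphism to_plus.
Proof. by move=> x y; apply: val_inj; rewrite /= rmorphB. Qed.

Lemma to_plus_is_monoid_morphism : monoid_morphism to_plus.
Proof.
by split=> [|x y]; apply: val_inj; rewrite /= (rmorph1, rmorphM).
Qed.

HB.instance Definition _ :=
  GRing.isZmodMorphism.Build R Rplus to_plus to_plus_is_zmod_morphism.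
HB.instance Definition _ :=
  GRing.isMonoidMorphism.Build R Rplus to_plus to_plus_is_monoid_morphism.

Variables (m : set R) (v : Rplus -> \bar rat).

(* The middle ideal is (y_1, ..., y_i)B; with i counted from 0, [y`_i] is
   y_{i+1}. *)
Definition weakly_almost_regular (B : comAlgType Rplus) (y : seq R) :=
  smul (to_plus @` m) (setT : set B) <> setT /\
  forall eps : rat, 0 < eps ->
    exists b : Rplus, (v b < eps%:E)%E /\
      forall i, (i < size y)%N ->
        let yB := smul (gen_ideal (map to_plus (take i y))) (setT : set B) in
        forall z : B, yB (to_plus y`_i *: z) -> yB (b *: z).

Definition weakly_almost_CM (B : comAlgType Rplus) :=
  exists2 y, system_of_parameters m y & weakly_almost_regular B y.

End AbsoluteIntegralClosure.

Arguments noetherian : clear implicits.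
Arguments mixed_characteristic : clear implicits.
Arguments krull_dim : clear implicits.

(* Main.v *)
(* The algebra is a product [K x C].  The factor [K] keeps [p] from being
   nilpotent and contributes nothing to [B / pB]; the factor [C] is an algebra
   of characteristic [p] killed by every [p^eps], so that the [p]-torsion of [B]
   is exactly [0 x C].  All conditions then reduce to the regularity of
   [x_2, ..., x_d] on [C] and to [(x_2, ..., x_d)C <> C].

   Let [Q] be a prime containing [p] at the bottom of a chain of primes of
   length [d - 1], and [D = R / Q].  The complete local domain [D] has a
   coefficient field [k] (lift a p-basis of the residue field) and is finite
   over [A = k[[x_2]]...[[x_d]]], which injects into [D] by Krull's height
   theorem.  A prime of [R^+] over [Q] gives a map [psi] from [R^+] to a field
   [L] containing [D].  Take for [C] the ring of sequences [nat -> L] with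
   values in a common finitely generated [A]-submodule of [L], where [z] in
   [R^+] acts as [(psi z ^ (p ^ e))_e].  Such a submodule lies in a free one,
   where regularity of [x_2^q, ..., x_d^q] can be checked on coordinates, and a
   relation [1 = sum_i x_i c_i] would put the coordinates of [1] in all the
   ideals [(x_2^q, ..., x_d^q)A], whose intersection is zero. *)
From HB Require Import structures.
Require Import Defs.
From mathcomp Require Import all_boot all_order all_algebra generic_quotient.
From mathcomp Require Import boolp classical_sets functions constructive_ereal.

Set Implicit Arguments.
Unset Strict Implicit.
Unset Printing Implicit Defensive.

Import Order.TTheory GRing.Theory Num.Theory.

Local Open Scope classical_set_scope.
Local Open Scope ring_scope.
Local Open Scope quotient_scope.

(** * Ideals and prime ideals *)

(** The obstacle is that every parameter outside [Q] is invertible in the field [L], so a constant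
    action of [R^+] on sequences would make [(x_2, ..., x_d)C] the unit ideal. With exponents
    [p ^ e] the would-be inverses [x_2 ^ (- p ^ e)] leave every finitely generated submodule as [e]
    grows, and boundedness excludes them. Integrality of [R^+] keeps all powers of [psi z] in one
    finitely generated submodule, so the action exists; it is additive because [L] has
    characteristic [p]. No Cohen-Macaulay property of [D] is needed, because a submodule of [L] can
    be enlarged to a free one by dividing basis vectors by denominators.

    The chain above [Q] matters for the injectivity of [A -> D]: a nonzero element of the kernel
    becomes, under a substitution [x_i = x_2 ^ N_i], a unit times a power of [x_2]. Then [m] would
    be minimal over [Q] and [d - 2] elements, although a chain of length [d - 1] joins [Q] to [m].

    Weak almost regularity comes from roots of [p]: a root [b] of [p] of order [N] has value
    [v(p) / N], lies in the prime over [Q], and hence kills the [p]-torsion of [B]. *)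

Lemma zorn_above (T : Type) (P : set (set T)) (X0 : set T) :
  X0 !=set0 -> P X0 ->
  (forall F : set (set T), F !=set0 -> (forall X, F X -> P X /\ X0 `<=` X) ->
     total_on F subset -> P (\bigcup_(X in F) X)) ->
  exists M, [/\ P M, X0 `<=` M & forall Y, P Y -> M `<=` Y -> Y = M].
Proof.
move=> [t0 X0t0] PX0 Pcup.
pose P' X := X = set0 \/ P X /\ X0 `<=` X.
have [F FP Ftot|M [PM Mmax]] := @Zorn_bigcup T P'.
  pose F' := [set X | F X /\ X0 `<=` X].
  have [[X F'X]|F'0] := pselect (F' !=set0); last first.
    left; apply/seteqP; split=> // t [X FX Xt].
    have [X0'|[_ X0X]] := FP _ FX; first by move: Xt; rewrite X0'.
    by case: F'0; exists X.
  have -> : \bigcup_(X in F) X = \bigcup_(X in F') X.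
    apply/seteqP; split=> t [Y FY Yt]; last by exists Y => //; case: FY.
    exists Y => //; split=> //.
    by have [Y0|[]//] := FP _ FY; move: Yt; rewrite Y0.
  right; split; last by move=> t X0t; exists X => //; case: F'X => _; exact.
  apply: Pcup; first by exists X.
    move=> Y [FY X0Y]; split=> //; have [Y0|[]//] := FP _ FY.
    by move: X0Y; rewrite Y0 => /(_ _ X0t0).
  by move=> Y Z [FY _] [FZ _]; exact: Ftot.
case: PM => [M0|[PM X0M]].
  exfalso; apply: (Mmax X0); last by right; split.
  by rewrite M0; split=> // /(_ _ X0t0).
exists M; split=> // Y PY MY; apply: contrapT => YM.
apply: (Mmax Y); last by right; split=> //; exact: subset_trans MY.
split=> // YM'; apply: YM; exact/seteqP.
Qed.

Section IdealTheory.
Variable A : comNzRingType.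
Implicit Types (I J P M : set A) (s : seq A).

Lemma ideal0 I : is_ideal I -> I 0. Proof. by case. Qed.
Lemma idealD I a b : is_ideal I -> I a -> I b -> I (a + b).
Proof. by case=> _ h _; exact: h. Qed.
Lemma idealMl I a b : is_ideal I -> I b -> I (a * b).
Proof. by case=> _ _; exact. Qed.
Lemma idealMr I a b : is_ideal I -> I a -> I (a * b).
Proof. by rewrite mulrC; exact: idealMl. Qed.
Lemma idealN I a : is_ideal I -> I a -> I (- a).
Proof. by rewrite -mulN1r; exact: idealMl. Qed.
Lemma idealB I a b : is_ideal I -> I a -> I b -> I (a - b).
Proof. by move=> hI Ia Ib; apply: idealD => //; exact: idealN. Qed.
Lemma idealBl I a b : is_ideal I -> I (a - b) -> I b -> I a.
Proof. by move=> hI ab Ib; rewrite -(subrK b a); exact: idealD. Qed.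
Lemma idealBr I a b : is_ideal I -> I (a - b) -> I a -> I b.
Proof. by move=> hI ab Ia; rewrite -(subKr a b); exact: idealB. Qed.
Lemma ideal_sum I (X : Type) (r : seq X) (Q : pred X) (F : X -> A) :
  is_ideal I -> (forall i, Q i -> I (F i)) -> I (\sum_(i <- r | Q i) F i).
Proof. by move=> [h0 hD _] h; elim/big_ind: _. Qed.
Lemma idealX I a n : is_ideal I -> I a -> (0 < n)%N -> I (a ^+ n).
Proof. by case: n => // n hI Ia _; rewrite exprS; exact: idealMr. Qed.

Lemma ideal_congrD I x x' y y' : is_ideal I ->
  I (x - x') -> I (y - y') -> I (x + y - (x' + y')).
Proof. by move=> hI Ix Iy; rewrite opprD addrACA; exact: idealD. Qed.
Lemma ideal_congrM I x x' y y' : is_ideal I ->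
  I (x - x') -> I (y - y') -> I (x * y - x' * y').
Proof.
move=> hI Ix Iy; rewrite -(subrKA (x' * y)) -mulrBl -mulrBr.
by apply: idealD => //; [exact: idealMr|exact: idealMl].
Qed.
Lemma ideal_congrX I x x' n : is_ideal I -> I (x - x') -> I (x ^+ n - x' ^+ n).
Proof.
move=> hI Ix; elim: n => [|n IH]; first by rewrite subrr; exact: ideal0.
by rewrite !exprS; exact: ideal_congrM.
Qed.

Lemma idealT_1 I : is_ideal I -> I 1 -> I = setT.
Proof.
by move=> hI I1; apply/seteqP; split=> // a _; rewrite -(mulr1 a); exact: idealMl.
Qed.

Lemma proper_ideal1 I : is_ideal I -> I <> setT -> ~ I 1.
Proof. by move=> hI IT /(idealT_1 hI). Qed.

Lemma gen_ideal_nil z : gen_ideal (nil : seq A) z <-> z = 0.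
Proof.
split=> [[c ->]|->]; first by rewrite big_ord0.
by exists (fun=> 0); rewrite big_ord0.
Qed.

Lemma gen_ideal_cons a s z :
  gen_ideal (a :: s) z <-> exists c w, gen_ideal s w /\ z = c * a + w.
Proof.
split=> [[c ->]|[c [w [[d ->] ->]]]].
  exists (c ord0), (\sum_(i < size s) c (lift ord0 i) * s`_i).
  by split; [exists (fun i => c (lift ord0 i))|rewrite big_ord_recl].
exists (fun i => oapp d c (unlift ord0 i)).
by rewrite big_ord_recl unlift_none; congr (_ + _); apply: eq_bigr => i _; rewrite liftK.
Qed.

Lemma gen_ideal_ideal s : is_ideal (gen_ideal s).
Proof.
split=> [|a b [c ->] [d ->]|a b [c ->]].
- by exists (fun=> 0); rewrite big1 // => i _; rewrite mul0r.
- by exists (fun i => c i + d i); rewrite -big_split; apply: eq_bigr => i _; rewrite mulrDl.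
- by exists (fun i => a * c i); rewrite mulr_sumr; apply: eq_bigr => i _; rewrite mulrA.
Qed.
Hint Resolve gen_ideal_ideal : core.

Lemma gen_ideal_mem s a : a \in s -> gen_ideal s a.
Proof.
elim: s => // b s IH; rewrite inE => /predU1P[->|/IH sa]; apply/gen_ideal_cons.
  by exists 1, 0; rewrite mul1r addr0; split=> //; exact: ideal0.
by exists 0, a; rewrite mul0r add0r.
Qed.

Lemma gen_ideal_sub I s : is_ideal I -> {in s, forall a, I a} -> gen_ideal s `<=` I.
Proof.
move=> hI sI z [c ->]; apply: ideal_sum => // i _; apply: idealMl => //.
by apply: sI; exact: mem_nth.
Qed.

Lemma gen_ideal_mono s t : {subset s <= t} -> gen_ideal s `<=` gen_ideal t.
Proof. by move=> st; apply: gen_ideal_sub => // a /st; exact: gen_ideal_mem. Qed.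

Definition ideal_add I J := [set z | exists a b, [/\ I a, J b & z = a + b]].

Lemma ideal_add_ideal I J : is_ideal I -> is_ideal J -> is_ideal (ideal_add I J).
Proof.
move=> hI hJ; split=> [|_ _ [a [b [Ia Jb ->]]] [c [d [Ic Jd ->]]]|e _ [a [b [Ia Jb ->]]]].
- by exists 0, 0; rewrite addr0; split=> //; exact: ideal0.
- by exists (a + c), (b + d); rewrite addrACA; split=> //; exact: idealD.
- by exists (e * a), (e * b); rewrite mulrDr; split=> //; exact: idealMl.
Qed.

Lemma ideal_addl I J : is_ideal J -> I `<=` ideal_add I J.
Proof. by move=> hJ a Ia; exists a, 0; rewrite addr0; split=> //; exact: ideal0. Qed.

Lemma ideal_addr I J : is_ideal I -> J `<=` ideal_add I J.
Proof. by move=> hJ a Ia; exists 0, a; rewrite add0r; split=> //; exact: ideal0. Qed.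

Lemma ideal_add_sub I J M : is_ideal M -> I `<=` M -> J `<=` M -> ideal_add I J `<=` M.
Proof. by move=> hM IM JM _ [a [b [/IM Ma /JM Mb ->]]]; exact: idealD. Qed.

Lemma bigcup_ideal (F : set (set A)) : F !=set0 -> (forall I, F I -> is_ideal I) ->
  total_on F subset -> is_ideal (\bigcup_(I in F) I).
Proof.
move=> [I0 FI0] FI Ftot; split=> [|a b [I IF Ia] [J JF Jb]|a b [I IF Ib]].
- by exists I0 => //; apply: ideal0; exact: FI.
- have [IJ|JI] := Ftot _ _ IF JF.
    by exists J => //; apply: idealD; [exact: FI|exact: IJ|].
  by exists I => //; apply: idealD; [exact: FI| |exact: JI].
- by exists I => //; apply: idealMl => //; exact: FI.
Qed.

Lemma noetherian_max (F : set (set A)) I0 : noetherian A ->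
  (forall I, F I -> is_ideal I) -> F I0 ->
  exists M, [/\ F M, I0 `<=` M & forall J, F J -> M `<=` J -> J = M].
Proof.
move=> noeth FI FI0; apply: zorn_above => //; first by exists 0; apply: ideal0; exact: FI.
move=> G [I GI] GF Gtot.
have hU : is_ideal (\bigcup_(X in G) X).
  by apply: bigcup_ideal => //; [exists I|move=> X /GF[/FI]].
(* The union of the chain is finitely generated, and its generators already lie in one member [Y] of
   the chain. *)
have [s sE] := noeth _ hU.
have [Y GY sY] : exists2 Y, G Y & {in s, forall a, Y a}.
  have : {in s, forall a, exists2 X, G X & X a}.
    by move=> a /gen_ideal_mem; rewrite -sE => -[X GX Xa]; exists X.
  elim: s {sE} => [|a s IH] h; first by exists I.
  have [Y GY sY] : exists2 Y, G Y & {in s, forall a, Y a}.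
    by apply: IH => b bs; apply: h; rewrite inE bs orbT.
  have [|X GX Xa] := h a; first exact: mem_head.
  have [XY|YX] := Gtot _ _ GX GY.
    by exists Y => // b; rewrite inE => /predU1P[->|/sY//]; exact: XY.
  by exists X => // b; rewrite inE => /predU1P[->//|/sY]; exact: YX.
suff -> : \bigcup_(X in G) X = Y by case: (GF _ GY).
apply/seteqP; split; last by move=> y Yy; exists Y.
by rewrite sE; apply: gen_ideal_sub => //; case: (GF _ GY) => /FI.
Qed.

Lemma noetherian_ind (Q : set A -> Prop) : noetherian A ->
  (forall I, is_ideal I ->
     (forall J, is_ideal J -> I `<=` J -> J <> I -> Q J) -> Q I) ->
  forall I, is_ideal I -> Q I.
Proof.
move=> noeth QI I hI; apply: contrapT => nQI.
have [J [[hJ nQJ] _ Jmax]] :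
    exists M, [/\ is_ideal M /\ ~ Q M, I `<=` M &
      forall J, is_ideal J /\ ~ Q J -> M `<=` J -> J = M].
  by apply: (@noetherian_max [set J | is_ideal J /\ ~ Q J]) => // J [].
apply: nQJ; apply: QI => // J' hJ' JJ' J'J; apply: contrapT => nQ.
by apply: J'J; exact: Jmax.
Qed.

Lemma prime_ideal_ideal P : prime_ideal P -> is_ideal P. Proof. by case. Qed.
Hint Resolve prime_ideal_ideal : core.

Lemma prime1 P : prime_ideal P -> ~ P 1.
Proof. by case=> hP PT _; exact: proper_ideal1. Qed.

Lemma primeM P a b : prime_ideal P -> ~ P a -> ~ P b -> ~ P (a * b).
Proof. by case=> _ _ hP Pa Pb /hP[]. Qed.

Lemma primeX P a n : prime_ideal P -> P (a ^+ n) -> P a.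
Proof.
move=> hP; elim: n => [|n IH]; first by rewrite expr0 => /(prime1 hP).
by rewrite exprS => Pa; case: hP => _ _ /(_ _ _ Pa)[].
Qed.

(** The maximality of [P] among ideals disjoint from [W] is kept in the conclusion because
    [lying_over] enlarges [P] by one element. *)
Lemma prime_avoiding I (W : set A) : is_ideal I -> W 1 ->
  (forall a b, W a -> W b -> W (a * b)) -> (forall a, I a -> ~ W a) ->
  exists P, [/\ prime_ideal P, I `<=` P, forall a, P a -> ~ W a &
    forall J, is_ideal J -> P `<=` J -> (forall a, J a -> ~ W a) -> J = P].
Proof.
move=> hI W1 WM IW.
have [||F F0 FP Ftot|P [[hP PW] IP Pmax]] :=
  @zorn_above A [set J | is_ideal J /\ forall a, J a -> ~ W a] I.
- by exists 0; exact: ideal0.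
- by [].
- split; first by apply: bigcup_ideal => // J /FP[[]].
  by move=> a [J /FP[[_ JW] _] Ja]; exact: JW.
exists P; split=> //; last by move=> J hJ PJ JW; apply: Pmax.
split=> //.
  by move=> PT; apply: (PW 1) => //; rewrite PT.
move=> a b Pab; apply: contrapT => /not_orP[Pa Pb].
have ex c : ~ P c -> exists r u, P u /\ W (u + r * c).
  move=> Pc; apply: contrapT => nex; apply: Pc.
  have hg : is_ideal (gen_ideal [:: c]) by [].
  have hJ := ideal_add_ideal hP hg.
  have <- : ideal_add P (gen_ideal [:: c]) = P.
    apply: Pmax; last exact: ideal_addl.
    split=> // x [u [w [Pu [d ->] ->]]] Wx; apply: nex.
    by exists (d ord0), u; split=> //; move: Wx; rewrite big_ord1.
  by apply: ideal_addr => //; apply: gen_ideal_mem; rewrite inE.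
have [r [u [Pu Wu]]] := ex _ Pa; have [t [w [Pw Ww]]] := ex _ Pb.
apply: (PW _ _ (WM _ _ Wu Ww)).
rewrite mulrDl; apply: idealD => //; first exact: idealMr.
rewrite mulrDr; apply: idealD => //; first exact: idealMl.
by rewrite mulrACA; exact: idealMl.
Qed.

Lemma radical_primes I a : is_ideal I ->
  (forall P, prime_ideal P -> I `<=` P -> P a) -> radical I a.
Proof.
move=> hI h; apply: contrapT => nrad.
have [||b c [i ->] [j ->]|b Ib [i bE]|P [hP IP PW _]] :=
  @prime_avoiding I [set b | exists n, b = a ^+ n].
- by [].
- by exists 0%N.
- by exists (i + j)%N; rewrite exprD.
- by apply: nrad; exists i; rewrite -bE.
- by apply: (PW a); [exact: h|exists 1%N].
Qed.

Definition minimal_prime I P :=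
  [/\ prime_ideal P, I `<=` P &
     forall Q, prime_ideal Q -> I `<=` Q -> Q `<=` P -> Q = P].

Lemma minimal_prime_below I P : prime_ideal P -> I `<=` P ->
  exists2 Q, minimal_prime I Q & Q `<=` P.
Proof.
move=> hP IP.
(* Passing to complements turns descending chains of primes into ascending ones, so a maximal
   complement gives a minimal prime. *)
pose G := [set X : set A | prime_ideal (~` X) /\ I `<=` ~` X].
have [||F F0 FP Ftot|X [[hX IX] PX Xmax]] := @zorn_above A G (~` P).
- by exists 1; exact: prime1.
- by rewrite /G /= setCK.
- have hF X : F X -> [/\ is_ideal (~` X), I `<=` ~` X & X 1].
    by move=> /FP[[hX IX] _]; split; [by case: hX|exact: IX|]; apply: contrapT; exact: (prime1 hX).
  split; last by move=> a Ia [X XF]; have [_ IX _] := hF _ XF; exact: IX.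
  split; last 1 first.
  + move=> a b nab; apply: contrapT => /not_orP[/contrapT[X XF Xa] /contrapT[Y YF Yb]].
    have [Z [ZF Za Zb]] : exists Z, [/\ F Z, Z a & Z b].
      have [XY|YX] := Ftot _ _ XF YF; first by exists Y; split=> //; exact: XY.
      by exists X; split=> //; exact: YX.
    apply: nab; exists Z => //; apply: contrapT => Zab.
    by have [[[_ _ hZ] _] _] := FP _ ZF; case: (hZ _ _ Zab).
  + split=> [[X XF X0]|a b na nb [X XF Xab]|a b nb [X XF Xab]]; have [hX _ _] := hF _ XF.
    * by case: (ideal0 hX).
    * have Xa : (~` X) a by move=> Xa; apply: na; exists X.
      have Xb : (~` X) b by move=> Xb; apply: nb; exists X.
      by case: (idealD hX Xa Xb).
    * have Xb : (~` X) b by move=> Xb; apply: nb; exists X.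
      by case: (idealMl a hX Xb).
  + have [X XF] := F0; have [_ _ X1] := hF _ XF.
    move=> E; have [] : (~` \bigcup_(i in F) i) 1 by rewrite E.
    by exists X.
have XP : ~` X `<=` P by rewrite -(setCK P); exact: subsetC.
exists (~` X) => //; split=> // Q hQ IQ QX.
rewrite -(setCK Q); congr (~` _); apply: Xmax; first by rewrite /G /= setCK.
by rewrite -(setCK X); exact: subsetC.
Qed.

End IdealTheory.
#[export] Hint Resolve gen_ideal_ideal prime_ideal_ideal : core.

(** * Krull's height theorem *)

Section IdealPowers.
Variable A : comNzRingType.
Implicit Types (I J M : set A).

Lemma smul_mem I M a b : I a -> M b -> @smul A A^o I M (a * b).
Proof.
move=> Ia Mb; exists [:: (a, b)]; last by rewrite big_seq1.
by move=> q; rewrite inE => /eqP->.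
Qed.

Lemma smul_sub I M J : is_ideal J -> (forall a b, I a -> M b -> J (a * b)) ->
  @smul A A^o I M `<=` J.
Proof.
move=> hJ h _ [s sIM ->]; rewrite big_seq; apply: ideal_sum => // q /sIM[].
exact: h.
Qed.

Lemma smul_ideal I M : is_ideal I -> is_ideal (@smul A A^o I M).
Proof.
move=> hI; split=> [|_ _ [s sI ->] [t tI ->]|a _ [s sI ->]].
- by exists [::]; rewrite ?big_nil.
- exists (s ++ t); last by rewrite big_cat.
  by move=> q; rewrite mem_cat => /orP[/sI|/tI].
- exists [seq (a * q.1, q.2) | q <- s].
    by move=> _ /mapP[q /sI[Iq Mq] ->]; split=> //; exact: idealMl.
  by rewrite big_map mulr_sumr; apply: eq_bigr => q _; exact: mulrA.
Qed.

Lemma ideal_exp_ideal I n : is_ideal I -> is_ideal (ideal_exp I n).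
Proof. by case: n => // n; exact: smul_ideal. Qed.

Lemma ideal_exp_mem I a n : I a -> ideal_exp I n (a ^+ n).
Proof. by move=> Ia; elim: n => // n IH; rewrite exprS; exact: smul_mem. Qed.

Lemma ideal_expM I a b i j : is_ideal I ->
  ideal_exp I i a -> ideal_exp I j b -> ideal_exp I (i + j) (a * b).
Proof.
move=> hI; elim: i a => [|i IH] a.
  by move=> _ hb; apply: idealMl => //; exact: ideal_exp_ideal.
move=> [s sI ->] hb; rewrite mulr_suml big_seq.
apply: ideal_sum => [|q /sI[Iq hq]]; first exact: ideal_exp_ideal.
have -> : (q.1 *: q.2 : A^o) * b = q.1 * (q.2 * b) by rewrite mulrA.
by apply: smul_mem => //; exact: IH.
Qed.

Lemma ideal_exp_le I i j : is_ideal I -> (j <= i)%N ->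
  ideal_exp I i `<=` ideal_exp I j.
Proof.
move=> hI /subnK <-; elim: (i - j)%N => // n IH a.
rewrite addSn => /=; move: a; apply: smul_sub; first exact: ideal_exp_ideal.
by move=> a b Ia /IH; apply: idealMl; exact: ideal_exp_ideal.
Qed.

Lemma ideal_exp_sub1 I n : is_ideal I -> (0 < n)%N -> ideal_exp I n `<=` I.
Proof.
move=> hI n0; apply: subset_trans (ideal_exp_le hI n0) _.
by apply: smul_sub => // a b Ia _; exact: idealMr.
Qed.

(** The product of [I] with the ideal of [s], written on the given generators so that one of them
    can be eliminated at a time. *)
Definition pspan I (s : seq A) := [set z | exists c : 'I_(size s) -> A,
  (forall i, I (c i)) /\ z = \sum_(i < size s) c i * s`_i].

Lemma pspan_cons I a s z : pspan I (a :: s) z ->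
  exists c w, [/\ I c, pspan I s w & z = c * a + w].
Proof.
case=> c [Ic ->]; exists (c ord0), (\sum_(i < size s) c (lift ord0 i) * s`_i).
by rewrite big_ord_recl; split=> //; exists (fun i => c (lift ord0 i)).
Qed.

Lemma pspan_ideal I s : is_ideal I -> is_ideal (pspan I s).
Proof.
move=> hI; split=> [|a b [c [hc ->]] [d [hd ->]]|a b [c [hc ->]]].
- exists (fun=> 0); split=> [i|]; first exact: ideal0.
  by rewrite big1 // => i _; rewrite mul0r.
- exists (fun i => c i + d i); split=> [i|]; first exact: idealD.
  by rewrite -big_split; apply: eq_bigr => i _; rewrite mulrDl.
- exists (fun i => a * c i); split=> [i|]; first exact: idealMl.
  by rewrite mulr_sumr; apply: eq_bigr => i _; rewrite mulrA.
Qed.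

Lemma pspan_mem I s a b : is_ideal I -> I a -> gen_ideal s b -> pspan I s (a * b).
Proof.
move=> hI Ia [c ->]; exists (fun i => a * c i); split=> [i|]; first exact: idealMr.
by rewrite mulr_sumr; apply: eq_bigr => i _; rewrite mulrA.
Qed.

(* Nakayama's lemma after localization at [P], with denominators cleared. *)
Lemma nakayama_at P J s : prime_ideal P -> is_ideal J ->
  {in s, forall g, exists u, ~ P u /\ ideal_add (pspan P s) J (u * g)} ->
  exists u, ~ P u /\ {in s, forall g, J (u * g)}.
Proof.
move=> hP hJ; have iP := prime_ideal_ideal hP.
elim: s => [|a s IH] h; first by exists 1; split=> //; exact: prime1.
have [u [Pu [z [y [/pspan_cons[r [w [Pr hw ->]]] Jy uE]]]]] := h _ (mem_head _ _).
(* Since [r] is in [P], the factor [u - r] stays outside [P]: up to this factor, [a] is expressed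
   through the other generators modulo [J], and the induction runs on those. *)
have Pu' : ~ P (u - r) by move=> Pur; apply: Pu; exact: idealBl Pr.
have {}uE : (u - r) * a = w + y by rewrite mulrBl uE addrC -addrA addKr.
have [|v [Pv hv]] := IH.
  move=> g sg; have [|ug [Pug]] := h g; first by rewrite inE sg orbT.
  move=> [_ [yg [/pspan_cons[rg [wg [Prg hwg ->]]] Jyg gE]]].
  exists ((u - r) * ug); split; first exact: primeM.
  exists (rg * w + (u - r) * wg), (rg * y + (u - r) * yg); split.
  - by apply: idealD; [exact: pspan_ideal|apply: idealMl..] => //; exact: pspan_ideal.
  - by apply: idealD => //; exact: idealMl.
  - rewrite -mulrA gE !mulrDr [_ * (rg * a)]mulrCA uE mulrDr -!addrA; congr (_ + _).
    by rewrite addrCA.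
exists (v * (u - r)); split; first exact: primeM.
move=> g; rewrite inE => /predU1P[->|sg]; last first.
  by rewrite mulrAC; apply: idealMr => //; exact: hv.
rewrite -mulrA uE mulrDr; apply: idealD => //; last exact: idealMl.
have [c [hc ->]] := hw; rewrite mulr_sumr; apply: ideal_sum => // i _.
by rewrite mulrCA; apply: idealMl => //; apply: hv; exact: mem_nth.
Qed.

End IdealPowers.

(** * Saturated ideals, the principal ideal theorem and chains of primes *)

Section Height.
Variable A : comNzRingType.
Hypothesis noeth : noetherian A.
Implicit Types (I J P Q : set A).

(** Saturated ideals stand for ideals of the localization at [P], and [saturation] for extension
    followed by contraction; no ring of fractions is built. *)
Definition saturated P I := forall w a, ~ P w -> I (w * a) -> I a.

Definition saturation P I := [set a | exists w, ~ P w /\ I (w * a)].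

Lemma saturation_ideal P I : prime_ideal P -> is_ideal I ->
  is_ideal (saturation P I).
Proof.
move=> hP hI; split=> [|a b [u [Pu Iu]] [w [Pw Iw]]|a b [u [Pu Iu]]].
- by exists 1; rewrite mulr0; split; [exact: prime1|exact: ideal0].
- exists (u * w); split; first exact: primeM.
  rewrite mulrDr; apply: idealD => //; last by rewrite -mulrA; exact: idealMl.
  by rewrite mulrAC; exact: idealMr.
- by exists u; split=> //; rewrite mulrCA; exact: idealMl.
Qed.

Lemma saturation_sub P I : prime_ideal P -> I `<=` saturation P I.
Proof. by move=> hP a Ia; exists 1; rewrite mul1r; split=> //; exact: prime1. Qed.

Lemma saturationP P I : prime_ideal P -> saturated P (saturation P I).
Proof.
move=> hP w a Pw [u [Pu Iu]]; exists (u * w).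
by rewrite -mulrA; split=> //; exact: primeM.
Qed.

Lemma saturation_mono P I J : I `<=` J -> saturation P I `<=` saturation P J.
Proof. by move=> IJ a [w [Pw /IJ Jw]]; exists w. Qed.

(** A maximal annihilator modulo [I] is prime. It contains [J], and it lies in [P] because [I] is
    saturated, so minimality of [P] over [J] forces it to be [P]. *)
Lemma saturation_socle J P I : is_ideal J -> minimal_prime J P ->
  is_ideal I -> J `<=` I -> saturated P I -> I <> setT ->
  exists a, ~ I a /\ forall b, P b -> I (b * a).
Proof.
move=> hJ [hP JP Pmin] hI JI Isat IT.
have := @noetherian_max A
  [set X | exists a, ~ I a /\ X = [set b | I (b * a)]] [set b | I (b * 1)] noeth.
case.
- move=> _ [a [_ ->]]; split=> [|b c /= Ib Ic|b c /= Ic].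
  + by rewrite /= mul0r; exact: ideal0.
  + by rewrite mulrDl; exact: idealD.
  + by rewrite -mulrA; exact: idealMl.
- by exists 1; split=> //; exact: proper_ideal1.
move=> _ [[a [Ia ->]] _ amax]; exists a; split=> //.
have hQ : prime_ideal [set b | I (b * a)].
  split.
  + split=> [|b c /= Ib Ic|b c /= Ic].
    * by rewrite /= mul0r; exact: ideal0.
    * by rewrite mulrDl; exact: idealD.
    * by rewrite -mulrA; exact: idealMl.
  + by move=> E; apply: Ia; rewrite -[a]mul1r; have : [set b | I (b * a)] 1 by rewrite E.
  + move=> b c /= Ibc; apply: contrapT => /not_orP[Ib Ic]; apply: Ib.
    have E : [set b | I (b * (c * a))] = [set b | I (b * a)].
      apply: amax; first by exists (c * a).
      by move=> d /= Ida; rewrite mulrCA; exact: idealMl.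
    have : [set b | I (b * (c * a))] b by rewrite /= mulrA.
    by rewrite E.
suff <- : [set b | I (b * a)] = P by [].
apply: Pmin => //.
- by move=> b Jb; apply: idealMr => //; exact: JI.
- by move=> b Ib; apply: contrapT => Pb; apply: Ia; exact: Isat Ib.
Qed.

(** Localized at [P], the quotient by [J] is Artinian. Noetherian induction on [I] adds a socle
    element [a]: the chain of the [X n + (a)] stabilizes, and the behaviour of [X n] follows
    according to whether [a] stays in the chain. *)
Lemma saturated_dcc J P I (X : nat -> set A) : is_ideal J -> minimal_prime J P ->
  is_ideal I -> J `<=` I -> saturated P I ->
  (forall n, [/\ is_ideal (X n), saturated P (X n), I `<=` X n & X n.+1 `<=` X n]) ->
  exists N, forall n, (N <= n)%N -> X n = X N.
Proof.
move=> hJ mP hI; move: I hI X; have hP : prime_ideal P by case: mP.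
apply: (noetherian_ind noeth) => I hI IH X JI Isat hX.
have anti i j : (i <= j)%N -> X j `<=` X i.
  move=> /subnK <-; elim: (j - i)%N => // n Xn; rewrite addSn.
  by apply: subset_trans _ Xn; case: (hX (n + i)%N).
have iX n : is_ideal (X n) by case: (hX n).
have IX n : I `<=` X n by case: (hX n).
have [IT|IT] := pselect (I = setT).
  have XT n : X n = setT.
    by apply/seteqP; split=> // a _; apply: IX; rewrite IT.
  by exists 0%N => n _; rewrite !XT.
have [a [Ia Pa]] := saturation_socle hJ mP hI JI Isat IT.
have ia : is_ideal (gen_ideal [:: a]) by [].
have mema : gen_ideal [:: a] a by apply: gen_ideal_mem; rewrite inE.
pose add K := saturation P (ideal_add K (gen_ideal [:: a])).
have addP K : is_ideal K ->
    [/\ is_ideal (add K), saturated P (add K), K `<=` add K & add K a].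
  move=> hK; split.
  - by apply: saturation_ideal => //; exact: ideal_add_ideal.
  - exact: saturationP.
  - exact: subset_trans (ideal_addl ia) (saturation_sub hP).
  - by apply: saturation_sub => //; exact: ideal_addr mema.
have addE K b : add K b -> exists w k r, [/\ ~ P w, K k & w * b = k + r * a].
  move=> [w [Pw [k [z [Kk [c zE] wE]]]]]; exists w, k, (c ord0); split=> //.
  by move: zE wE; rewrite big_ord1 => ->.
have [iI satI IaddI Ia'] := addP _ hI.
have [||||| N hN] := IH _ iI _ _ (fun n => add (X n)).
- exact: IaddI.
- by move=> E; apply: Ia; rewrite -E.
- exact: subset_trans JI IaddI.
- exact: satI.
- move=> n; have [i1 s1 Xa a1] := addP _ (iX n); split=> //.
    by apply: saturation_mono; apply: ideal_add_sub => //;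
      [exact: ideal_add_ideal|apply: subset_trans (IX n) _; exact: ideal_addl|exact: ideal_addr].
  apply: saturation_mono; apply: ideal_add_sub; first exact: ideal_add_ideal.
    by apply: subset_trans (anti _ _ (leqnSn n)) _; exact: ideal_addl.
  exact: ideal_addr.
have [Xa|/existsNP[M XMa]] := pselect (forall n, X n a).
  have XE n : X n = add (X n).
    apply/seteqP; split; first by case: (addP _ (iX n)).
    move=> b /addE[w [k [r [Pw Xk wE]]]]; have [_ sX _ _] := hX n.
    by apply: (sX w) => //; rewrite wE; apply: idealD => //; exact: idealMl.
  by exists N => n Nn; rewrite XE [RHS]XE; exact: hN.
(* If [a] leaves the chain, [X n] meets [I + (a)] only in [I]: a coefficient of [a] outside [P]
   would put [a] into [X M], and a coefficient in [P] sends [a] into [I]. The modular law then gives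
   stability. *)
have cap n b : (M <= n)%N -> X n b -> add I b -> I b.
  move=> Mn Xb /addE[w [k [r [Pw Ik wE]]]].
  have [Pr|Pr] := pselect (P r).
    by apply: (Isat w) => //; rewrite wE; apply: idealD => //; exact: Pa.
  case: XMa; have [_ sX _ _] := hX M; apply: (sX r) => //.
  rewrite -(addKr k (r * a)) -wE addrC; apply: idealB => //.
    by apply: idealMl => //; exact: anti Xb.
  exact: IX.
exists (N + M)%N => n NMn; apply/seteqP; split; first exact: anti.
move=> b Xb; have : add (X n) b.
  rewrite hN; last exact: leq_trans (leq_addr M N) NMn.
  rewrite -(hN (N + M)%N) ?leq_addr //.
  by have [_ _ Xadd _] := addP _ (iX (N + M)%N); exact: Xadd.
move=> /addE[w [k [r [Pw Xk wE]]]]; have [_ sX _ _] := hX n.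
apply: (sX w) => //; rewrite wE; apply: idealD => //; apply: IX.
apply: (cap (N + M)%N); first exact: leq_addl.
  rewrite -(addKr k (r * a)) -wE addrC; apply: idealB => //; first exact: idealMl.
  exact: anti Xk.
by apply: idealMl.
Qed.

(* Krull's principal ideal theorem: the descending chain of symbolic powers of
   [P1], taken modulo [y] and localized at [P2], becomes stationary. *)
Lemma principal_ideal_theorem P0 P1 P2 y :
  prime_ideal P0 -> prime_ideal P1 -> P0 `<` P1 -> P1 `<` P2 ->
  ~ minimal_prime (ideal_add P0 (gen_ideal [:: y])) P2.
Proof.
move=> hP0 hP1 [P01 P10] [P12 P21] mP2; have [hP2 JP2 P2min] := mP2.
have iP1 := prime_ideal_ideal hP1; have iP0 := prime_ideal_ideal hP0.
have iP2 := prime_ideal_ideal hP2.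
have yy : gen_ideal [:: y] y by apply: gen_ideal_mem; rewrite inE.
have P1y : ~ P1 y.
  move=> P1y; apply: P21; rewrite (P2min P1) //.
  apply: ideal_add_sub => //; apply: gen_ideal_sub => // a.
  by rewrite inE => /eqP->.
have P2y : P2 y by apply: JP2; exact: ideal_addr.
have iP1X n : is_ideal (ideal_exp P1 n) by exact: ideal_exp_ideal.
pose T n := saturation P1 (ideal_add (ideal_exp P1 n) P0).
have iT n : is_ideal (T n) by apply: saturation_ideal => //; exact: ideal_add_ideal.
have sT n : saturated P1 (T n) by exact: saturationP.
have TS n : T n.+1 `<=` T n.
  apply: saturation_mono; apply: ideal_add_sub; first exact: ideal_add_ideal.
    by apply: subset_trans _ (ideal_addl iP0); apply: ideal_exp_le.
  exact: ideal_addr.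
have P0T n : P0 `<=` T n.
  by apply: subset_trans _ (saturation_sub hP1); exact: ideal_addr.
have iy : is_ideal (gen_ideal [:: y]) by [].
pose X n := saturation P2 (ideal_add (T n) (gen_ideal [:: y])).
have iJ := ideal_add_ideal iP0 iy.
have [|||n|N hN] := @saturated_dcc _ P2
    (saturation P2 (ideal_add P0 (gen_ideal [:: y]))) X iJ mP2.
- exact: saturation_ideal.
- exact: saturation_sub.
- exact: saturationP.
- split.
  + by apply: saturation_ideal => //; exact: ideal_add_ideal.
  + exact: saturationP.
  + apply: saturation_mono; apply: ideal_add_sub; first exact: ideal_add_ideal.
      exact: subset_trans (P0T n) (ideal_addl _).
    exact: ideal_addr.
  + apply: saturation_mono; apply: ideal_add_sub; first exact: ideal_add_ideal.
      exact: subset_trans (TS n) (ideal_addl _).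
    exact: ideal_addr.
(* Locally at [P2], an element [g] of [T N] is [t + c * y] with [t] in [T N.+1]. As [y] is outside
   [P1], saturation puts [c] in [T N]; as [y] is in [P2], Nakayama at [P2] applies. *)
have TSN : T N `<=` T N.+1.
  have [s sE] := noeth (iT N).
  have sT' g : g \in s -> T N g by rewrite sE; exact: gen_ideal_mem.
  have [||u [P2u hu]] := @nakayama_at A P2 (T N.+1) s hP2.
  - exact: iT.
  - move=> g /sT' Tg.
    have : X N.+1 g.
      rewrite hN //; apply: saturation_sub => //; exact: ideal_addl.
    move=> [w [P2w [t [z [Tt [c]]]]]]; rewrite big_ord1 /= => -> wE.
    exists w; split=> //; exists (c ord0 * y), t; rewrite addrC; split=> //.
    rewrite mulrC; apply: pspan_mem => //; rewrite -sE; apply: (sT _ y) => //.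
    rewrite mulrC -(addKr t (_ * y)) -wE addrC; apply: idealB => //.
      exact: idealMl.
    exact: TS.
  rewrite [X in X `<=` _]sE; apply: gen_ideal_sub => // g /hu; apply: sT.
  by move=> P1u; apply: P2u; exact: P12.
have [s sE] := noeth (iP1X N).
(* Stationarity of [T] says that, locally at [P1], the [N]-th power of [P1] lies in the next power
   plus [P0]. Nakayama at [P1] sends it into [P0], hence [P1] too. *)
have [|g sg|u [P1u hu]] := @nakayama_at A P1 P0 s hP1.
- by [].
- have /TSN[u [P1u [z [w [hz P0w uE]]]]] : T N g.
    apply: saturation_sub => //; apply: ideal_addl => //; rewrite sE.
    exact: gen_ideal_mem.
  exists u; split=> //; exists z, w; split=> //.
  move: z hz {uE}; apply: smul_sub; first exact: pspan_ideal.
  by move=> a b P1a hb; apply: pspan_mem => //; rewrite -sE; exact: hb.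
apply: P10 => a P1a; apply: (@primeX _ _ _ N) => //.
have : gen_ideal s (a ^+ N) by rewrite -sE; exact: ideal_exp_mem.
move: (a ^+ N); apply: gen_ideal_sub => // g /hu P0ug.
have [_ _ /(_ _ _ P0ug)[/P01|]//] := hP0.
Qed.

Lemma prime_chain_le n (P : nat -> set A) i j : prime_chain n P ->
  (i <= j <= n)%N -> P i `<=` P j.
Proof.
move=> [_ hP] /andP[ij]; rewrite -(subnK ij); elim: (j - i)%N => [_|k IH kn].
  exact: subset_refl.
by apply: subset_trans _ (properW (hP _ kn)); apply: IH; exact: ltnW.
Qed.

(** The entry of [y] is moved down one step at a time: a prime without [y] just below the top is
    replaced by a minimal prime over its predecessor and [y], which is not the top by
    [principal_ideal_theorem]. *)
Lemma prime_chain_lift l (P : nat -> set A) y : prime_chain l.+1 P -> P l.+1 y ->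
  exists Q : nat -> set A, [/\ prime_chain l.+1 Q, Q 0%N = P 0%N, Q l.+1 = P l.+1 & Q 1%N y].
Proof.
elim: l P => [|l IH] P cP Py; first by exists P.
have [hP sP] := cP.
have [P' [hP' P'y lP' P'l]] : exists P', [/\ prime_ideal P', P' y, P l `<` P' & P' `<` P l.+2].
  have [Ply|Ply] := pselect (P l.+1 y).
    by exists (P l.+1); split=> //; [exact: hP|exact: sP|exact: sP].
  have iPl : is_ideal (P l) by apply: prime_ideal_ideal; apply: hP; rewrite ltnW.
  have iy : is_ideal (gen_ideal [:: y]) by [].
  have yy : gen_ideal [:: y] y by apply: gen_ideal_mem; rewrite inE.
  have iP2 : is_ideal (P l.+2) by apply: prime_ideal_ideal; exact: hP.
  have [||Q mQ QP] := @minimal_prime_below A (ideal_add (P l) (gen_ideal [:: y])) (P l.+2).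
  - exact: hP.
  - apply: ideal_add_sub => //; first by apply: (prime_chain_le cP); rewrite leqnn andbT ltnW.
    by apply: gen_ideal_sub => // a; rewrite inE => /eqP->.
  have [hQ IQ Qmin] := mQ.
  have Qy : Q y by apply: IQ; exact: ideal_addr.
  exists Q; split=> //.
  - split; first by apply: subset_trans _ IQ; exact: ideal_addl.
    move=> Ql; apply: Ply; apply: (prime_chain_le cP (i := l)); last exact: Ql.
    by rewrite leqnSn /= ltnW.
  - split=> // PQ; have QE : Q = P l.+2 by apply/seteqP.
    rewrite QE in mQ; apply: (@principal_ideal_theorem _ (P l.+1)) mQ.
    + by apply: hP; rewrite ltnW.
    + by apply: hP; rewrite ltnW.
    + by apply: sP; rewrite ltnW.
    + exact: sP.
pose R i := if i == l.+1 then P' else P i.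
have cR : prime_chain l.+1 R.
  split=> i il; rewrite /R.
    by case: eqP => // _; apply: hP; exact: ltnW.
  rewrite ltn_eqF //; case: eqP => [[->]//|_].
  by apply: sP; exact: ltnW.
have [|Q [cQ Q0 Ql Qy]] := IH R cR; first by rewrite /R eqxx.
exists (fun i => if i == l.+2 then P l.+2 else Q i); rewrite eqxx /=; split=> //.
have [hQ sQ] := cQ; split=> i il.
  case: eqP => [_|/eqP il']; first exact: hP.
  by apply: hQ; move: il; rewrite leq_eqVlt (negbTE il').
rewrite ltn_eqF //; case: eqP => [[->]|/eqP il'].
  by rewrite Ql /R eqxx.
by apply: sQ; move: il; rewrite ltnS leq_eqVlt => /predU1P[E|//]; rewrite E eqxx in il'.
Qed.

(** The base prime [P 0] plays the role of a quotient ring. Once the chain is arranged so that its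
    prime of index 1 contains [y], that prime is the base for the remaining generators. *)
Theorem height_theorem (ys : seq A) l (P : nat -> set A) : prime_chain l P ->
  minimal_prime (ideal_add (P 0%N) (gen_ideal ys)) (P l) -> (l <= size ys)%N.
Proof.
elim: ys l P => [|y ys IH] [//|l] P cP mP; have [hP sP] := cP; have [hPl JPl Pmin] := mP.
  have := sP 0%N isT => -[P01 P10].
  have P0l : P 0%N = P l.+1.
    apply: Pmin; first exact: hP.
      have iP0 : is_ideal (P 0%N) by apply: prime_ideal_ideal; exact: hP.
      by apply: ideal_add_sub => //; exact: gen_ideal_sub.
    by apply: (prime_chain_le cP); rewrite /= leqnn.
  by case: P10; rewrite P0l; apply: (prime_chain_le cP); rewrite /= leqnn.
have iP0 : is_ideal (P 0%N) by apply: prime_ideal_ideal; exact: hP.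
have [|Q [cQ Q0 Ql Qy]] := prime_chain_lift cP (y := y).
  by apply: JPl; apply: ideal_addr => //; apply: gen_ideal_mem; exact: mem_head.
have [hQ sQ] := cQ.
rewrite ltnS; apply: (IH l (fun i => Q i.+1)).
  by split=> i il; [apply: hQ|apply: sQ].
have iQ1 : is_ideal (Q 1%N) by apply: prime_ideal_ideal; exact: hQ.
rewrite Ql; split=> //.
  apply: ideal_add_sub => //; first exact: prime_ideal_ideal.
    by rewrite -Ql; apply: (prime_chain_le cQ); rewrite /= leqnn.
  apply: subset_trans _ JPl; apply: subset_trans _ (ideal_addr iP0).
  by apply: gen_ideal_mono => a ays; rewrite inE ays orbT.
move=> P' hP' JP' P'P; apply: Pmin => //.
have iys : is_ideal (gen_ideal ys) by [].
have Q1P' : Q 1%N `<=` P' by apply: subset_trans _ JP'; exact: ideal_addl.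
apply: ideal_add_sub; first exact: prime_ideal_ideal.
  by apply: subset_trans _ Q1P'; rewrite -Q0; case: (sQ 0%N isT).
apply: gen_ideal_sub; first exact: prime_ideal_ideal.
move=> a; rewrite inE => /predU1P[->|ays]; first exact: Q1P'.
by apply: JP'; apply: ideal_addr => //; exact: gen_ideal_mem.
Qed.

End Height.

(** * Prime avoidance and local rings *)

Section Avoidance.
Variable A : comNzRingType.
Implicit Types (I J M P Q : set A).

Lemma noetherian_primes I : noetherian A -> is_ideal I -> exists s : seq (set A),
  {in s, forall P, prime_ideal P /\ I `<=` P} /\
  forall P, prime_ideal P -> I `<=` P -> exists2 Q, Q \in s & Q `<=` P.
Proof.
move=> noeth; move: I; apply: (noetherian_ind noeth) => I hI IH.
have [hP|nP] := pselect (prime_ideal I).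
  exists [:: I]; split=> [P|P _ IP]; first by rewrite inE => /eqP->; split.
  by exists I; rewrite ?inE.
have [IT|IT] := pselect (I = setT).
  exists [::]; split=> // P hP IP; case: (prime1 hP).
  by apply: IP; rewrite IT.
have [a [b [Iab Ia Ib]]] : exists a b, [/\ I (a * b), ~ I a & ~ I b].
  apply: contrapT => nab; apply: nP; split=> // a b Iab; apply: contrapT => /not_orP[Ia Ib].
  by apply: nab; exists a, b.
have ext c : ~ I c -> exists s : seq (set A), {in s, forall P, prime_ideal P /\ I `<=` P} /\
    forall P, prime_ideal P -> I `<=` P -> P c -> exists2 Q, Q \in s & Q `<=` P.
  move=> Ic; have ic : is_ideal (gen_ideal [:: c]) by [].
  have cc : gen_ideal [:: c] c by apply: gen_ideal_mem; rewrite inE.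
  have [|||s [hs sP]] := IH (ideal_add I (gen_ideal [:: c])).
  - exact: ideal_add_ideal.
  - exact: ideal_addl.
  - by move=> E; apply: Ic; rewrite -E; exact: ideal_addr.
  exists s; split=> [P /hs[hP cP]|P hP IP Pc].
    by split=> //; apply: subset_trans cP; exact: ideal_addl.
  apply: sP => //; apply: ideal_add_sub => //.
    exact: prime_ideal_ideal.
  by apply: gen_ideal_sub => [|x]; [exact: prime_ideal_ideal|rewrite inE => /eqP->].
have [s [hs sP]] := ext _ Ia; have [t [ht tP]] := ext _ Ib.
exists (s ++ t); split=> [P|P hP IP]; first by rewrite mem_cat => /orP[/hs|/ht].
have [_ _ /(_ _ _ (IP _ Iab))[Pa|Pb]] := hP.
  by have [Q Qs QP] := sP _ hP IP Pa; exists Q; rewrite ?mem_cat ?Qs.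
by have [Q Qs QP] := tP _ hP IP Pb; exists Q; rewrite ?mem_cat ?Qs ?orbT.
Qed.

Lemma prime_avoidance M (s : seq (set A)) : is_ideal M ->
  {in s, forall P, prime_ideal P /\ ~ M `<=` P} ->
  exists2 x, M x & {in s, forall P, ~ P x}.
Proof.
move=> hM; have [n] := ubnP (size s); elim: n s => // n IH [|P s] /=.
  by exists 0 => //; exact: ideal0.
rewrite ltnS => sn hs.
have [[Q Qs QP]|incomp] := pselect (exists2 Q, Q \in s & Q `<=` P).
  have sub x : x \in P :: rem Q s -> x \in P :: s.
    by rewrite !inE => /orP[->//|/mem_rem->]; rewrite orbT.
  have [||x Mx xs] := IH (P :: rem Q s).
  - by rewrite /= size_rem // prednK //; case: s Qs {hs sn sub}.
  - by move=> T /sub/hs.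
  exists x => // T; have Px : ~ P x by apply: xs; exact: mem_head.
  rewrite inE => /predU1P[->//|]; rewrite (perm_mem (perm_to_rem Qs)).
  rewrite inE => /predU1P[->|Ts]; first by move=> /QP.
  by apply: xs; rewrite inE Ts orbT.
have [|x Mx xs] := IH _ sn; first by move=> Q Qs; apply: hs; rewrite inE Qs orbT.
have [Px|Px] := pselect (P x); last first.
  by exists x => // Q; rewrite inE => /predU1P[->|/xs].
have [hP MP] := hs _ (mem_head _ _).
(* No prime of [s] lies inside [P] here, so a product of elements of these primes can avoid [P].
   Adding [a * z] to [x] moves it out of [P] without changing it modulo the others. *)
have [z [Pz sz]] : exists z, ~ P z /\ {in s, forall Q, Q z}.
  have : {in s, forall Q, is_ideal Q /\ ~ Q `<=` P}.
    move=> Q Qs; split; last by move=> QP; apply: incomp; exists Q.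
    by apply: prime_ideal_ideal; case: (hs Q) => //; rewrite inE Qs orbT.
  elim: (s) => [|Q t IHt] ht; first by exists 1; split=> //; exact: prime1.
  have [|z [Pz tz]] := IHt.
    by move=> Q' Q't; apply: ht; rewrite inE Q't orbT.
  have [hQ /existsNP[q /not_implyP[Qq Pq]]] := ht _ (mem_head _ _).
  exists (q * z); split; first exact: primeM.
  move=> Q'; rewrite inE => /predU1P[->|Q't]; first exact: idealMr.
  by apply: idealMl; [case: (ht Q'); rewrite // inE Q't orbT|exact: tz].
have /existsNP[a /not_implyP[Ma Pa]] := MP.
have iP := prime_ideal_ideal hP.
exists (x + a * z); first by apply: idealD => //; exact: idealMr.
move=> Q; rewrite inE => /predU1P[->|Qs].
  by rewrite -[x]opprK addrC => /(idealBl iP)/(_ (idealN iP Px)); exact: primeM.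
have [hQ _] : prime_ideal Q /\ ~ M `<=` Q by apply: hs; rewrite inE Qs orbT.
have iQ := prime_ideal_ideal hQ.
move=> Qxz; apply: (xs _ Qs); rewrite -(addrK (a * z) x); apply: idealB => //.
by apply: idealMl => //; exact: sz.
Qed.

Lemma maximal_ideal_prime M : maximal_ideal M -> prime_ideal M.
Proof.
move=> [hM MT Mmax].
have [||a Ma a1|P [hP MP _ _]] := @prime_avoiding A M [set 1] hM.
- by [].
- by move=> a b /= -> ->; rewrite mul1r.
- by case: (proper_ideal1 hM MT); rewrite -a1.
by rewrite -(Mmax P) //; [exact: prime_ideal_ideal|case: hP].
Qed.

Hypothesis noeth : noetherian A.

Lemma local_sub (m I : set A) : local_ring m -> is_ideal I -> I <> setT -> I `<=` m.
Proof.
move=> [hm mU] hI IT.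
have [J [[hJ JT] IJ Jmax]] : exists J, [/\ is_ideal J /\ J <> setT, I `<=` J &
    forall K, is_ideal K /\ K <> setT -> J `<=` K -> K = J].
  by apply: (@noetherian_max A [set J | is_ideal J /\ J <> setT]) => // J [].
by rewrite -(mU J) //; split=> // K hK JK KT; apply: Jmax.
Qed.

Lemma local_unit (m : set A) a : local_ring m -> ~ m a -> exists b, b * a = 1.
Proof.
move=> hm ma; have ia : is_ideal (gen_ideal [:: a]) by [].
have aa : gen_ideal [:: a] a by apply: gen_ideal_mem; rewrite inE.
have [E|/(local_sub hm ia)/(_ _ aa)//] := pselect (gen_ideal [:: a] = setT).
have : gen_ideal [:: a] 1 by rewrite E.
by move=> [c]; rewrite big_ord1 /= => E1; exists (c ord0).
Qed.

Lemma radical_minimal (m : set A) s : local_ring m -> minimal_prime (gen_ideal s) m ->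
  radical (gen_ideal s) = m.
Proof.
move=> hm [pm sm mmin]; apply/seteqP; split=> a.
  by move=> [n /sm]; exact: primeX.
move=> ma; apply: radical_primes => // P hP sP.
by rewrite (mmin P) //; apply: local_sub => //; case: hP.
Qed.

(* The ideal [m] itself may serve as the top of any chain of primes. *)
Lemma local_chain_le (m : set A) s n (P : nat -> set A) : local_ring m ->
  minimal_prime (gen_ideal s) m -> prime_chain n P -> (n <= size s)%N.
Proof.
move=> hm [pm sm mmin]; case: n => // n [hP sP].
have Pm i : (i <= n.+1)%N -> P i `<=` m.
  by move=> ni; have [iP PT _] := hP _ ni; exact: local_sub.
pose Q i := if i == n.+1 then m else P i.
apply: (height_theorem noeth (P := Q)); rewrite /Q ?eqxx /=.
  split=> i ni; first by case: eqP => // _; exact: hP.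
  rewrite ltn_eqF //; case: eqP => [[->]|_]; last exact: sP.
  have [Pn Pn'] := sP n (leqnn _); split; first exact: subset_trans Pn (Pm _ _).
  by move=> mP; apply: Pn'; apply: subset_trans mP; exact: Pm.
have iP0 : is_ideal (P 0%N) by apply: prime_ideal_ideal; exact: hP.
split=> //; first by apply: ideal_add_sub; [exact: prime_ideal_ideal|exact: Pm|].
move=> Q' hQ' addQ' Q'm; apply: mmin => //; apply: subset_trans _ addQ'.
exact: ideal_addr.
Qed.

End Avoidance.

(** * Systems of parameters and the Krull intersection theorem *)

Section SystemOfParameters.
Variables (A : idomainType) (m : set A) (p : A).
Hypotheses (noeth : noetherian A) (hm : local_ring m) (mp : m p) (p0 : p <> 0).
Implicit Types (P Q : set A) (s : seq A).

(** The invariant of the construction. It concerns every prime over [s], not only [m], so that it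
    can be applied to a minimal prime that misses the next parameter; the condition at index 1
    provides the prime [Q] containing [p]. *)
Let has_chains s := forall P, prime_ideal P -> gen_ideal s `<=` P ->
  exists C : nat -> set A, [/\ prime_chain (size s) C, C (size s) = P & C 1%N p].

Let pm : prime_ideal m. Proof. by apply: maximal_ideal_prime; case: hm. Qed.

Let has_chains1 : has_chains [:: p].
Proof.
move=> P hP pP; have Pp : P p by apply: pP; apply: gen_ideal_mem; rewrite inE.
have hz : prime_ideal [set 0 : A].
  split.
  - split=> [//|a b /= -> ->|a b /= ->]; by rewrite ?addr0 ?mulr0.
  - move=> E; have /eqP : [set 0 : A] 1 by rewrite E.
    by rewrite oner_eq0.
  - by move=> a b /= /eqP; rewrite mulf_eq0 => /orP[] /eqP; [left|right].
exists (fun i => if i is 0%N then [set 0] else P); split=> //.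
split=> [[|[|i]]|[|i]] //= _; split=> [a /= ->|P0]; first exact: ideal0 (prime_ideal_ideal hP).
exact/p0/P0.
Qed.

(** The new element [x] avoids the finitely many listed primes over [s] other than [m]. A prime over
    [s] and [x] is then strictly above a minimal prime of [s], whose chain it extends. *)
Let has_chains_rcons s : has_chains s -> {in s, forall x, m x} -> (0 < size s)%N ->
  ~ minimal_prime (gen_ideal s) m ->
  exists x, m x /\ has_chains (rcons s x).
Proof.
move=> hs sm s0 nmin.
have [t [ht tP]] := noetherian_primes noeth (gen_ideal_ideal s).
have im := prime_ideal_ideal pm.
have [P|x mx xt] := @prime_avoidance A m [seq P <- t | ~~ `[< m `<=` P >]] im.
  by rewrite mem_filter => /andP[/asboolPn mP /ht[]].
exists x; split=> // P hP sxP.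
have sP : gen_ideal s `<=` P.
  by apply: subset_trans _ sxP; apply: gen_ideal_mono => a sa; rewrite mem_rcons inE sa orbT.
have Px : P x by apply: sxP; apply: gen_ideal_mem; rewrite mem_rcons mem_head.
have [Q mQ QP] := minimal_prime_below hP sP; have [hQ sQ Qmin] := mQ.
have [C [[hC sC] CQ C1]] := hs _ hQ sQ.
have Qx : ~ Q x.
  have mnQ : ~ m `<=` Q.
    move=> mQ'; apply: nmin; suff -> : m = Q by [].
    apply/seteqP; split=> //; apply: local_sub => //; [exact: prime_ideal_ideal|by case: hQ].
  have [Q' Q't Q'Q] := tP _ hQ sQ.
  have [hQ' sQ'] := ht _ Q't; apply: xt; rewrite mem_filter -(Qmin Q') // Q't andbT.
  by apply/asboolPn; rewrite (Qmin Q').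
exists (fun i => if i == (size s).+1 then P else C i); rewrite size_rcons eqxx.
split=> //; last by case: (size s) s0.
split=> i il.
  by case: eqP => // /eqP il'; apply: hC; move: il; rewrite leq_eqVlt (negbTE il').
rewrite ltn_eqF //; case: eqP => [[->]|/eqP il'].
  by rewrite CQ; split=> // PQ; exact/Qx/PQ.
by apply: sC; rewrite ltn_neqAle -eqSS il'.
Qed.

Lemma system_of_parameters_chain : exists (x : seq A) (C : nat -> set A),
  [/\ system_of_parameters m (p :: x), minimal_prime (gen_ideal (p :: x)) m,
      prime_chain (size x).+1 C, C (size x).+1 = m & C 1%N p].
Proof.
have im := prime_ideal_ideal pm.
have [g mE] := noeth im.
have bound s : has_chains s -> {in s, forall x, m x} -> (size s <= size g)%N.
  move=> hs sm; have [|C [cC Cm _]] := hs m pm; first exact: gen_ideal_sub.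
  apply: local_chain_le cC; [exact: noeth|exact: hm|].
  by rewrite -mE; split=> // P hP mP Pm; exact/seteqP.
suff [x [xm hx xmin]] : exists x, [/\ {in p :: x, forall a, m a}, has_chains (p :: x) &
    minimal_prime (gen_ideal (p :: x)) m].
  have [|C [cC Cm Cp]] := hx m pm; first exact: gen_ideal_sub.
  exists x, C; split=> //; split; last exact: radical_minimal.
  by split; [exists C|move=> k P cP; exact: (local_chain_le noeth hm xmin cP)].
(* By the height theorem a generating list [g] of [m] bounds the number of parameters, so the
   construction stops, and it can only stop when [m] is minimal. *)
suff ext n x : (size g - size (p :: x) < n)%N -> {in p :: x, forall a, m a} ->
    has_chains (p :: x) -> exists y, [/\ {in p :: y, forall a, m a},
    has_chains (p :: y) & minimal_prime (gen_ideal (p :: y)) m].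
  by apply: (ext _ [::] (ltnSn _)) => // a; rewrite inE => /eqP->.
elim: n x => // n IH x xn xm hx.
have [mmin|nmin] := pselect (minimal_prime (gen_ideal (p :: x)) m); first by exists x.
have [y [my hy]] := has_chains_rcons hx xm isT nmin.
have ym : {in p :: rcons x y, forall a, m a}.
  by move=> a; rewrite -rcons_cons mem_rcons inE => /predU1P[->|/xm].
have := bound _ hy ym; rewrite /= size_rcons => h.
apply: (IH (rcons x y)) => //; rewrite /= size_rcons.
by move: xn; rewrite ltnS /= => /(leq_trans _); apply; rewrite ltn_sub2l.
Qed.

End SystemOfParameters.

(** * Powers of ideals inside a radical and the Krull intersection theorem *)

Section KrullIntersection.
Variable A : comNzRingType.
Hypothesis noeth : noetherian A.
Implicit Types (I J M P Q : set A).

Lemma ideal_exp_mono I J n : I `<=` J -> ideal_exp I n `<=` ideal_exp J n.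
Proof.
move=> IJ; elim: n => // n IH _ [s sI ->]; exists s => // q /sI[Iq Iq2].
by split; [exact: IJ|exact: IH].
Qed.

Lemma ideal_expD_sub I i j : is_ideal I ->
  ideal_exp I (i + j) `<=` @smul A A^o (ideal_exp I i) (ideal_exp I j).
Proof.
move=> hI; have iX k : is_ideal (ideal_exp I k) by exact: ideal_exp_ideal.
elim: i => [|i IH] a; first by move=> ha; rewrite -[a]mul1r; exact: smul_mem.
rewrite addSn /=; move: a; apply: smul_sub; first exact: smul_ideal (iX i.+1).
move=> a b Ia /IH; move: b.
suff : @smul A A^o (ideal_exp I i) (ideal_exp I j) `<=`
   [set b | @smul A A^o (ideal_exp I i.+1) (ideal_exp I j) (a * b)] by [].
have hS := smul_ideal (ideal_exp I j) (iX i.+1).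
apply: smul_sub.
  split=> [|b c /= hb hc|b c /= hc].
  - by rewrite /= mulr0; exact: ideal0.
  - by rewrite mulrDr; exact: idealD.
  - by rewrite mulrCA; exact: idealMl.
by move=> b c hb hc /=; rewrite mulrA; apply: smul_mem => //; exact: smul_mem.
Qed.

Lemma ideal_exp_exp I t n : is_ideal I ->
  ideal_exp I (n * t) `<=` ideal_exp (ideal_exp I t) n.
Proof.
move=> hI; elim: n => // n IH a; rewrite mulSn => /(ideal_expD_sub hI).
move: a; apply: smul_sub; first exact: ideal_exp_ideal (ideal_exp_ideal _ hI).
by move=> a b Ia /IH; exact: smul_mem.
Qed.

Lemma ideal_exp_add a J n : is_ideal J ->
  ideal_exp (ideal_add (gen_ideal [:: a]) J) n `<=` ideal_add (gen_ideal [:: a ^+ n]) J.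
Proof.
move=> hJ; have ig b : is_ideal (gen_ideal [:: b]) by [].
have iS b : is_ideal (ideal_add (gen_ideal [:: b]) J) by exact: ideal_add_ideal.
have aa b : gen_ideal [:: b] b by apply: gen_ideal_mem; rewrite inE.
elim: n => [|n IH].
  move=> b _; rewrite -[b]mulr1; apply: idealMl => //; apply: ideal_addl => //.
apply: smul_sub => // b c [x [y [[d ->] Jy ->]]] /IH[x' [y' [[d' ->] Jy' ->]]].
rewrite !big_ord1 /= mulrDl mulrDr -!addrA; apply: idealD => //.
  by apply: ideal_addl => //; rewrite mulrACA -exprS; exact: idealMl.
by apply: ideal_addr => //; apply: idealD => //; [exact: idealMl|exact: idealMr].
Qed.

Lemma ideal_exp_add_gen a J K t : is_ideal J -> is_ideal K ->
  ideal_exp J t `<=` K ->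
  ideal_exp (ideal_add (gen_ideal [:: a]) J) t `<=` ideal_add (gen_ideal [:: a]) K.
Proof.
move=> hJ hK JK; have ia : is_ideal (gen_ideal [:: a]) by [].
have iJ n : is_ideal (ideal_exp J n) by exact: ideal_exp_ideal.
suff h n : ideal_exp (ideal_add (gen_ideal [:: a]) J) n `<=`
    ideal_add (gen_ideal [:: a]) (ideal_exp J n).
  apply: subset_trans (h t) _; apply: ideal_add_sub; first exact: ideal_add_ideal.
    exact: ideal_addl.
  by apply: subset_trans JK _; exact: ideal_addr.
elim: n => [|n IH]; first by move=> b _; exact: ideal_addr.
apply: smul_sub; first exact: ideal_add_ideal.
move=> b c [x [y [ax Jy ->]]] /IH[x' [y' [ax' Jy' ->]]].
rewrite mulrDl [y * _]mulrDr; apply: idealD; first exact: ideal_add_ideal.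
  by apply: ideal_addl => //; exact: idealMr.
apply: idealD; first exact: ideal_add_ideal.
  by apply: ideal_addl => //; exact: idealMl.
by apply: ideal_addr => //; exact: smul_mem.
Qed.

(** If [(s)^t] and [a ^ n] are in [Q], then [((a) + (s))^t] lies in [(a) + Q], whose [n]-th power
    lies in [(a ^ n) + Q]; hence the exponent [n * t]. *)
Lemma radical_exp_sub s Q : is_ideal Q -> {in s, forall a, radical Q a} ->
  exists t, ideal_exp (gen_ideal s) t `<=` Q.
Proof.
move=> hQ; elim: s => [|a s IH] hs.
  by exists 1%N; apply: smul_sub => // b c /gen_ideal_nil-> _; rewrite mul0r; exact: ideal0.
have [|t tQ] := IH; first by move=> b sb; apply: hs; rewrite inE sb orbT.
have [n nQ] := hs _ (mem_head _ _).
have ia (b : A) : is_ideal (gen_ideal [:: b]) by [].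
have iS : is_ideal (gen_ideal (a :: s)) by [].
exists (n * t)%N; apply: subset_trans (ideal_exp_exp iS) _.
apply: (@subset_trans _ (ideal_exp (ideal_add (gen_ideal [:: a]) Q) n)).
  apply: ideal_exp_mono.
  apply: (subset_trans _ (ideal_exp_add_gen (gen_ideal_ideal s) hQ tQ)).
  apply: ideal_exp_mono; apply: gen_ideal_sub; first exact: ideal_add_ideal.
  move=> b; rewrite inE => /predU1P[->|sb].
    by apply: ideal_addl => //; apply: gen_ideal_mem; rewrite inE.
  by apply: ideal_addr => //; exact: gen_ideal_mem.
apply: subset_trans (ideal_exp_add hQ) _; apply: ideal_add_sub => //.
by apply: gen_ideal_sub => // b; rewrite inE => /eqP->.
Qed.

(* [Q] is chosen maximal with [Q] and [N] meeting in [m N + J]; some power of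
   [m] lies in [Q], so [N] is contained in [m N + J] and Nakayama applies. *)
Lemma krull_closed (m : set A) J z : local_ring m -> is_ideal J ->
  (forall n, ideal_add J (ideal_exp m n) z) -> J z.
Proof.
move=> hm hJ; have pm : prime_ideal m by apply: maximal_ideal_prime; case: hm.
have im := prime_ideal_ideal pm.
have iX n : is_ideal (ideal_exp m n) by exact: ideal_exp_ideal.
have iA n : is_ideal (ideal_add J (ideal_exp m n)) by exact: ideal_add_ideal.
pose N : set A := [set a | forall n, ideal_add J (ideal_exp m n) a].
have iN : is_ideal N.
  split=> [n|a b Na Nb n|a b Nb n]; first exact: ideal0.
    by apply: idealD.
  by apply: idealMl.
pose K := ideal_add (@smul A A^o m N) J.
have iS : is_ideal (@smul A A^o m N) by exact: smul_ideal.
have iK : is_ideal K by exact: ideal_add_ideal.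
have [Q [[iQ JQ NQK] KQ Qmax]] : exists Q, [/\
    [/\ is_ideal Q, J `<=` Q & Q `&` N `<=` K], K `<=` Q &
    forall Q', [/\ is_ideal Q', J `<=` Q' & Q' `&` N `<=` K] -> Q `<=` Q' -> Q' = Q].
  apply: (@noetherian_max A [set Q | [/\ is_ideal Q, J `<=` Q & Q `&` N `<=` K]]) => //.
    by move=> I [].
  by split=> //; exact: ideal_addr.
have mrad x : m x -> radical Q x.
  move=> mx; have iC k : is_ideal [set r | Q (r * x ^+ k)].
    split=> [|a b /= Qa Qb|a b /= Qb].
    - by rewrite /= mul0r; exact: ideal0.
    - by rewrite mulrDl; exact: idealD.
    - by rewrite -mulrA; exact: idealMl.
  (* The colon ideals of [Q] by the powers of [x] ascend; [k] is where they stop. Maximality of [Q]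
     will show that [x ^ k] is in [Q]. *)
  have [_ [[k ->] _ kmax]] := @noetherian_max A
    [set X | exists k, X = [set r | Q (r * x ^+ k)]] [set r | Q (r * x ^+ 0)] noeth
    ltac:(by move=> _ [k ->]) ltac:(by exists 0%N).
  exists k.
  have ik : is_ideal (gen_ideal [:: x ^+ k]) by [].
  suff <- : ideal_add Q (gen_ideal [:: x ^+ k]) = Q.
    by apply: ideal_addr => //; apply: gen_ideal_mem; rewrite inE.
  apply: Qmax; last exact: ideal_addl.
  split; first exact: ideal_add_ideal.
    by apply: subset_trans JQ _; exact: ideal_addl.
  move=> y [[q [r [Qq [c]]]]]; rewrite big_ord1 /= => -> -> Ny.
  apply: NQK; split=> //; apply: idealD => //.
  (* For [y = q + c * x ^ k] in [N], the product [x * y] is in [m N], hence in [Q], which gives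
     [c * x ^ k.+1] in [Q]; the choice of [k] lowers the exponent. *)
  suff : [set r | Q (r * x ^+ k.+1)] (c ord0).
    rewrite (kmax [set r | Q (r * x ^+ k.+1)]) //; first by exists k.+1.
    by move=> d /= Qd; rewrite exprS mulrCA; exact: idealMl.
  rewrite /= exprS mulrCA -(addKr (x * q) (x * _)) -mulrDr addrC.
  apply: idealB => //; last exact: idealMl.
  by apply: KQ; apply: ideal_addl => //; exact: smul_mem.
have [g mE] := noeth im; have [s NE] := noeth iN.
have [t mtQ] : exists t, ideal_exp m t `<=` Q.
  rewrite mE; apply: radical_exp_sub => // a ga; apply: mrad; rewrite mE.
  exact: gen_ideal_mem.
have NK : N `<=` K.
  move=> a Na; apply: NQK; split=> //; have [b [c [/JQ Qb /mtQ Qc ->]]] := Na t.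
  exact: idealD.
have [h sh|u [mu hu]] := @nakayama_at A m J s pm hJ.
  exists 1; split; first exact: prime1.
  rewrite mul1r; have /NK[a [b [ha Jb ->]]] : N h by rewrite NE; exact: gen_ideal_mem.
  exists a, b; split=> //; move: a ha; apply: smul_sub; first exact: pspan_ideal.
  by move=> a c ma; rewrite NE; exact: pspan_mem.
move=> Nz; have : gen_ideal s z by rewrite -NE.
have [v uv] := local_unit noeth hm mu.
move: z {Nz}; apply: gen_ideal_sub => // h /hu Juh.
by rewrite -[h]mul1r -uv -mulrA; exact: idealMl.
Qed.

End KrullIntersection.

(** * Residue domains and lying over *)

Section PrimeQuotient.
Variable R : comNzRingType.

(** The proof [hP] is a parameter so that the ideal structure, which includes properness, can be
    attached to the predicate. *)
Definition prime_pred (P : set R) (hP : prime_ideal P) : {pred R} :=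
  [pred x | `[< P x >]].

Lemma prime_pred_idealr P (hP : prime_ideal P) : idealr_closed (prime_pred hP).
Proof.
have iP := prime_ideal_ideal hP; split.
- by apply/asboolP; exact: ideal0.
- by apply/asboolPn; exact: prime1.
- move=> a u v /asboolP Pu /asboolP Pv; apply/asboolP.
  by apply: idealD => //; exact: idealMl.
Qed.

HB.instance Definition _ P hP :=
  isIdealr.Build R (@prime_pred P hP) (prime_pred_idealr hP).

Definition prime_quot P (hP : prime_ideal P) := {ideal_quot (prime_pred hP)}.

Section Quot.
Variables (P : set R) (hP : prime_ideal P).
Local Notation Q := (prime_quot hP).

HB.instance Definition _ := GRing.ComNzRing.on Q.

Definition prime_pi : R -> Q := \pi_{ideal_quot (prime_pred hP)}.

Lemma prime_pi_is_zmod_morphism : zmod_morphism prime_pi.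
Proof. by move=> x y; rewrite /prime_pi rmorphB. Qed.

Lemma prime_pi_is_monoid_morphism : monoid_morphism prime_pi.
Proof. by split=> [|x y]; rewrite /prime_pi (rmorph1, rmorphM). Qed.

HB.instance Definition _ :=
  GRing.isZmodMorphism.Build R Q prime_pi prime_pi_is_zmod_morphism.
HB.instance Definition _ :=
  GRing.isMonoidMorphism.Build R Q prime_pi prime_pi_is_monoid_morphism.

Lemma prime_pi_surj (z : Q) : exists x, prime_pi x = z.
Proof. by exists (repr z); rewrite /prime_pi reprK. Qed.

Lemma prime_pi_eq0 x : prime_pi x = 0 <-> P x.
Proof.
rewrite -(rmorph0 prime_pi) /prime_pi; split.
  by move/eqP; rewrite -Quotient.idealrBE subr0 => /asboolP.
by move=> Px; apply/eqP; rewrite -Quotient.idealrBE subr0; apply/asboolP.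
Qed.

Definition prime_quot_unit : {pred Q} := [pred z | `[< exists y, y * z = 1 >]].

Definition prime_quot_inv (z : Q) : Q :=
  if pselect (exists y, y * z = 1) is left h then sval (cid h) else z.

Lemma prime_quot_mulVx : {in prime_quot_unit, left_inverse 1 prime_quot_inv *%R}.
Proof.
move=> z /asboolP zu; rewrite /prime_quot_inv; case: pselect => // h.
exact: svalP (cid h).
Qed.

Lemma prime_quot_unitP (x y : Q) : y * x = 1 -> prime_quot_unit x.
Proof. by move=> yx; apply/asboolP; exists y. Qed.

Lemma prime_quot_inv_out : {in [predC prime_quot_unit], prime_quot_inv =1 id}.
Proof.
by move=> z /asboolPn zu; rewrite /prime_quot_inv; case: pselect.
Qed.

HB.instance Definition _ := GRing.ComNzRing_hasMulInverse.Build Q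
  prime_quot_mulVx prime_quot_unitP prime_quot_inv_out.

Lemma prime_quot_domain (x y : Q) : x * y = 0 -> (x == 0) || (y == 0).
Proof.
have [a <-] := prime_pi_surj x; have [b <-] := prime_pi_surj y.
rewrite -rmorphM => /prime_pi_eq0; case: hP => _ _ h /h[] /prime_pi_eq0->.
  by rewrite eqxx.
by rewrite eqxx orbT.
Qed.

HB.instance Definition _ := GRing.ComUnitRing_isIntegral.Build Q prime_quot_domain.

End Quot.
End PrimeQuotient.

Lemma prime_quotient (R : comNzRingType) (P : set R) : prime_ideal P ->
  exists (D : idomainType) (pi : {rmorphism R -> D}),
    (forall z, exists x, pi x = z) /\ (forall x, pi x = 0 <-> P x).
Proof.
move=> hP; exists (prime_quot hP), (prime_pi hP).
by split; [exact: prime_pi_surj|exact: prime_pi_eq0].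
Qed.

Lemma prime_to_field (R : comNzRingType) (P : set R) : prime_ideal P ->
  exists (F : fieldType) (f : {rmorphism R -> F}), forall x, f x = 0 <-> P x.
Proof.
move=> /prime_quotient[D [pi [_ piP]]].
exists {fraction D}, (@FracField.tofrac D \o pi) => x; rewrite -piP /=.
by split=> [/eqP|->]; [rewrite tofrac_eq0 => /eqP|exact: rmorph0].
Qed.

Lemma factor_rmorphism (R D S : comNzRingType) (pi : {rmorphism R -> D})
    (f : {rmorphism R -> S}) : (forall z, exists x, pi x = z) ->
  (forall x, pi x = 0 -> f x = 0) ->
  exists g : {rmorphism D -> S}, forall x, g (pi x) = f x.
Proof.
move=> pisurj fpi; pose s z := sval (cid (pisurj z)).
have sK z : pi (s z) = z by exact: svalP (cid (pisurj z)).
pose g z := f (s z).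
have gpi x : g (pi x) = f x.
  by apply/eqP; rewrite -subr_eq0 -rmorphB; apply/eqP/fpi; rewrite rmorphB sK subrr.
have gB : zmod_morphism g.
  by move=> x y; rewrite -[x in LHS]sK -[y in LHS]sK -rmorphB gpi rmorphB.
have gM : monoid_morphism g.
  split=> [|x y]; first by rewrite -(rmorph1 pi) gpi rmorph1.
  by rewrite -[x in LHS]sK -[y in LHS]sK -rmorphM gpi rmorphM.
pose mB := GRing.isZmodMorphism.Build D S g gB.
pose mM := GRing.isMonoidMorphism.Build D S g gM.
pose G : {rmorphism D -> S} := HB.pack g mB mM.
by exists G.
Qed.

(* [P] is maximal among the ideals contracting into [Q]; were [f a] outside [P]
   for some [a] in [Q], an equation of integral dependence would place a power
   of an element outside [Q] into [Q]. *)
Lemma lying_over (R S : comNzRingType) (f : {rmorphism R -> S}) (Q : set R) :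
  injective f -> prime_ideal Q ->
  (forall s, exists n (c : nat -> R), s ^+ n = \sum_(i < n) f (c i) * s ^+ i) ->
  exists2 P, prime_ideal P & forall x, P (f x) <-> Q x.
Proof.
move=> finj hQ fint; have iQ := prime_ideal_ideal hQ.
pose W := [set f x | x in [set x | ~ Q x]].
have [||a b [x Qx <-] [y Qy <-]|a /= -> [x Qx fx0]|P [hP _ PW Pmax]] :=
  @prime_avoiding S [set 0] W.
- by split=> [//|a b /= -> ->|a b /= ->]; rewrite ?addr0 ?mulr0.
- by exists 1; [exact: prime1|rewrite rmorph1].
- by exists (x * y); [exact: primeM|rewrite rmorphM].
- by apply: Qx; rewrite (_ : x = 0); [exact: ideal0|apply: finj; rewrite rmorph0].
have iP := prime_ideal_ideal hP.
have PQ x : P (f x) -> Q x by move=> Pfx; apply: contrapT => Qx; apply: (PW (f x)) => //; exists x.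
exists P => // a; split=> [|Qa]; first exact: PQ.
have ia : is_ideal (gen_ideal [:: f a]) by [].
have faa : gen_ideal [:: f a] (f a) by apply: gen_ideal_mem; rewrite inE.
have iJ := ideal_add_ideal iP ia.
apply: contrapT => Pfa.
have [z [z' [u [Pz' [c uE] zE]]] [w Qw fw]] :
    exists2 z, ideal_add P (gen_ideal [:: f a]) z & W z.
  apply: contrapT => nz; apply: Pfa.
  rewrite -(Pmax (ideal_add P (gen_ideal [:: f a]))) //; last 1 first.
    by move=> y Jy Wy; apply: nz; exists y.
    exact: ideal_addr.
  exact: ideal_addl.
rewrite big_ord1 /= in uE.
have [n [d dE]] := fint (c ord0).
apply: Qw; apply: (@primeX _ _ _ n) => //.
(* Modulo [P] one has [w = c * a]; multiplying the integral equation of [c] by [a ^ n] yields an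
   equation for [w] whose lower coefficients carry a factor [a] and so lie in [Q]. *)
suff : Q (w ^+ n - \sum_(i < n) d i * a ^+ (n - i) * w ^+ i).
  move=> h; apply: (idealBl iQ h); apply: ideal_sum => // i _.
  by apply: idealMr => //; apply: idealMl => //; apply: idealX => //; rewrite subn_gt0.
apply: PQ; have [piF [pi piP]] := prime_to_field hP.
apply/piP; rewrite !rmorphB /= rmorphXn /= !rmorph_sum.
have wE : pi (f w) = pi (c ord0) * pi (f a).
  by rewrite fw zE uE rmorphD rmorphM (_ : pi z' = 0) ?add0r //; apply/piP.
rewrite rmorphXn wE exprMn -rmorphXn dE rmorph_sum mulr_suml; apply/eqP; rewrite subr_eq0.
apply/eqP/eq_bigr => i _; rewrite /= !rmorphM !rmorphXn wE.
rewrite exprMn -!mulrA; congr (_ * _); rewrite mulrCA; congr (_ * _).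
by rewrite -exprD subnK // ltnW.
Qed.

(** * Coefficient rings in characteristic p *)

Section PowerSubfield.
Variables (K : fieldType) (S : divringClosed K).

Record subfield := Subfield { subfield_val : K; _ : subfield_val \in S }.
HB.instance Definition _ := [isSub for subfield_val].
HB.instance Definition _ := [Choice of subfield by <:].
HB.instance Definition _ := [SubChoice_isSubIntegralDomain of subfield by <:].
HB.instance Definition _ := [SubIntegralDomain_isSubField of subfield by <:].

(* A nonzero polynomial of degree < p vanishing at [b] has a common divisor
   [(X - b)^i], 0 < i < p, with [X^p - b^p] over the subfield. *)
Lemma pth_power_subfield (p : nat) (b : K) (f : {poly subfield}) :
  p \in [pchar K] -> b ^+ p \in S -> f != 0 -> (size f <= p)%N ->
  root (map_poly subfield_val f) b -> b \in S.
Proof.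
move=> pK bS f0 fp fb; pose c : subfield := Subfield bS.
pose v : {rmorphism subfield -> K} := val.
pose g := gcdp f ('X^p - c%:P).
have pl : p \in [pchar {poly K}] by rewrite pchar_poly.
have gE : map_poly v g = gcdp (map_poly v f) (('X - b%:P) ^+ p).
  rewrite gcdp_map; congr (gcdp _ _).
  transitivity ('X^p - (b ^+ p)%:P : {poly K}).
    by rewrite rmorphB; congr (_ - _); [exact: (map_polyXn v)|exact: (map_polyC v)].
  rewrite -[RHS](pFrobenius_autE pl) rmorphB /= !pFrobenius_autE.
  by rewrite -rmorphXn.
have : map_poly v g %| ('X - b%:P) ^+ p by rewrite gE dvdp_gcdr.
move=> /dvdp_exp_XsubCP[i ip gi].
have g0 : map_poly v g != 0 by rewrite map_poly_eq0 gcdp_eq0 negb_and f0.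
have ig : size (map_poly v g) = i.+1 by rewrite (eqp_size gi) size_exp_XsubC.
have iltp : (i < p)%N.
  rewrite -ig; apply: leq_trans fp; rewrite -(size_map_poly v f) gE.
  by apply: dvdp_leq; rewrite ?map_poly_eq0 ?dvdp_gcdl.
have i0 : (0 < i)%N.
  rewrite lt0n; apply: contraL fb => /eqP iE; rewrite /root.
  have : ~~ root (map_poly v g) b by rewrite (eqp_root gi) iE expr0 root1.
  apply: contra => fb; rewrite gE root_gcd /root fb /=.
  by rewrite horner_exp hornerXsubC subrr expr0n; case: (p) iltp.
have [c' c'0 gc] : exists2 c', c' != 0 & map_poly v g = c' *: ('X - b%:P) ^+ i.
  by have /eqpf_eq := gi.
have XsubE : ('X - b%:P) ^+ i = \prod_(x <- nseq i b) ('X - x%:P).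
  by rewrite big_nseq iter_mulr_1 -/('X - b%:P).
have lead : ('X - b%:P : {poly K}) ^+ i \is monic by rewrite monic_exp ?monicXsubC.
have coefi : (('X - b%:P) ^+ i)`_i = 1 :> K.
  by have /monicP := lead; rewrite lead_coefE size_exp_XsubC.
(* This coefficient exposes [b]: the common divisor has its coefficients in the subfield, and [i] is
   invertible because [0 < i < p]. *)
have coefi1 : (('X - b%:P) ^+ i)`_i.-1 = - (b *+ i) :> K.
  have := @coefPn_prod_XsubC K (nseq i b); rewrite size_nseq -XsubE => ->.
    by rewrite big_nseq iter_addr_0.
  by rewrite -lt0n.
have gS j : (map_poly v g)`_j \in S by rewrite coef_map; exact: valP.
have c'S : c' \in S by have := gS i; rewrite gc coefZ coefi mulr1.
have biS : c' * - (b *+ i) \in S by have := gS i.-1; rewrite gc coefZ coefi1.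
have iK : (i%:R : K) != 0 by rewrite -(dvdn_pcharf pK) gtnNdvd.
suff -> : b = - (c' * - (b *+ i)) / c' / i%:R.
  by rewrite rpred_div ?rpred_nat // rpred_div ?rpredN.
by rewrite mulrN opprK [c' * _]mulrC mulfK // -[b *+ i]mulr_natr mulfK.
Qed.

End PowerSubfield.

(** * Coefficient rings from a lifted p-basis *)

Section CoefficientRing.
Variables (D : comNzRingType) (m : set D) (p : nat).
Hypotheses (noeth : noetherian D) (hm : local_ring m) (pp : prime p).
Hypotheses (pD : p%:R = 0 :> D) (hc : adically_complete m).

Let pchD : p \in [pchar D]. Proof. by rewrite inE pp pD eqxx. Qed.

Let pm : prime_ideal m. Proof. by apply: maximal_ideal_prime; case: hm. Qed.
Let im : is_ideal m. Proof. exact: prime_ideal_ideal. Qed.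

(** The subring generated by [q]-th powers and [X], that is [D^q[X]]. Products are generated one
    factor at a time, which suits induction; general products are recovered in [psub_mul]. *)
Inductive psub (q : nat) (X : set D) : D -> Prop :=
| psub1 : psub q X 1
| psubB a b : psub q X a -> psub q X b -> psub q X (a - b)
| psubX x a : psub q X a -> psub q X (x ^+ q * a)
| psubM b a : X b -> psub q X a -> psub q X (b * a).

Lemma psub0 q X : psub q X 0.
Proof. by rewrite -(subrr 1); apply: psubB; exact: psub1. Qed.

Lemma psubN q X a : psub q X a -> psub q X (- a).
Proof. by move=> h; rewrite -(sub0r a); apply: psubB => //; exact: psub0. Qed.

Lemma psubD q X a b : psub q X a -> psub q X b -> psub q X (a + b).
Proof. by move=> ha hb; rewrite -(opprK b); apply: psubB => //; exact: psubN. Qed.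

Lemma psub_mul q X a b : psub q X a -> psub q X b -> psub q X (a * b).
Proof.
move=> + hb; elim=> [|x y _ IHx _ IHy|x y _ IH|x y Xx _ IH].
- by rewrite mul1r.
- by rewrite mulrBl; exact: psubB.
- by rewrite -mulrA; exact: psubX.
- by rewrite -mulrA; exact: psubM.
Qed.

Lemma psub_mem q (X : set D) b : X b -> psub q X b.
Proof. by move=> Xb; rewrite -[b]mulr1; apply: psubM => //; exact: psub1. Qed.

Lemma psub_pow q X x : psub q X (x ^+ q).
Proof. by rewrite -[_ ^+ _]mulr1; apply: psubX; exact: psub1. Qed.

Lemma psub_exp q X a n : psub q X a -> psub q X (a ^+ n).
Proof.
by move=> ha; elim: n => [|n IH]; [exact: psub1|rewrite exprS; exact: psub_mul].
Qed.

Lemma psub_sum q X n (F : 'I_n -> D) :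
  (forall i, psub q X (F i)) -> psub q X (\sum_(i < n) F i).
Proof. by move=> h; elim/big_ind: _ => //; [exact: psub0|exact: psubD]. Qed.

Lemma psub_sub q X Y : X `<=` Y -> psub q X `<=` psub q Y.
Proof.
move=> XY a; elim=> [|x y _ IHx _ IHy|x y _ IH|x y Xx _ IH].
- exact: psub1. - exact: psubB. - exact: psubX.
- by apply: psubM => //; exact: XY.
Qed.

Lemma psub_le e X : psub (p ^ e.+1) X `<=` psub (p ^ e) X.
Proof.
move=> a; elim=> [|x y _ IHx _ IHy|x y _ IH|x y Xx _ IH].
- exact: psub1. - exact: psubB.
- by rewrite expnS exprM; exact: psubX.
- exact: psubM.
Qed.

Let expB (x y : D) : (x - y) ^+ p = x ^+ p - y ^+ p.
Proof. by rewrite -!(pFrobenius_autE pchD) rmorphB. Qed.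

Lemma psub_Frobenius q X a : psub q X a -> psub (q * p) X (a ^+ p).
Proof.
elim=> [|x y _ IHx _ IHy|x y _ IH|x y Xx _ IH].
- by rewrite expr1n; exact: psub1.
- by rewrite expB; exact: psubB.
- by rewrite exprMn -exprM; exact: psubX.
- by rewrite exprMn; apply: psub_mul => //; apply: psub_exp; exact: psub_mem.
Qed.

Lemma psub_finite q X a : psub q X a -> exists2 l : seq D,
  {in l, forall b, X b} & psub q [set` l] a.
Proof.
have catl (l l' : seq D) : [set` l] `<=` [set` l ++ l'].
  by move=> x /= xl; rewrite mem_cat xl.
have catr (l l' : seq D) : [set` l'] `<=` [set` l ++ l'].
  by move=> x /= xl; rewrite mem_cat xl orbT.
elim=> [|x y _ [l lX hx] _ [l' l'X hy]|x y _ [l lX hy]|x y Xx _ [l lX hy]].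
- by exists [::] => //; exact: psub1.
- exists (l ++ l'); first by move=> b; rewrite mem_cat => /orP[/lX|/l'X].
  by apply: psubB; [apply: psub_sub hx; exact: catl|apply: psub_sub hy; exact: catr].
- by exists l => //; exact: psubX.
- exists (x :: l); first by move=> b; rewrite inE => /predU1P[->|/lX].
  apply: psubM; first exact: mem_head.
  by apply: psub_sub hy => b /= bl; rewrite inE bl orbT.
Qed.

(** Polynomials in the entries of [l], of degree below [p] in each, whose coefficients are [p]-th
    powers of elements of [U]. They are nested one variable at a time, in the order used by
    [pindep]. *)
Fixpoint pcomb (U : set D) (l : seq D) : set D :=
  if l is b :: l' then [set s | exists t : nat -> D,
    (forall j, pcomb U l' (t j)) /\ s = \sum_(j < p) t j * b ^+ j]
  else [set u ^+ p | u in U].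

(** p-independence of the residues: modulo [m], no entry lies in the ring generated by the [p]-th
    powers and the later entries. *)
Fixpoint pindep (l : seq D) : Prop :=
  if l is b :: l' then (forall s, psub p [set` l'] s -> ~ m (b - s)) /\ pindep l'
  else True.

Section Pcomb.
Variable U : set D.
Hypotheses (UB : forall x y, U x -> U y -> U (x - y)) (U0 : U 0).

Lemma pcombB l s t : pcomb U l s -> pcomb U l t -> pcomb U l (s - t).
Proof.
elim: l s t => [_ _ [u Uu <-] [w Uw <-]|b l IH _ _ [u [hu ->]] [w [hw ->]]].
  by exists (u - w); [exact: UB|exact: expB].
exists (fun j => u j - w j); split=> [j|]; first exact: IH (hu j) (hw j).
by rewrite -sumrB; apply: eq_bigr => j _; rewrite mulrBl.
Qed.

Lemma pcomb0 l : pcomb U l 0.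
Proof.
elim: l => [|b l IH]; first by exists 0 => //; rewrite expr0n gtn_eqF ?prime_gt0.
by exists (fun=> 0); split=> //; rewrite big1 // => j _; rewrite mul0r.
Qed.

Lemma pcomb1 l : U 1 -> pcomb U l 1.
Proof.
move=> U1; elim: l => [|b l IH]; first by exists 1 => //; rewrite expr1n.
exists (fun j => if j is 0%N then 1 else 0); split=> [[|j]//|]; first exact: pcomb0.
case: (p) (prime_gt0 pp) => // q _; rewrite big_ord_recl mulr1 big1 ?addr0 //.
by move=> j _; rewrite mul0r.
Qed.

Lemma pcombX g l s : (forall u, U u -> U (g * u)) ->
  pcomb U l s -> pcomb U l (g ^+ p * s).
Proof.
move=> Ug; elim: l s => [_ [u Uu <-]|b l IH _ [u [hu ->]]].
  by exists (g * u); [exact: Ug|rewrite exprMn].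
exists (fun j => g ^+ p * u j); split=> [j|]; first exact: IH (hu j).
by rewrite mulr_sumr; apply: eq_bigr => j _; rewrite mulrA.
Qed.

Lemma pcombM b l s : {in l, forall c u, U u -> U (c * u)} -> b \in l ->
  pcomb U l s -> pcomb U l (b * s).
Proof.
elim: l s => // c l IH _ Ul bl [u [hu ->]].
have Ul' : {in l, forall c u, U u -> U (c * u)}.
  by move=> d dl; apply: Ul; rewrite inE dl orbT.
move: bl; rewrite inE => /predU1P[->|bl]; last first.
  exists (fun j => b * u j); split=> [j|]; first exact: IH (hu j).
  by rewrite mulr_sumr; apply: eq_bigr => j _; rewrite mulrA.
(* Multiplication by [c] shifts the exponents; the overflowing [c ^ p] becomes part of the
   coefficient of exponent 0. *)
exists (fun j => if j is j'.+1 then u j' else c ^+ p * u p.-1); split=> [[|j]|]; last 1 first.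
- case: (p) (prime_gt0 pp) => // q _; rewrite mulr_sumr big_ord_recr big_ord_recl /=.
  rewrite addrC mulr1; congr (_ + _); first by rewrite mulrCA -exprS mulrC.
  by apply: eq_bigr => j _; rewrite mulrCA -exprS.
- by apply: pcombX (hu _) => w; exact: (Ul _ (mem_head _ _)) w.
- exact: hu.
Qed.

End Pcomb.

Lemma psub_pcomb e l s : psub (p ^ e.+1) [set` l] s ->
  pcomb (psub (p ^ e) [set` l]) l s.
Proof.
have UB x y : psub (p ^ e) [set` l] x -> psub (p ^ e) [set` l] y ->
  psub (p ^ e) [set` l] (x - y) by exact: psubB.
have U0 := psub0 (p ^ e) [set` l].
elim=> [|x y _ IHx _ IHy|x y _ IH|x y Xx _ IH].
- by apply: pcomb1 => //; exact: psub1.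
- exact: pcombB.
- by rewrite expnSr exprM; apply: pcombX => // u; exact: psubX.
- by apply: pcombM => // c cl u; apply: psubM.
Qed.

Lemma pcomb_psub U l s : pcomb U l s -> psub p [set` l] s.
Proof.
elim: l s => [_ [u _ <-]|b l IH _ [t [ht ->]]]; first exact: psub_pow.
apply: psub_sum => j; apply: psub_mul.
  by apply: psub_sub (IH _ (ht j)) => c /= cl; rewrite inE cl orbT.
by apply: psub_exp; apply: psub_mem; exact: mem_head.
Qed.

(** In a field where exactly [m] vanishes, the image of [psub p X] is a subfield containing the
    [p]-th power of [b] but not [b]. By [pth_power_subfield], [b] is then no root of a nonzero
    polynomial of degree below [p] over it. *)
Lemma pindep_lin b (X : set D) (t : nat -> D) :
  (forall s, psub p X s -> ~ m (b - s)) -> (forall j, psub p X (t j)) ->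
  m (\sum_(j < p) t j * b ^+ j) -> forall j, (j < p)%N -> m (t j).
Proof.
move=> bX tX mt j0 j0p; have [F [f fP]] := prime_to_field pm.
have pF : p \in [pchar F] by rewrite inE pp -(rmorph_nat f) pD rmorph0 eqxx.
pose S0 : {pred F} := [pred x | `[< exists2 s, psub p X s & f s = x >]].
have S0P : divring_closed S0.
  split=> [|_ _ /asboolP[s hs <-] /asboolP[s' hs' <-]|_ _ /asboolP[s hs <-] /asboolP[s' hs' <-]].
  - by apply/asboolP; exists 1; [exact: psub1|rewrite rmorph1].
  - by apply/asboolP; exists (s - s'); [exact: psubB|rewrite rmorphB].
  - apply/asboolP; have [ms'|ms'] := pselect (m s').
      exists 0; first exact: psub0.
      by rewrite (iffRL (fP s')) // invr0 mulr0 rmorph0.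
    have [v vs'] := local_unit noeth hm ms'.
    (* The inverse [v] of [s'] need not lie in the subring, but it equals [v ^ p * s' ^ p.-1], which
       does. *)
    exists (s * (v ^+ p * s' ^+ p.-1)).
      by apply: psub_mul => //; apply: psubX; exact: psub_exp.
    rewrite rmorphM; congr (_ * _); apply: (@mulIf _ (f s')).
      by apply/eqP => /fP.
    rewrite mulVf; last by apply/eqP => /fP.
    by rewrite -rmorphM -mulrA -exprSr prednK ?prime_gt0 // -exprMn vs' expr1n rmorph1.
pose S : divringClosed F := HB.pack S0 (GRing.isDivringClosed.Build F S0 S0P).
have tS j : f (t j) \in S by apply/asboolP; exists (t j).
pose g : {poly subfield S} := \poly_(j < p) (Subfield (tS j)).
have bS : f b ^+ p \in S by apply/asboolP; exists (b ^+ p); [exact: psub_pow|rewrite rmorphXn].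
have [g0|g0] := eqVneq g 0.
  apply/fP; have : val (g`_j0) = 0 by rewrite g0 coef0.
  by rewrite coef_poly j0p.
have : f b \in S.
  apply: pth_power_subfield pF bS g0 _ _; first exact: size_poly.
  rewrite /root; have mapE : map_poly (@subfield_val _ S) g = \poly_(j < p) f (t j).
    apply/polyP => j; rewrite (coef_map (val : {rmorphism subfield S -> F})) !coef_poly.
    by case: ifP => // _; rewrite rmorph0.
  rewrite mapE horner_poly; apply/eqP; rewrite -[RHS](iffRL (fP _) mt) rmorph_sum.
  by apply: eq_bigr => j _; rewrite rmorphM rmorphXn.
move=> /asboolP[s hs fs]; case: (bX s hs); apply/fP.
by rewrite rmorphB fs subrr.
Qed.

Lemma pindep_pcomb U l s : U 0 -> pindep l -> pcomb U l s -> m s ->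
  pcomb (U `&` m) l s.
Proof.
move=> U0; elim: l s => [_ _ [u Uu <-]|b l IH _ [bl hl] [t [ht ->]] ms].
  by move=> /(primeX pm) mu; exists u.
have mt := pindep_lin bl (fun j => pcomb_psub (ht j)) ms.
exists (fun j => if (j < p)%N then t j else 0); split=> [j|].
  case: ifP => jp; first exact: IH hl (ht j) (mt _ jp).
  by apply: pcomb0; split=> //; exact: ideal0.
by apply: eq_bigr => j _; rewrite ltn_ord.
Qed.

Lemma ideal_expX_mem (I : set D) a i n : is_ideal I ->
  ideal_exp I i a -> ideal_exp I (i * n) (a ^+ n).
Proof.
move=> hI ha; elim: n => [|n IH]; first by rewrite muln0.
by rewrite mulnS exprS; exact: ideal_expM.
Qed.

Lemma pcomb_exp U l s q : U `<=` ideal_exp m q -> pcomb U l s ->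
  ideal_exp m (q * p) s.
Proof.
move=> Uq; elim: l s => [_ [u /Uq mu <-]|b l IH _ [t [ht ->]]].
  exact: ideal_expX_mem.
have iX : is_ideal (ideal_exp m (q * p)) by exact: ideal_exp_ideal.
by apply: ideal_sum => // j _; apply: idealMr => //; exact: IH (ht j).
Qed.

(** The coefficients of [s] are [p]-th powers of elements of the previous subring. Independence puts
    these elements in [m], so by induction in its [p ^ e]-th power, and Frobenius multiplies the
    exponent by [p]. *)
Lemma pindep_exp e l s : pindep l -> psub (p ^ e) [set` l] s -> m s ->
  ideal_exp m (p ^ e) s.
Proof.
move=> hl; elim: e s => [s _ ms|e IH s hs ms].
  by rewrite -[s]expr1; exact: ideal_exp_mem.
rewrite expnSr; apply: (@pcomb_exp (psub (p ^ e) [set` l] `&` m) l).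
  by move=> u [hu mu]; exact: IH.
by apply: pindep_pcomb => //; [exact: psub0|exact: psub_pcomb].
Qed.

(** A condition on finite subsets, so that it passes to unions of chains. The extension [l'] is free
    to order its entries, since [pindep] depends on the order. *)
Let pbasis (X : set D) := forall l : seq D, {in l, forall b, X b} ->
  exists l' : seq D, [/\ {subset l <= l'}, {in l', forall b, X b} & pindep l'].

Lemma pbasis_exp X e s : pbasis X -> psub (p ^ e) X s -> m s ->
  ideal_exp m (p ^ e) s.
Proof.
move=> hX /psub_finite[l lX hs]; have [l' [ll' _ hl']] := hX _ lX.
by apply: (pindep_exp hl'); apply: psub_sub hs => x /ll'.
Qed.

(** An element not congruent to one of [psub p X] could be put at the head of every independent
    list, against the maximality of [X]. *)
Lemma pbasis_exists : exists2 X, pbasis X &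
  forall d, exists s, psub p X s /\ m (d - s).
Proof.
have [F FP Ftot l hl|X [hX Xmax]] := @Zorn_bigcup D pbasis.
  have [Y [FY lY]] : exists Y : set D, (Y = set0 \/ F Y) /\ {in l, forall b, Y b}.
    elim: l hl => [|b l IH] hl; first by exists set0; split; [left|].
    have [|Y [FY lY]] := IH; first by move=> c cl; apply: hl; rewrite inE cl orbT.
    have [X FX Xb] := hl _ (mem_head _ _).
    have [YX|XY] : Y `<=` X \/ F Y /\ X `<=` Y.
      case: FY => [->|FY]; first by left; exact: sub0set.
      by have [] := Ftot _ _ FX FY; [right|left].
      exists X; split; first by right.
      by move=> c; rewrite inE => /predU1P[->//|/lY/YX].
    exists Y; split; first by right; case: XY.
    by move=> c; rewrite inE => /predU1P[->|/lY//]; apply: XY.2.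
  have [Y0|{}FY] := FY.
    by exists [::]; split=> // c /lY; rewrite Y0.
  have [l' [ll' l'Y hl']] := FP _ FY _ lY; exists l'; split=> // b /l'Y Yb.
  by exists Y.
exists X => // t; apply: contrapT => nt.
have Xt s : psub p X s -> ~ m (t - s) by move=> hs mts; apply: nt; exists s.
apply: (Xmax (X `|` [set t])).
  split=> [x Xx|]; first by left.
  move=> /(_ t) /= XT; apply: (Xt t); first by apply: psub_mem; apply: XT; right.
  by rewrite subrr; exact: ideal0.
move=> l hl; have [|l' [ll' l'X hl']] := hX [seq b <- l | `[< X b >]].
  by move=> b; rewrite mem_filter => /andP[/asboolP].
exists (t :: l'); split.
- move=> b bl; rewrite inE; case: (hl _ bl) => [Xb|->]; last by rewrite eqxx.
  by apply/orP; right; apply: ll'; rewrite mem_filter bl andbT; apply/asboolP.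
- by move=> b; rewrite inE => /predU1P[->|/l'X]; [right|left].
- by split=> // s hs; apply: Xt; apply: psub_sub hs => b /l'X.
Qed.

(** In an expression by [p]-th powers and [X], each [x ^ p] may be replaced by the [p]-th power of
    an approximation of [x] in [psub (p ^ e) X]; that power lies at level [e.+1]. *)
Lemma psub_surj X : (forall d, exists s, psub p X s /\ m (d - s)) ->
  forall e d, exists s, psub (p ^ e) X s /\ m (d - s).
Proof.
move=> hX; elim=> [|e IH] d.
  by exists d; split; [rewrite -[d]expr1; exact: psub_pow|rewrite subrr; exact: ideal0].
have [s [hs ds]] := hX d.
suff [s' [hs' ss']] : exists s', psub (p ^ e.+1) X s' /\ m (s - s').
  by exists s'; split=> //; rewrite -(subrKA s); exact: idealD.
elim: hs {d ds} => [|x y _ [x' [hx mx]] _ [y' [hy my]]|x y _ [y' [hy my]]|x y Xx _ [y' [hy my]]].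
- by exists 1; split; [exact: psub1|rewrite subrr; exact: ideal0].
- exists (x' - y'); split; first exact: psubB.
  by rewrite opprD addrACA -opprD; exact: idealB.
- have [x' [hx mx]] := IH x; exists (x' ^+ p * y'); split.
    by apply: psub_mul => //; rewrite expnSr; exact: psub_Frobenius.
  by apply: ideal_congrM => //; rewrite -expB; apply: idealX => //; exact: prime_gt0.
- exists (x * y'); split; first exact: psubM.
  by rewrite -mulrBr; exact: idealMl.
Qed.

(* The coefficient ring is the set of limits of elements of the subrings
   [D^(p^e)[X]], where [X] lifts a p-basis of the residue field. *)
Theorem coefficient_ring_exists : exists k : set D,
  [/\ k 1, forall a b, k a -> k b -> k (a - b), forall a b, k a -> k b -> k (a * b),
      forall a, k a -> m a -> a = 0 & forall d, exists c, k c /\ m (d - c)].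
Proof.
have [X hX /psub_surj Xsurj] := pbasis_exists.
have iX n : is_ideal (ideal_exp m n) by exact: ideal_exp_ideal.
have p1 := prime_gt1 pp.
exists [set a | forall e, exists2 s, psub (p ^ e) X s & ideal_exp m (p ^ e) (a - s)].
split.
- by move=> e; exists 1; [exact: psub1|rewrite subrr; exact: ideal0].
- move=> a b ha hb e; have [s hs as'] := ha e; have [t ht bt] := hb e.
  exists (s - t); first exact: psubB.
  by rewrite opprD addrACA -opprD; exact: idealB.
- move=> a b ha hb e; have [s hs as'] := ha e; have [t ht bt] := hb e.
  exists (s * t); first exact: psub_mul.
  rewrite -(subrKA (s * b)) -mulrBl -mulrBr.
  by apply: idealD => //; [exact: idealMr|exact: idealMl].
(* If [a] is in [m], so are its approximants, and [pbasis_exp] sends them to ever higher powers of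
   [m]; so [a] vanishes by separatedness. *)
- move=> a ha ma; apply: (hc.1) => n; have [s hs as'] := ha n.
  have nle : (n <= p ^ n)%N by exact/ltnW/ltn_expl.
  apply: (ideal_exp_le im nle); apply: (idealBl (iX _) as').
  apply: pbasis_exp hX hs _; apply: (idealBr im _ ma).
  by apply: ideal_exp_sub1 as' => //; rewrite expn_gt0 prime_gt0.
- move=> d; have [s hs] := choice (Xsurj^~ d).
  (* Consecutive approximations of [d] differ by an element of [m] in the subring of level [e], so
     the sequence is Cauchy. *)
  have ms e : ideal_exp m (p ^ e) (s e.+1 - s e).
    apply: pbasis_exp hX _ _.
      by apply: psubB; [apply: psub_le; case: (hs e.+1)|case: (hs e)].
    have -> : s e.+1 - s e = (d - s e) - (d - s e.+1).
      by rewrite [RHS]addrC opprB subrKA.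
    by apply: idealB; [exact: im|case: (hs e)|case: (hs e.+1)].
  have [|a ha] := hc.2 s.
    by move=> n; apply: (ideal_exp_le im _ (ms n)); exact/ltnW/ltn_expl.
  have as' e : ideal_exp m (p ^ e) (a - s e).
    have le : (e <= p ^ e)%N by exact/ltnW/ltn_expl.
    have sn n : ideal_exp m (p ^ e) (s (n + e)%N - s e).
      elim: n => [|n IH]; first by rewrite subrr; exact: ideal0.
      rewrite addSn -(subrKA (s (n + e)%N)); apply: idealD => //.
      apply: (ideal_exp_le im (i := (p ^ (n + e))%N)); last exact: ms.
      by rewrite leq_exp2l ?leq_addl.
    rewrite -(subrKA (s (p ^ e)%N)); apply: idealD => //.
    by have := sn (p ^ e - e)%N; rewrite subnK.
  exists a; split; first by move=> e; exists (s e); case: (hs e).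
  have mas : m (a - s 0%N) by apply: ideal_exp_sub1 (as' 0%N).
  have mds : m (d - s 0%N) by case: (hs 0%N).
  by rewrite -(subrKA (s 0%N)) -[s 0%N - a]opprB; exact: idealB.
Qed.

End CoefficientRing.

(** * Formal power series *)

(** An alias, since [nat -> A] already carries the termwise product, the one used later for
    [bounded_seq]. *)
Definition series (A : comNzRingType) := nat -> A.

Section Series.
Variable A : comNzRingType.
Implicit Types (f g h : series A) (P Q : {poly A}).

HB.instance Definition _ := GRing.Zmodule.on (series A).

Definition series_mul f g : series A := fun n => \sum_(i < n.+1) f i * g (n - i)%N.
Definition series_const (a : A) : series A := fun n => if n is 0%N then a else 0.

(** The ring laws for series are inherited from polynomials through truncation at every order. *)
Definition approx n P f := forall i, (i <= n)%N -> P`_i = f i.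

Lemma approx_trunc n f : approx n (\poly_(i < n.+1) f i) f.
Proof. by move=> i ni; rewrite coef_poly ltnS ni. Qed.

Lemma approx_mul n P Q f g : approx n P f -> approx n Q g ->
  approx n (P * Q) (series_mul f g).
Proof.
move=> Pf Qg i ni; rewrite coefM; apply: eq_bigr => j _.
rewrite Pf ?Qg //; first exact: leq_trans (leq_subr _ _) ni.
by apply: leq_trans ni; rewrite -ltnS.
Qed.

Lemma approx_add n P Q f g : approx n P f -> approx n Q g -> approx n (P + Q) (f + g).
Proof. by move=> Pf Qg i ni; rewrite coefD Pf // Qg. Qed.

Lemma approx_const n a : approx n a%:P (series_const a).
Proof. by move=> [|i] _; rewrite coefC. Qed.

Lemma approx_eq f g : (forall n, exists2 P, approx n P f & approx n P g) -> f = g.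
Proof. by move=> h; apply/funext => n; have [P Pf Pg] := h n; rewrite -Pf // Pg. Qed.

Lemma series_mulA : associative series_mul.
Proof.
move=> f g h; apply: approx_eq => n.
pose T f := \poly_(i < n.+1) f i; have TP := @approx_trunc n.
exists (T f * (T g * T h)); first by do 2?apply: approx_mul => //.
by rewrite mulrA; do 2?apply: approx_mul => //.
Qed.

Lemma series_mulC : commutative series_mul.
Proof.
move=> f g; apply: approx_eq => n.
pose T f := \poly_(i < n.+1) f i; have TP := @approx_trunc n.
by exists (T f * T g); [|rewrite mulrC]; apply: approx_mul.
Qed.

Lemma series_mul1 : left_id (series_const 1) series_mul.
Proof.
move=> f; apply: approx_eq => n.
pose T f := \poly_(i < n.+1) f i; have TP := @approx_trunc n.
by exists (1%:P * T f); [apply: approx_mul => //; exact: approx_const|rewrite mul1r].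
Qed.

Lemma series_mulDl : left_distributive series_mul +%R.
Proof.
move=> f g h; apply: approx_eq => n.
pose T f := \poly_(i < n.+1) f i; have TP := @approx_trunc n.
exists ((T f + T g) * T h); first by apply: approx_mul => //; exact: approx_add.
by rewrite mulrDl; apply: approx_add; exact: approx_mul.
Qed.

Lemma series_1_neq0 : series_const 1 != 0 :> series A.
Proof. by apply/eqP => /(congr1 (fun f : series A => f 0%N)) /eqP; rewrite oner_eq0. Qed.

HB.instance Definition _ := GRing.Zmodule_isComNzRing.Build (series A)
  series_mulA series_mulC series_mul1 series_mulDl series_1_neq0.

Lemma series_const_is_zmod_morphism : zmod_morphism series_const.
Proof. by move=> a b; apply/funext => -[|n] //; rewrite /= !fctE /= subrr. Qed.

Lemma series_constM a f n : (series_const a * f) n = a * f n.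
Proof.
rewrite [LHS]big_ord_recl subn0 big1 ?addr0 // => i _.
by rewrite /= mul0r.
Qed.

Lemma series_const_is_monoid_morphism : monoid_morphism series_const.
Proof.
split=> // a b; apply/funext => n; rewrite series_constM.
by case: n => [|n] //=; rewrite mulr0.
Qed.

HB.instance Definition _ := GRing.isZmodMorphism.Build A (series A)
  series_const series_const_is_zmod_morphism.
HB.instance Definition _ := GRing.isMonoidMorphism.Build A (series A)
  series_const series_const_is_monoid_morphism.

Definition series_X : series A := fun n => if n is 1%N then 1 else 0.

Lemma series_XM f n : (series_X * f) n = if n is n'.+1 then f n' else 0.
Proof.
case: n => [|n]; first by rewrite [LHS]big_ord1 mul0r.
rewrite [LHS]big_ord_recl mul0r add0r big_ord_recl /= mul1r big1 ?addr0.
  by rewrite /bump /= subn1.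
by move=> i _; rewrite /= mul0r.
Qed.

Lemma series_XnM q f n : (series_X ^+ q * f) n = if (n < q)%N then 0 else f (n - q)%N.
Proof.
elim: q n => [|q IH] n; first by rewrite mul1r subn0.
by rewrite exprS -mulrA series_XM; case: n => // n; rewrite IH ltnS subSS.
Qed.

Lemma series_sumE n (F : 'I_n -> series A) i : (\sum_(j < n) F j) i = \sum_(j < n) F j i.
Proof. by elim/big_rec2: _ => // j x y _ <-. Qed.

Lemma gen_ideal_series_const (s : seq A) f :
  gen_ideal (map series_const s) f <-> forall i, gen_ideal s (f i).
Proof.
split=> [[c ->] i|h].
  rewrite series_sumE; apply: ideal_sum => // j _.
  have js : (j < size s)%N by rewrite -(size_map series_const).
  rewrite (nth_map 0) // mulrC series_constM; apply: idealMr => //.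
  by apply: gen_ideal_mem; exact: mem_nth.
have [c cP] := choice h.
have e : size (map series_const s) = size s by rewrite size_map.
exists (fun j => (fun i => c i (cast_ord e j)) : series A).
apply/funext => i; rewrite series_sumE cP.
rewrite (reindex (cast_ord e)) /=; last first.
  by exists (cast_ord (esym e)) => j _; rewrite ?cast_ordK ?cast_ordKV.
apply: eq_bigr => j _; rewrite (nth_map 0) -?e //.
by rewrite [in RHS]mulrC series_constM mulrC.
Qed.

End Series.

Section SeriesEval.
Variables (A D : comNzRingType) (m : set D) (phi : {rmorphism A -> D}) (x : D).
Hypotheses (im : is_ideal m) (hc : adically_complete m) (mx : m x).

Let iX n : is_ideal (ideal_exp m n). Proof. exact: ideal_exp_ideal. Qed.

Let part (f : series A) n := \sum_(i < n) phi (f i) * x ^+ i.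

Let lim_exists f : exists a, forall n, ideal_exp m n (a - part f n).
Proof.
apply: hc.2 => n; rewrite /part big_ord_recr /= addrAC subrr add0r.
by apply: idealMl => //; exact: ideal_exp_mem.
Qed.

Let ev f := sval (cid (lim_exists f)).
Let evP f n : ideal_exp m n (ev f - part f n).
Proof. by rewrite /ev; case: (cid _) => a /=. Qed.

Let sep a b : (forall n, exists c, ideal_exp m n (a - c) /\ ideal_exp m n (b - c)) -> a = b.
Proof.
move=> h; apply/eqP; rewrite -subr_eq0; apply/eqP/(hc.1) => n.
have [c [ac bc]] := h n; rewrite -(subrKA c) -[c - b]opprB; exact: idealB.
Qed.

Let horner_exp (P : {poly A}) n : (forall i, (i < n)%N -> P`_i = 0) ->
  ideal_exp m n (map_poly phi P).[x].
Proof.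
move=> Pn; rewrite horner_coef; apply: ideal_sum => // i _; rewrite coef_map.
have [ni|ni] := ltnP i n; first by rewrite Pn // raddf0 mul0r; exact: ideal0.
apply: idealMl => //; apply: (ideal_exp_le im ni); exact: ideal_exp_mem.
Qed.

Let partE f n : part f n = (map_poly phi (\poly_(i < n) f i)).[x].
Proof.
have -> : map_poly phi (\poly_(i < n) f i) = \poly_(i < n) phi (f i).
  by apply/polyP => i; rewrite coef_map !coef_poly; case: ifP => // _; rewrite raddf0.
by rewrite horner_poly.
Qed.

Let evB : zmod_morphism ev.
Proof.
move=> f g; apply: sep => n; exists (part f n - part g n); split.
  suff -> : part f n - part g n = part (f - g) n by exact: evP.
  by rewrite -sumrB; apply: eq_bigr => i _; rewrite -mulrBl -rmorphB.
by rewrite opprD addrACA -opprD; exact: idealB.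
Qed.

Let ev_const a : ev (series_const a) = phi a.
Proof.
apply: sep => n; exists (part (series_const a) n); split=> //.
case: n => [//|n]; rewrite /part big_ord_recl mulr1 big1 ?addr0.
  by rewrite subrr; exact: ideal0.
by move=> i _; rewrite /= rmorph0 mul0r.
Qed.

Let evM : monoid_morphism ev.
Proof.
split=> [|f g]; first by rewrite -[1]/(series_const 1) ev_const rmorph1.
apply: sep => n; exists (part (f * g) n); split=> //.
rewrite -(subrKA (part f n * part g n)); apply: idealD => //.
  rewrite -(subrKA (part f n * ev g)) -mulrBl -mulrBr.
  by apply: idealD => //; [exact: idealMr|exact: idealMl].
rewrite !partE -hornerM -rmorphM -hornerN -hornerD -rmorphB; apply: horner_exp => i ni.
rewrite coefB coef_poly ni coefM; apply/eqP; rewrite subr_eq0; apply/eqP.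
apply: eq_bigr => j _; rewrite !coef_poly ifT ?ifT //.
  exact: leq_ltn_trans (leq_subr _ _) ni.
by apply: leq_ltn_trans ni; rewrite -ltnS.
Qed.

(** The value is the limit of the partial sums. The last clause splits off the first [t] terms,
    which isolates the leading term of a nonzero series. *)
Lemma series_eval : exists e : {rmorphism series A -> D},
  [/\ forall f n, ideal_exp m n (e f - \sum_(i < n) phi (f i) * x ^+ i),
      forall a, e (series_const a) = phi a, e (series_X A) = x &
      forall f t, e f = \sum_(i < t) phi (f i) * x ^+ i +
        x ^+ t * e (fun i => f (i + t)%N)].
Proof.
pose mB := GRing.isZmodMorphism.Build (series A) D ev evB.
pose mM := GRing.isMonoidMorphism.Build (series A) D ev evM.
pose E : {rmorphism series A -> D} := HB.pack ev mB mM.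
exists E; have shift f t : E f = \sum_(i < t) phi (f i) * x ^+ i +
    x ^+ t * E (fun i => f (i + t)%N).
  apply: sep => n; exists (part f (t + n)%N); split.
    by apply: (ideal_exp_le im (leq_addl t n)); exact: evP.
  have -> : part f (t + n)%N = \sum_(i < t) phi (f i) * x ^+ i +
      x ^+ t * part (fun i => f (i + t)%N) n.
    rewrite /part big_split_ord mulr_sumr /=; congr (_ + _).
    by apply: eq_bigr => i _; rewrite mulrCA -exprD addnC.
  by rewrite opprD addrACA subrr add0r -mulrBr; apply: idealMl => //; exact: evP.
split; [exact: evP|exact: ev_const| |exact: shift].
rewrite (shift _ 1%N) big_ord1 rmorph0 mul0r add0r.
have -> : (fun i => series_X A (i + 1)%N) = 1 :> series A.
  by apply/funext => -[|i] //; rewrite addn1.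
by rewrite rmorph1 mulr1.
Qed.

End SeriesEval.

(** * Power series rings over a coefficient ring *)

Definition rspan (A S : comNzRingType) (f : A -> S) (es : seq S) : set S :=
  [set z | exists c : 'I_(size es) -> A, z = \sum_(i < size es) f (c i) * es`_i].

(** All positive exponents are required at once because stage [e] of the algebra uses
    [q = p ^ e]. *)
Definition frob_regular (A : comNzRingType) (ys : seq A) := forall q, (0 < q)%N ->
  forall k, (k < size ys)%N -> forall a,
  gen_ideal [seq y ^+ q | y <- take k ys] (ys`_k ^+ q * a) ->
  gen_ideal [seq y ^+ q | y <- take k ys] a.

(** The threshold [N] serves the passage to series: the generator [X ^ q] leaves coefficient [i]
    undisturbed only when [q > i], so small exponents must be discarded. *)
Definition frob_separated (A : comNzRingType) (ys : seq A) := forall N a,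
  (forall q, (N <= q)%N -> gen_ideal [seq y ^+ q | y <- ys] a) -> a = 0.

Section SeriesCover.

Lemma frob_regular_series (A : comNzRingType) (ys : seq A) :
  frob_regular ys -> frob_regular (rcons (map (@series_const A) ys) (series_X A)).
Proof.
move=> reg q q0 k; rewrite size_rcons size_map ltnS => ks f.
have takeE : [seq y ^+ q | y <- take k (rcons (map (@series_const A) ys) (series_X A))] =
    map (@series_const A) [seq y ^+ q | y <- take k ys].
  rewrite -cats1 takel_cat ?size_map // -map_take -!map_comp.
  by apply: eq_map => y /=; rewrite rmorphXn.
rewrite takeE nth_rcons size_map !gen_ideal_series_const.
have [kl|kl] := ltnP k (size ys).
  move=> h i; apply: reg => //; have := h i.
  by rewrite (nth_map 0) // -rmorphXn series_constM.
have -> : k = size ys by apply/eqP; rewrite eqn_leq ks kl.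
by rewrite eqxx => h i; have := h (i + q)%N; rewrite series_XnM ltnNge leq_addl /= addnK.
Qed.

Lemma frob_separated_series (A : comNzRingType) (ys : seq A) :
  frob_separated ys -> frob_separated (rcons (map (@series_const A) ys) (series_X A)).
Proof.
move=> sep N f h; apply/funext => i; apply: (sep (N + i.+1)%N) => q Nq.
have [Nq' iq] : (N <= q)%N /\ (i < q)%N.
  by split; apply: leq_trans Nq; [exact: leq_addr|exact: leq_addl].
have := h q Nq'; rewrite map_rcons.
have -> : [seq y ^+ q | y <- map (@series_const A) ys] =
    map (@series_const A) [seq y ^+ q | y <- ys].
  by rewrite -!map_comp; apply: eq_map => y /=; rewrite rmorphXn.
move=> hf; have : gen_ideal (series_X A ^+ q :: map (@series_const A) [seq y ^+ q | y <- ys]) f.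
  by apply: gen_ideal_mono hf => y; rewrite mem_rcons.
move=> /gen_ideal_cons[c [w [/gen_ideal_series_const hw ->]]].
suff -> : (c * series_X A ^+ q + w) i = w i by exact: hw.
have -> : (c * series_X A ^+ q + w) i = (c * series_X A ^+ q) i + w i by [].
by rewrite mulrC series_XnM iq add0r.
Qed.

Variables (D k : comNzRingType) (m : set D) (phi : {rmorphism k -> D}).
Hypotheses (noeth : noetherian D) (hm : local_ring m) (hc : adically_complete m).
Hypothesis phi_unit : forall c, c <> 0 -> ~ m (phi c).

Let im : is_ideal m. Proof. by case: hm => -[]. Qed.

(** Each remainder is approximated modulo [J] and [x], and its cofactor of [x] is the next
    remainder; the successive coefficients form the series [g j]. By [krull_closed], [J] is closed,
    so the limit is correct modulo [J]. *)
Lemma series_span (A : comNzRingType) (f : {rmorphism A -> D})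
    (e : {rmorphism series A -> D}) x es J : is_ideal J -> m x ->
  (forall g n, ideal_exp m n (e g - \sum_(i < n) f (g i) * x ^+ i)) ->
  (forall d, exists z, rspan f es z /\ ideal_add J (gen_ideal [:: x]) (d - z)) ->
  forall d, exists z, rspan e es z /\ J (d - z).
Proof.
move=> iJ mx eP h d; have iX n : is_ideal (ideal_exp m n) by exact: ideal_exp_ideal.
have h1 d' : exists cr : ('I_(size es) -> A) * D,
    J (d' - \sum_(i < size es) f (cr.1 i) * es`_i - cr.2 * x).
  have [_ [[c ->] [a [_ [Ja [r ->] E]]]]] := h d'; exists (c, r ord0).
  by rewrite E big_ord1 /= addrK.
have [cr crP] := choice h1; pose it t := iter t (fun d' => (cr d').2) d.
pose g (j : 'I_(size es)) : series A := fun t => (cr (it t)).1 j.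
exists (\sum_(j < size es) e (g j) * es`_j); split; first by exists g.
apply: (krull_closed noeth hm iJ) => n.
have Jn : J (d - \sum_(t < n) (\sum_(j < size es) f (g j t) * es`_j) * x ^+ t - it n * x ^+ n).
  elim: n => [|n IH]; first by rewrite big_ord0 subr0 mulr1 subrr; exact: ideal0.
  rewrite big_ord_recr /=; set s := \sum_(t < n) _ in IH *; set u := \sum_(j < _) _.
  have -> : d - (s + u * x ^+ n) - it n.+1 * x ^+ n.+1 =
      (d - s - it n * x ^+ n) + x ^+ n * (it n - u - it n.+1 * x).
    rewrite !mulrBr [x ^+ n * (_ * x)]mulrCA -exprSr ![x ^+ n * _]mulrC.
    by rewrite opprD !addrA subrK.
  by apply: idealD => //; apply: idealMl => //; exact: (crP (it n)).
exists (d - \sum_(t < n) (\sum_(j < size es) f (g j t) * es`_j) * x ^+ t - it n * x ^+ n).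
exists (it n * x ^+ n + \sum_(j < size es)
   (\sum_(t < n) f (g j t) * x ^+ t - e (g j)) * es`_j); split=> //.
  apply: idealD => //; first by apply: idealMl => //; exact: ideal_exp_mem.
  apply: ideal_sum => // j _; apply: idealMr => //; rewrite -opprB; exact: idealN.
rewrite addrA subrK -addrA; congr (_ + _).
have -> : \sum_(t < n) (\sum_(j < size es) f (g j t) * es`_j) * x ^+ t =
    \sum_(j < size es) (\sum_(t < n) f (g j t) * x ^+ t) * es`_j.
  under eq_bigr do rewrite mulr_suml.
  rewrite exchange_big; apply: eq_bigr => j _; rewrite mulr_suml.
  by apply: eq_bigr => t _; rewrite mulrAC.
rewrite [X in _ = _ + X](_ : _ = \sum_(j < size es) (\sum_(t < n) f (g j t) * x ^+ t) * es`_j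
    - \sum_(j < size es) e (g j) * es`_j) ?addKr //.
by rewrite -sumrB; apply: eq_bigr => j _; rewrite mulrBl.
Qed.

(** The spanning clause allows any [J], since adjoining a variable moves [x] into [J]. The last
    clause is a substitution [x_i = s ^ N_i] making the image of a nonzero [f] a unit times a power
    of [s]; the first exponent is 1, so that [s = x_1] costs no relation. *)
Theorem power_series_cover (xs es : seq D) : {in xs, forall x, m x} ->
  exists (A : comNzRingType) (e : {rmorphism A -> D}) (ys : seq A),
  [/\ map e ys = xs, frob_regular ys, frob_separated ys,
    forall J, is_ideal J ->
      (forall d, exists z, rspan phi es z /\ ideal_add J (gen_ideal xs) (d - z)) ->
      forall d, exists z, rspan e es z /\ J (d - z) &
    forall f s, f <> 0 -> m s -> exists (N : seq nat) M u,
      [/\ size N = size xs, all (leq 1) N /\ head 1%N N = 1%N, ~ m u,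
         xs = [::] -> M = 0%N &
        gen_ideal [seq z.1 - s ^+ z.2 | z <- zip xs N] (e f - u * s ^+ M)]].
Proof.
elim/last_ind: xs => [_|xs x IH xsm].
  exists k, phi, [::]; split=> //.
  - by move=> N a /(_ N (leqnn _)) /gen_ideal_nil.
  - move=> J hJ h d; have [z [hz [a [b [Ja /gen_ideal_nil-> E]]]]] := h d.
    by exists z; split=> //; rewrite E addr0.
  - move=> f s /phi_unit fu _; exists [::], 0%N, (phi f); split=> //.
    by rewrite mulr1 subrr; exact: ideal0.
have mx : m x by apply: xsm; rewrite mem_rcons mem_head.
have [|A [f [ys [ysE reg sep span inj]]]] := IH.
  by move=> y yx; apply: xsm; rewrite mem_rcons inE yx orbT.
have [e [eP eC eX eS]] := series_eval f im hc mx.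
exists (series A), e, (rcons (map (@series_const A) ys) (series_X A)); split.
- rewrite map_rcons eX -map_comp; congr rcons; rewrite -ysE.
  by apply: eq_map => y /=; exact: eC.
- exact: frob_regular_series.
- exact: frob_separated_series.
- move=> J iJ h; apply: (series_span iJ mx eP); apply: span.
    exact: ideal_add_ideal.
  move=> d; have [z [hz dz]] := h d; exists z; split=> //.
  have ix : is_ideal (gen_ideal [:: x]) by [].
  have ixs : is_ideal (gen_ideal xs) by [].
  have iJx := ideal_add_ideal iJ ix.
  move: dz; apply: ideal_add_sub; first exact: ideal_add_ideal.
    exact: subset_trans (ideal_addl ix) (ideal_addl ixs).
  apply: gen_ideal_sub; first exact: ideal_add_ideal.
  move=> y; rewrite mem_rcons inE => /predU1P[->|yxs].
    by apply: ideal_addl => //; apply: ideal_addr => //; apply: gen_ideal_mem; rewrite inE.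
  by apply: ideal_addr => //; exact: gen_ideal_mem.
move=> g s g0 ms.
have [t gt tmin] : exists2 t, g t <> 0 & forall i, (i < t)%N -> g i = 0.
  have ext : exists t, g t != 0.
    apply: contrapT => nt; apply: g0; apply/funext => t.
    by apply: contrapT => /eqP gt; apply: nt; exists t.
  case: (ex_minnP ext) => t /eqP gt tmin; exists t => // i it; apply: contrapT => /eqP /tmin.
  by rewrite leqNgt it.
have [N [M [u [sN [N1 hN] mu M0 hI]]]] := inj _ s gt ms.
(* The lowest nonzero coefficient of [g] becomes [u * s ^ M]. Substituting [s ^ M.+1] for [x] makes
   the later terms divisible by a higher power of [s], so the unit only changes by a multiple of
   [s]. *)
exists (rcons N M.+1), (M.+1 * t + M)%N, (u + s * e (fun i => g (i + t.+1)%N)); split.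
- by rewrite !size_rcons sN.
- rewrite all_rcons N1; split=> //; case: N sN hN {N1 hI} => [|//].
  by move=> /esym/size0nil/M0->.
- by move=> mus; apply: mu; rewrite -(addrK (s * e (fun i => g (i + t.+1)%N)) u);
    apply: idealB => //; exact: idealMr.
- by move=> /(congr1 size); rewrite size_rcons.
rewrite zip_rcons // map_rcons /=; set zs := map _ _ in hI *.
have igen : is_ideal (gen_ideal (rcons zs (x - s ^+ M.+1))) by [].
have Ix : gen_ideal (rcons zs (x - s ^+ M.+1)) (x - s ^+ M.+1).
  by apply: gen_ideal_mem; rewrite mem_rcons mem_head.
have Ig : gen_ideal (rcons zs (x - s ^+ M.+1)) (f (g t) - u * s ^+ M).
  by apply: gen_ideal_mono hI => y yzs; rewrite mem_rcons inE yzs orbT.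
have gE : e g = x ^+ t * (f (g t) + x * e (fun i => g (i + t.+1)%N)).
  rewrite (eS g t.+1) big_ord_recr /= big1 ?add0r; last first.
    by move=> i _; rewrite tmin // rmorph0 mul0r.
  by rewrite mulrDr mulrC exprSr mulrA.
rewrite gE exprD exprM.
have -> : (u + s * e (fun i => g (i + t.+1)%N)) * (s ^+ M.+1 ^+ t * s ^+ M) =
    s ^+ M.+1 ^+ t * (u * s ^+ M + s ^+ M.+1 * e (fun i => g (i + t.+1)%N)).
  by rewrite mulrCA; congr (_ * _); rewrite mulrDl exprS -!mulrA; congr (_ + _ * _); rewrite mulrC.
apply: ideal_congrM => //; first exact: ideal_congrX.
apply: ideal_congrD => //; apply: ideal_congrM => //.
by rewrite subrr; exact: ideal0.
Qed.

End SeriesCover.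

(** * The algebra of bounded Frobenius sequences *)

Section Subring.
Variables (T : comNzRingType) (S : subringClosed T).
Record subring := Subring { subring_val : T; _ : subring_val \in S }.
HB.instance Definition _ := [isSub for subring_val].
HB.instance Definition _ := [Choice of subring by <:].
HB.instance Definition _ := [SubChoice_isSubComNzRing of subring by <:].
End Subring.

Section BigCM.
Variables (A : comNzRingType) (L : fieldType) (phi : {rmorphism A -> L}).
Hypothesis phi_inj : forall a, phi a = 0 -> a = 0.

Definition ispan (I : set A) (bs : seq L) : set L :=
  [set z | exists c : 'I_(size bs) -> A,
    (forall i, I (c i)) /\ z = \sum_(i < size bs) phi (c i) * bs`_i].

Definition independent (bs : seq L) := forall c : 'I_(size bs) -> A,
  \sum_(i < size bs) phi (c i) * bs`_i = 0 -> forall i, c i = 0.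

Lemma ispan0 I bs : is_ideal I -> ispan I bs 0.
Proof.
move=> hI; exists (fun=> 0); split=> [i|]; first exact: ideal0.
by rewrite big1 // => i _; rewrite rmorph0 mul0r.
Qed.

Lemma ispanD I bs z w : is_ideal I -> ispan I bs z -> ispan I bs w -> ispan I bs (z + w).
Proof.
move=> hI [c [hc ->]] [d [hd ->]]; exists (fun i => c i + d i).
split=> [i|]; first exact: idealD.
by rewrite -big_split; apply: eq_bigr => i _; rewrite rmorphD mulrDl.
Qed.

Lemma ispanZ I J bs a z : I a -> is_ideal I -> ispan J bs z -> ispan I bs (phi a * z).
Proof.
move=> Ia hI [c [hc ->]]; exists (fun i => a * c i); split=> [i|]; first exact: idealMr.
by rewrite mulr_sumr; apply: eq_bigr => i _; rewrite mulrA -rmorphM.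
Qed.

Lemma ispan_sum I bs (n : nat) (F : 'I_n -> L) : is_ideal I ->
  (forall i, ispan I bs (F i)) -> ispan I bs (\sum_(i < n) F i).
Proof.
by move=> hI h; elim/big_ind: _ => //; [exact: ispan0|move=> z w; exact: ispanD].
Qed.

Lemma rspan_ispan es z : rspan phi es z <-> ispan setT es z.
Proof. by split=> [[c ->]|[c [_ ->]]]; exists c. Qed.

Lemma rspan_mem es b : b \in es -> rspan phi es b.
Proof.
move=> bes; have bi : (index b es < size es)%N by rewrite index_mem.
exists (fun i => if i == Ordinal bi then 1 else 0).
rewrite (bigD1 (Ordinal bi)) //= eqxx rmorph1 mul1r nth_index // big1 ?addr0 //.
by move=> i /negbTE->; rewrite rmorph0 mul0r.
Qed.

Let idT : is_ideal [set: A]. Proof. by []. Qed.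

Lemma ispan_trans I (es bs : seq L) : is_ideal I -> {in es, forall b, rspan phi bs b} ->
  ispan I es `<=` ispan I bs.
Proof.
move=> hI h _ [c [hc ->]]; apply: ispan_sum => // i.
by apply: ispanZ => //; apply/rspan_ispan; apply: h; exact: mem_nth.
Qed.

(** If a multiple [phi r * a] is in the span of [bs], dividing [bs] by [phi r] captures [a] and
    keeps independence; otherwise [a] itself is adjoined. *)
Lemma independent_cover (es : seq L) : exists2 bs, independent bs &
  {in es, forall b, rspan phi bs b}.
Proof.
elim: es => [|a es [bs ind hes]]; first by exists [::] => // c _ [].
have [[r [r0 [c rE]]]|nr] := pselect (exists r, r <> 0 /\ rspan phi bs (phi r * a)).
  have pr0 : phi r != 0 by apply/eqP => /phi_inj.
  pose bs' := [seq b / phi r | b <- bs].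
  have sz : size bs' = size bs by rewrite size_map.
  have bsE z : rspan phi bs (phi r * z) -> rspan phi bs' z.
    move=> [d dE]; exists (fun i => d (cast_ord sz i)).
    apply: (mulfI pr0); rewrite dE mulr_sumr (reindex (cast_ord sz)) /=; last first.
      by exists (cast_ord (esym sz)) => i _; rewrite ?cast_ordK ?cast_ordKV.
    apply: eq_bigr => i _; rewrite (nth_map 0) -?sz // [RHS]mulrCA; congr (_ * _).
    by rewrite mulrC mulfVK.
  exists bs'; last first.
    move=> b; rewrite inE => /predU1P[->|bes]; apply: bsE; first by exists c.
    by apply/rspan_ispan; apply: (ispanZ (J := setT)) => //; apply/rspan_ispan; exact: hes.
  move=> d dE i; have := ind (fun i => d (cast_ord (esym sz) i)).
  move=> /(_ _ (cast_ord sz i)); rewrite cast_ordK; apply.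
  apply: (mulfI (invr_neq0 pr0)); rewrite mulr0; apply: etrans dE; rewrite mulr_sumr.
  rewrite (reindex (cast_ord sz)) /=; last first.
    by exists (cast_ord (esym sz)) => j _; rewrite ?cast_ordK ?cast_ordKV.
  apply: eq_bigr => j _; rewrite cast_ordK (nth_map 0) -?sz // mulrCA.
  by rewrite [_^-1 * _]mulrC.
exists (a :: bs) => [c|b].
  rewrite big_ord_recl /= => cE.
  have c0 : c ord0 = 0.
    apply: contrapT => c0; apply: nr; exists (c ord0); split=> //.
    exists (fun i => - c (lift ord0 i)); move/eqP: cE; rewrite addr_eq0 => /eqP->.
    by rewrite -sumrN; apply: eq_bigr => i _; rewrite rmorphN mulNr.
  move: cE; rewrite c0 rmorph0 mul0r add0r => /(ind (fun i => c (lift ord0 i))) cl i.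
  by case: (unliftP ord0 i) => [j|] ->.
rewrite inE => /predU1P[->|bes]; first exact: rspan_mem (mem_head _ _).
have /rspan_ispan hb := hes _ bes; apply/rspan_ispan; apply: ispan_trans hb => // b' b'bs.
by apply: rspan_mem; rewrite inE b'bs orbT.
Qed.

Variables (p : nat) (pL : p \in [pchar L]).
Variables (Rp : comNzRingType) (psi : {rmorphism Rp -> L}).
Hypothesis psi_fin : forall z, exists es, forall n, rspan phi es (psi z ^+ n).

Definition bounded_seq : {pred nat -> L} :=
  [pred f | `[< exists es, forall e, rspan phi es (f e) >]].

Lemma bounded_seq_subring : subring_closed bounded_seq.
Proof.
split=> [|f g /asboolP[es hes] /asboolP[es' hes']|
    f g /asboolP[es hes] /asboolP[es' hes']]; apply/asboolP.
- by exists [:: 1] => e; apply: rspan_mem; rewrite inE.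
- exists (es ++ es') => e; apply/rspan_ispan.
  have -> : (f - g) e = f e + phi (- 1) * g e by rewrite rmorphN1 mulN1r.
  apply: ispanD => //; last apply: ispanZ => //.
    have /rspan_ispan := hes e; apply: ispan_trans => // b bes.
    by apply: rspan_mem; rewrite mem_cat bes.
  have /rspan_ispan := hes' e; apply: ispan_trans => // b bes.
  by apply: rspan_mem; rewrite mem_cat bes orbT.
- exists [seq a * b | a <- es, b <- es'] => e; apply/rspan_ispan.
  have [c fE] := hes e; have [d gE] := hes' e.
  have -> : (f * g) e = f e * g e by [].
  rewrite fE gE mulr_suml; apply: ispan_sum => // i.
  rewrite mulr_sumr; apply: ispan_sum => // j.
  rewrite mulrACA -rmorphM; apply: ispanZ => //; apply/rspan_ispan; apply: rspan_mem.
  by apply: allpairs_f; exact: mem_nth.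
Qed.

HB.instance Definition _ :=
  GRing.isSubringClosed.Build (nat -> L) bounded_seq bounded_seq_subring.

Definition bigCM := subring bounded_seq.
HB.instance Definition _ := GRing.ComNzRing.on bigCM.
Definition bigCM_seq (c : bigCM) : nat -> L := subring_val c.

Definition frob_seq (z : Rp) : nat -> L := fun e => psi z ^+ (p ^ e).

Lemma frob_seq_bounded z : frob_seq z \in bounded_seq.
Proof. by apply/asboolP; have [es hes] := psi_fin z; exists es => e; exact: hes. Qed.

Definition to_bigCM z : bigCM := Subring (frob_seq_bounded z).

Lemma to_bigCM_is_zmod_morphism : zmod_morphism to_bigCM.
Proof.
move=> x y; apply: val_inj; apply/funext => e; rewrite /= /frob_seq rmorphB.
have pn : [pchar L].-nat (p ^ e)%N by rewrite pnatX pnatE ?(pcharf_prime pL) // pL.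
by rewrite exprDn_pchar // exprNn_pchar.
Qed.

Lemma to_bigCM_is_monoid_morphism : monoid_morphism to_bigCM.
Proof.
split=> [|x y]; apply: val_inj; apply/funext => e; rewrite /= /frob_seq.
  by rewrite rmorph1 expr1n.
by rewrite rmorphM exprMn.
Qed.

Variables (ys : seq A) (xs : seq Rp).
Hypothesis xys : map psi xs = map phi ys.

Let fgen e (zs : seq A) := gen_ideal [seq y ^+ (p ^ e) | y <- zs].

(* The ideal of [bigCM] generated by the [x_i] is computed termwise on the
   coordinates in a basis [bs] of a free module containing the sequence. *)
Lemma gen_ideal_bigCM (us : seq Rp) (zs : seq A) (c : bigCM) :
  map psi us = map phi zs ->
  gen_ideal (map to_bigCM us) c <->
  exists bs, independent bs /\ forall e, ispan (fgen e zs) bs (bigCM_seq c e).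
Proof.
elim: us zs c => [|u us IH] [|z zs] // c => [_|[uz /IH{}IH]]; split.
- move=> /gen_ideal_nil->; exists [::]; split=> [d _ []//|e].
  by apply: ispan0; exact: gen_ideal_ideal.
- move=> [bs [_ hbs]]; apply/gen_ideal_nil; apply: val_inj; apply/funext => e.
  have [d [hd /= cE]] := hbs e; rewrite -[LHS]/(bigCM_seq c e) cE big1 // => i _.
  by have /gen_ideal_nil-> := hd i; rewrite rmorph0 mul0r.
- move=> /gen_ideal_cons[a [w [/IH[bs1 [ind1 h1]] ->]]].
  have /asboolP[es hes] := valP a.
  have [bs ind hbs] := independent_cover (bs1 ++ es).
  exists bs; split=> // e; have iz : is_ideal (fgen e (z :: zs)) by exact: gen_ideal_ideal.
  have -> : bigCM_seq (a * to_bigCM u + w) e =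
      phi (z ^+ (p ^ e)) * bigCM_seq a e + bigCM_seq w e.
    by rewrite rmorphXn -uz mulrC.
  apply: ispanD => //.
    apply: (ispanZ (J := setT)) => //; first by apply: gen_ideal_mem; exact: mem_head.
    have /rspan_ispan := hes e; apply: ispan_trans => // b bes.
    by apply: hbs; rewrite mem_cat bes orbT.
  have [d [hd ->]] := h1 e; apply: ispan_sum => // i.
  apply: (ispanZ (J := setT)) => //.
    by apply: gen_ideal_mono (hd i) => y yzs; rewrite inE yzs orbT.
  by apply/rspan_ispan; apply: hbs; rewrite mem_cat mem_nth.
- move=> [bs [ind hbs]]; apply/gen_ideal_cons.
  have hc e : exists dw : ('I_(size bs) -> A) * ('I_(size bs) -> A),
      (forall i, fgen e zs (dw.2 i)) /\
      bigCM_seq c e = phi (z ^+ (p ^ e)) * (\sum_(i < size bs) phi (dw.1 i) * bs`_i) +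
        \sum_(i < size bs) phi (dw.2 i) * bs`_i.
    have [d [hd ->]] := hbs e.
    have hd' i : exists dw : A * A, fgen e zs dw.2 /\ d i = dw.1 * z ^+ (p ^ e) + dw.2.
      by have /gen_ideal_cons[b [w [hw ->]]] := hd i; exists (b, w).
    have [dw dwP] := choice hd'.
    exists (fun i => (dw i).1, fun i => (dw i).2); split=> [i|]; first by case: (dwP i).
    rewrite mulr_sumr -big_split; apply: eq_bigr => i _ /=.
    by have [_ ->] := dwP i; rewrite rmorphD rmorphM mulrDl mulrA [phi (z ^+ _) * _]mulrC.
  have [dw dwP] := choice hc.
  (* Both new sequences have coordinates in the same [bs] at every [e], which makes them bounded. *)
  pose af e := \sum_(i < size bs) phi ((dw e).1 i) * bs`_i.
  pose wf e := \sum_(i < size bs) phi ((dw e).2 i) * bs`_i.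
  have ha : af \in bounded_seq.
    by apply/asboolP; exists bs => e; exists (dw e).1.
  have hw : wf \in bounded_seq.
    by apply/asboolP; exists bs => e; exists (dw e).2.
  exists (Subring ha), (Subring hw); split.
    by apply/IH; exists bs; split=> // e; exists (dw e).2; case: (dwP e).
  apply: val_inj; apply/funext => e; have [_ E] := dwP e.
  by rewrite -[LHS]/(bigCM_seq c e) E rmorphXn -uz mulrC.
Qed.

Lemma bigCM_regular : frob_regular ys -> forall k, (k < size xs)%N ->
  forall c : bigCM, gen_ideal (map to_bigCM (take k xs)) (to_bigCM xs`_k * c) ->
  gen_ideal (map to_bigCM (take k xs)) c.
Proof.
move=> reg k kxs c; have sz : size xs = size ys by rewrite -(size_map psi) xys size_map.
have xyk : map psi (take k xs) = map phi (take k ys) by rewrite !map_take xys.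
have yk : psi xs`_k = phi ys`_k.
  by rewrite -(nth_map 0 0) // xys (nth_map 0) // -sz.
move=> /(gen_ideal_bigCM _ xyk)[bs1 [ind1 h1]]; apply/(gen_ideal_bigCM _ xyk).
have /asboolP[es hes] := valP c.
have [bs ind hbs] := independent_cover (bs1 ++ es).
exists bs; split=> // e; have iz : is_ideal (fgen e (take k ys)) by exact: gen_ideal_ideal.
have : ispan setT bs (bigCM_seq c e).
  have /rspan_ispan := hes e; apply: ispan_trans => // b bes.
  by apply: hbs; rewrite mem_cat bes orbT.
move=> [d [_ cE]]; rewrite cE; exists d; split=> // i.
have : ispan (fgen e (take k ys)) bs (phi (ys`_k ^+ (p ^ e)) * bigCM_seq c e).
  rewrite rmorphXn -yk; apply: ispan_trans (h1 e) => // b bes.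
  by apply: hbs; rewrite mem_cat bes.
move=> [d' [hd' E]]; apply: reg.
- by rewrite expn_gt0 prime_gt0 ?(pcharf_prime pL).
- by rewrite -sz.
(* The basis contains both the sequence and its multiple, so independence compares coordinates and
   [frob_regular] applies to each. *)
suff -> : ys`_k ^+ (p ^ e) * d i = d' i by exact: hd'.
apply/eqP; rewrite -subr_eq0; apply/eqP; move: i.
apply: (ind (fun i => ys`_k ^+ (p ^ e) * d i - d' i)).
transitivity (phi (ys`_k ^+ (p ^ e)) * bigCM_seq c e - phi (ys`_k ^+ (p ^ e)) * bigCM_seq c e).
  rewrite {2}E cE mulr_sumr -sumrB; apply: eq_bigr => i _.
  by rewrite rmorphB rmorphM mulrBl mulrA.
by rewrite subrr.
Qed.

(** The unit is a constant sequence, so its coordinates do not depend on the stage and lie in the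
    ideals of all stages. *)
Lemma bigCM_proper : frob_separated ys -> ~ gen_ideal (map to_bigCM xs) 1.
Proof.
move=> sep /(gen_ideal_bigCM _ xys)[bs [ind h]].
have [c [_ cE]] := h 0%N.
have c0 i : c i = 0.
  apply: (sep 0%N) => q _.
  (* Stage [q] has exponent [p ^ q], which is at least [q]; its ideal is therefore inside that of
     the [q]-th powers. *)
  have qp : (q <= p ^ q)%N by apply/ltnW/ltn_expl/prime_gt1/(pcharf_prime pL).
  have : fgen q ys (c i).
    have [d [hd dE]] := h q; suff -> : c i = d i by exact: hd.
    apply/eqP; rewrite -subr_eq0; apply/eqP; move: i.
    apply: (ind (fun i => c i - d i)); transitivity (1 - 1 : L); last by rewrite subrr.
    rewrite [X in X - _](_ : 1 = bigCM_seq 1 0%N) // [X in _ - X](_ : 1 = bigCM_seq 1 q) //.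
    rewrite cE dE -sumrB; apply: eq_bigr => i _.
    by rewrite rmorphB mulrBl.
  apply: gen_ideal_sub => // _ /mapP[y yys ->].
  rewrite -(subnK qp) exprD; apply: idealMl => //.
  by apply: gen_ideal_mem; exact: map_f.
have /eqP : bigCM_seq 1 0%N = 0 by rewrite cE big1 // => i _; rewrite c0 rmorph0 mul0r.
by rewrite oner_eq0.
Qed.

End BigCM.

Theorem big_CM_exists (A : comNzRingType) (L : fieldType) (phi : {rmorphism A -> L})
    (p : nat) (Rp : comNzRingType) (psi : {rmorphism Rp -> L})
    (ys : seq A) (xs : seq Rp) :
  (forall a, phi a = 0 -> a = 0) -> p \in [pchar L] ->
  (forall z, exists es, forall n, rspan phi es (psi z ^+ n)) ->
  map psi xs = map phi ys -> frob_regular ys -> frob_separated ys ->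
  exists (C : comNzRingType) (h : {rmorphism Rp -> C}),
    [/\ forall z, psi z = 0 -> h z = 0,
      forall k, (k < size xs)%N -> forall c,
        gen_ideal (map h (take k xs)) (h xs`_k * c) -> gen_ideal (map h (take k xs)) c &
      ~ gen_ideal (map h xs) 1].
Proof.
move=> phi_inj pL psi_fin xys reg sep.
pose f := to_bigCM p psi_fin.
pose fB := GRing.isZmodMorphism.Build Rp (bigCM phi) f (to_bigCM_is_zmod_morphism pL psi_fin).
pose fM := GRing.isMonoidMorphism.Build Rp (bigCM phi) f (to_bigCM_is_monoid_morphism p psi_fin).
pose h : {rmorphism Rp -> bigCM phi} := HB.pack f fB fM.
exists (bigCM phi), h; split.
- move=> z z0; apply: val_inj; apply/funext => e; rewrite /= /frob_seq z0.
  by rewrite expr0n gtn_eqF // expn_gt0 prime_gt0 ?(pcharf_prime pL).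
- exact: (bigCM_regular phi_inj pL xys reg).
- exact: (bigCM_proper phi_inj pL xys sep).
Qed.

(** * Quotients of complete local rings *)

Lemma gen_ideal_map (A B : comNzRingType) (f : {rmorphism A -> B}) (s : seq A) z :
  gen_ideal s z -> gen_ideal (map f s) (f z).
Proof.
have iP : is_ideal [set a | gen_ideal (map f s) (f a)].
  split=> [|a b /= ha hb|a b /= hb].
  - by rewrite /= rmorph0; exact: ideal0.
  - by rewrite rmorphD; exact: idealD.
  - by rewrite rmorphM; exact: idealMl.
move: z; apply: (gen_ideal_sub iP) => a sa.
by apply: gen_ideal_mem; exact: map_f.
Qed.

Section LocalQuotient.
Variables (R D : comNzRingType) (pi : {rmorphism R -> D}) (m Q : set R).
Hypotheses (pi_surj : forall z, exists x, pi x = z) (piQ : forall x, pi x = 0 <-> Q x).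
Hypotheses (noeth : noetherian R) (hm : local_ring m) (hc : adically_complete m).
Hypothesis iQ : is_ideal Q.

Let im : is_ideal m. Proof. by case: hm => -[]. Qed.

Lemma preimage_ideal (I : set D) : is_ideal I -> is_ideal (pi @^-1` I).
Proof.
move=> hI; split=> [|a b /= ha hb|a b /= hb].
- by rewrite /preimage /= rmorph0; exact: ideal0.
- by rewrite /preimage /= rmorphD; exact: idealD.
- by rewrite /preimage /= rmorphM; exact: idealMl.
Qed.

Lemma image_ideal (I : set R) : is_ideal I -> is_ideal (pi @` I).
Proof.
move=> hI; split=> [|_ _ [a Ia <-] [b Ib <-]|d _ [b Ib <-]].
- by exists 0; [exact: ideal0|rewrite rmorph0].
- by exists (a + b); [exact: idealD|rewrite rmorphD].
- have [a <-] := pi_surj d.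
  by exists (a * b); [exact: idealMl|rewrite rmorphM].
Qed.

Lemma quotient_noetherian : noetherian D.
Proof.
move=> I hI; have [s sE] := noeth (preimage_ideal hI).
exists (map pi s); apply/seteqP; split=> [d Id|].
  have [a ad] := pi_surj d; rewrite -ad; apply: gen_ideal_map.
  by rewrite -sE /preimage /= ad.
apply: gen_ideal_sub => // _ /mapP[a sa ->].
suff : (pi @^-1` I) a by [].
by rewrite sE; exact: gen_ideal_mem.
Qed.

Lemma quotient_local : Q `<=` m -> local_ring (pi @` m).
Proof.
move=> Qm; have [[_ mT mmax] mU] := hm.
have pre (I : set D) : is_ideal I -> I <> setT -> pi @^-1` I <> setT.
  move=> hI IT /(congr1 (fun X : set R => X 1)); rewrite /preimage /= rmorph1 => I1.
  by apply: (proper_ideal1 hI IT); rewrite I1.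
have mD1 : pi @` m <> setT.
  move=> /(congr1 (fun X : set D => X 1)) E.
  have [a ma a1] : (pi @` m) 1 by rewrite E.
  apply: (proper_ideal1 im mT); apply: (idealBr im _ ma); apply: Qm; apply/piQ.
  by rewrite rmorphB rmorph1 a1 subrr.
have sub (I : set D) : is_ideal I -> I <> setT -> I `<=` pi @` m.
  move=> hI IT d Id; have [a ad] := pi_surj d; exists a => //.
  apply: (local_sub noeth hm (preimage_ideal hI) (pre _ hI IT)).
  by rewrite /preimage /= ad.
have iD := image_ideal im.
split; first by split=> // J hJ mJ JT; apply/seteqP; split=> //; exact: sub.
by move=> m' [hm' m'T m'max]; apply/esym/m'max => //; exact: sub.
Qed.

Lemma image_ideal_exp n d : ideal_exp (pi @` m) n d <-> exists2 a, ideal_exp m n a & pi a = d.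
Proof.
have iX k : is_ideal (ideal_exp m k) by exact: ideal_exp_ideal.
split; last first.
  have h : ideal_exp m n `<=` pi @^-1` (ideal_exp (pi @` m) n).
    have iD k : is_ideal (ideal_exp (pi @` m) k) by apply: ideal_exp_ideal; exact: image_ideal.
    elim: n => // n IH; apply: smul_sub; first exact: preimage_ideal.
    move=> a b ma /IH hb; rewrite /preimage /= rmorphM; apply: smul_mem => //; exists a.
  by move=> [a /h + <-].
elim: n d => [|n IH] d; first by have [a <-] := pi_surj d; exists a.
move: d; apply: (@smul_sub _ _ _ [set d | exists2 a, ideal_exp m n.+1 a & pi a = d]).
  exact: (image_ideal (iX n.+1)).
move=> _ d [a ma <-] /IH[b hb <-].
by exists (a * b); [exact: smul_mem|rewrite rmorphM].
Qed.

(** Separatedness is the closedness of [Q] given by [krull_closed]; a Cauchy sequence is lifted by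
    lifting its differences inside the powers of [m]. *)
Lemma quotient_complete : adically_complete (pi @` m).
Proof.
have iX k : is_ideal (ideal_exp m k) by exact: ideal_exp_ideal.
split=> [d hd|u hu].
  have [a ad] := pi_surj d; rewrite -ad; apply/piQ.
  apply: (krull_closed noeth hm iQ) => n.
  have /image_ideal_exp[b hb bd] := hd n.
  exists (a - b), b; rewrite subrK; split=> //.
  by apply/piQ; rewrite rmorphB ad bd subrr.
have hu' n : exists a, ideal_exp m n a /\ pi a = u n.+1 - u n.
  by have /image_ideal_exp[a ha aE] := hu n; exists a.
have [a aP] := choice hu'; have [v0 v0E] := pi_surj (u 0%N).
pose v n := v0 + \sum_(i < n) a i.
have vE n : pi (v n) = u n.
  elim: n => [|n IH]; first by rewrite /v big_ord0 addr0.
  by rewrite /v big_ord_recr addrA rmorphD -/(v n) IH /= (aP n).2 addrC subrK.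
have [|b hb] := hc.2 v.
  move=> n; rewrite /v big_ord_recr /= addrA [X in X - _]addrC addrK.
  by case: (aP n).
exists (pi b) => n; apply/image_ideal_exp; exists (b - v n); first exact: hb.
by rewrite rmorphB vE.
Qed.

End LocalQuotient.

(* Since [D / (xs)] has finite length, lifts of finitely many of its elements
   span it over the coefficient ring. *)
Lemma finite_span (D k : comNzRingType) (m : set D) (phi : {rmorphism k -> D})
    (xs : seq D) : noetherian D -> local_ring m ->
  (forall d, exists c, m (d - phi c)) -> m `<=` radical (gen_ideal xs) ->
  exists es, forall d, exists z, rspan phi es z /\ gen_ideal xs (d - z).
Proof.
move=> noeth hm surj mrad; have im : is_ideal m by case: hm => -[].
have [g mE] := noeth _ im.
have [t tx] : exists t, ideal_exp m t `<=` gen_ideal xs.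
  rewrite mE; apply: radical_exp_sub => // a ga; apply: mrad; rewrite mE.
  exact: gen_ideal_mem.
suff [es hes] : exists es, forall d, exists z, rspan phi es z /\ ideal_exp m t (d - z).
  by exists es => d; have [z [hz dz]] := hes d; exists z; split=> //; exact: tx.
have iX n : is_ideal (ideal_exp m n) by exact: ideal_exp_ideal.
elim: t {tx} => [|n [es hes]].
  by exists [::] => d; exists 0; split=> //; exists (fun=> 0); rewrite big_ord0.
have [h hE] := noeth _ (iX n).
exists (es ++ h) => d; have [z [[c zE] dz]] := hes d.
have [a aE] : gen_ideal h (d - z) by rewrite -hE.
have [k' k'P] := choice surj.
exists (z + \sum_(i < size h) phi (k' (a i)) * h`_i); split.
  have e : size (es ++ h) = (size es + size h)%N by rewrite size_cat.
  pose f (i : 'I_(size es + size h)) :=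
    match fintype.split i with inl j => c j | inr j => k' (a j) end.
  exists (fun i => f (cast_ord e i)).
  rewrite (reindex (cast_ord (esym e))) /=; last first.
    by exists (cast_ord e) => i _; rewrite ?cast_ordK ?cast_ordKV.
  rewrite big_split_ord /= zE; congr (_ + _); apply: eq_bigr => i _.
    by rewrite cast_ordKV /f (unsplitK (inl i)) nth_cat ltn_ord.
  by rewrite cast_ordKV /f (unsplitK (inr i)) nth_cat ltnNge leq_addr /= addKn.
rewrite opprD addrA aE -sumrB; apply: ideal_sum => // i _.
have hi : ideal_exp m n h`_i by rewrite hE; apply: gen_ideal_mem; exact: mem_nth.
by rewrite -mulrBl; apply: smul_mem.
Qed.

Lemma integral_powers_span (D L : comNzRingType) (g : {rmorphism D -> L}) (z : L) n (c : nat -> D) :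
  z ^+ n = \sum_(i < n) g (c i) * z ^+ i ->
  forall k, rspan g [seq z ^+ i | i <- iota 0 n] (z ^+ k).
Proof.
case: n => [|n] zn k.
  (* An integral equation of degree 0 reads [1 = 0], impossible in a field. *)
  have z10 : (1 : L) = 0 by rewrite -[LHS]/(z ^+ 0) zn big_ord0.
  by have := oner_neq0 L; rewrite z10 eqxx.
set es := [seq _ | i <- _].
have sz : size es = n.+1 by rewrite size_map size_iota.
have nthE i : (i < n.+1)%N -> es`_i = z ^+ i.
  by move=> i_n; rewrite (nth_map 0%N) ?size_iota // nth_iota.
have spanE w : (exists d : nat -> D, w = \sum_(i < n.+1) g (d i) * z ^+ i) -> rspan g es w.
  move=> [d ->]; exists (fun i => d i); rewrite -sz.
  by apply: eq_bigr => i _; rewrite nthE // -sz.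
apply: spanE; elim: k => [|k [d dE]].
  exists (fun i => (i == 0%N)%:R); rewrite big_ord_recl rmorph1 mul1r big1 ?addr0 //.
  by move=> i _; rewrite /= rmorph0 mul0r.
exists (fun i => (if i is i'.+1 then d i' else 0) + d n * c i).
rewrite exprS dE mulr_sumr big_ord_recr /=.
under [RHS]eq_bigr do rewrite rmorphD mulrDl rmorphM -mulrA.
rewrite big_split /= -[X in _ = _ + X]mulr_sumr -zn exprS mulrCA; congr (_ + _).
rewrite [RHS]big_ord_recl rmorph0 mul0r add0r.
by apply: eq_bigr => i _; rewrite mulrCA -exprS.
Qed.

Lemma rspan_comp (A D : comNzRingType) (L : fieldType)
    (e : {rmorphism A -> D}) (g : {rmorphism D -> L})
    (es : seq D) (ws : seq L) : (forall d, rspan e es d) ->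
  forall w, rspan g ws w -> rspan (g \o e) [seq g a * b | a <- es, b <- ws] w.
Proof.
move=> he w [c ->]; have iT : is_ideal [set: A] by [].
pose phi : {rmorphism A -> L} := g \o e.
apply/(rspan_ispan phi); apply: ispan_sum => // i; have [d ->] := he (c i).
rewrite rmorph_sum mulr_suml; apply: ispan_sum => // j.
rewrite rmorphM -mulrA; apply: (@ispanZ _ _ phi _ setT) => //.
by apply/rspan_ispan; apply: rspan_mem; apply: allpairs_f; exact: mem_nth.
Qed.

Lemma gen_ideal_map_surj (A B : comNzRingType) (f : {rmorphism A -> B}) (s : seq A) d :
  (forall z, exists x, f x = z) -> gen_ideal (map f s) d ->
  exists w, gen_ideal s w /\ f w = d.
Proof.
move=> fsurj; elim: s d => [|a s IH] d.
  by move=> /gen_ideal_nil->; exists 0; rewrite rmorph0; split=> //; exact: ideal0.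
move=> /gen_ideal_cons[c [w [/IH[w' [hw' <-]] ->]]]; have [b <-] := fsurj c.
exists (b * a + w'); rewrite rmorphD rmorphM; split=> //.
by apply/gen_ideal_cons; exists b, w'.
Qed.

Theorem residual_big_CM (R : idomainType) (m : set R) (p : nat) (S : comNzRingType)
    (f : {rmorphism R -> S}) :
  local_ring m -> noetherian R -> adically_complete m ->
  prime p -> m p%:R -> p%:R <> 0 :> R -> injective f ->
  (forall s, exists n (c : nat -> R), s ^+ n = \sum_(i < n) f (c i) * s ^+ i) ->
  exists (x : seq R) (C : comNzRingType) (h : {rmorphism S -> C}),
  [/\ system_of_parameters m (p%:R :: x),
    exists P, [/\ prime_ideal P, P p%:R & forall z, P z -> h z = 0],
    forall k, (k < size x)%N -> forall c,
      gen_ideal (map h (take k (map f x))) (h (f x`_k) * c) ->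
      gen_ideal (map h (take k (map f x))) c &
    ~ gen_ideal (map h (map f x)) 1].
Proof.
move=> hm noeth hc pp mp p0 finj fint.
have [x [ch [sop mmin [hch sch] chm Qp]]] := system_of_parameters_chain noeth hm mp p0.
have im : is_ideal m by case: hm => -[].
(* This prime is the bottom of a chain of length [size x] ending at [m], which the injectivity
   argument contradicts. *)
set Q := ch 1%N in Qp; have hQ : prime_ideal Q by exact: hch.
have iQ := prime_ideal_ideal hQ.
have xm : {in x, forall a, m a}.
  move=> a ax; case: mmin => _ + _; apply; apply: gen_ideal_mem.
  by rewrite inE ax orbT.
have Qm : Q `<=` m by have [_ QT _] := hQ; exact: local_sub.
have [D [pi [pi_surj piQ]]] := prime_quotient hQ.
pose mD := pi @` m.
have nD : noetherian D by exact: quotient_noetherian pi_surj noeth.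
have lD : local_ring mD by exact: quotient_local pi_surj piQ noeth hm Qm.
have cD : adically_complete mD by exact: quotient_complete pi_surj piQ noeth hm hc iQ.
have imD : is_ideal mD by case: lD => -[].
have pD : p%:R = 0 :> D by rewrite -(rmorph_nat pi); apply/piQ.
have [k0 [k1 kB kM k0m ksurj]] := coefficient_ring_exists nD lD pp pD cD.
pose kp : {pred D} := [pred d | `[< k0 d >]].
have kpP : subring_closed kp.
  split=> [|a b /asboolP ka /asboolP kb|a b /asboolP ka /asboolP kb]; apply/asboolP => //.
    exact: kB.
  exact: kM.
pose K0 : subringClosed D := HB.pack kp (GRing.isSubringClosed.Build D kp kpP).
pose phi : {rmorphism subring K0 -> D} := val.
have phiu c : c <> 0 -> ~ mD (phi c).
  move=> c0 mc; apply: c0; apply: val_inj; apply: k0m => //.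
  exact/asboolP/(valP c).
have phi_surj d : exists c, mD (d - phi c).
  by have [c [/asboolP kc dc]] := ksurj d; exists (Subring (kc : c \in K0)).
have mDrad : mD `<=` radical (gen_ideal (map pi x)).
  move=> _ [a ma <-]; have : radical (gen_ideal (p%:R :: x)) a by case: sop => _ ->.
  move=> [n /(gen_ideal_map pi)]; rewrite rmorphXn /= rmorph_nat pD => ha; exists n.
  move: ha => /gen_ideal_cons[c [w [hw ->]]].
  by rewrite mulr0 add0r.
have [es hes] := finite_span nD lD phi_surj mDrad.
have [|A [e [ys [ysE reg sep span inj]]]] :=
  @power_series_cover D _ mD phi nD lD cD phiu (map pi x) es.
  by move=> _ /mapP[a ax ->]; exists a => //; exact: xm.
have De d : rspan e es d.
  have [|d'|z [hz /(gen_ideal_nil _)/eqP]] := span (gen_ideal [::]) _ _ d.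
  - exact: gen_ideal_ideal.
  - have [z [hz dz]] := hes d'; exists z; split=> //.
    exact: ideal_addr (gen_ideal_ideal _) _ dz.
  - by rewrite subr_eq0 => /eqP->.
have e_inj a : e a = 0 -> a = 0.
  move=> ea0; apply: contrapT => a0.
  (* The substitution uses the first parameter as [s]. For empty [x] the default [0] is harmless,
     since then [M = 0] and the image of [a] is a unit. *)
  have ms : mD (nth 0 (map pi x) 0).
    case: (x) xm => [|x1 x'] xm' /=; first exact: ideal0.
    by exists x1 => //; apply: xm'; exact: mem_head.
  have [N [M [u [sN [N1 hN] mu M0 hI]]]] := inj a _ a0 ms.
  rewrite ea0 sub0r in hI.
  case xE : x => [|x1 x'].
    have N0 : N = [::] by apply: size0nil; rewrite sN xE.
    move: hI; rewrite N0 xE => /(gen_ideal_nil _)/eqP; rewrite oppr_eq0 M0 ?xE // mulr1 => /eqP u0.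
    by apply: mu; rewrite u0; exact: ideal0.
  (* As the first exponent is 1, the first relation is [x1 - x1 = 0]: only [size x'] relations
     remain. *)
  have [N' NE] : exists N', N = 1%N :: N'.
    by case: N sN hN {N1 hI} => [|n N']; rewrite xE //= => _ ->; exists N'.
  move: hI sN N1; rewrite NE xE /= subrr => hI [sN] N1.
  pose zs := [seq z.1 - x1 ^+ z.2 | z <- zip x' N'].
  have sz : size zs = size x' by rewrite size_map size_zip sN size_map minnn.
  rewrite size_map in sN.
  have hx1 : ideal_add Q (gen_ideal zs) (x1 ^+ M).
    have [v vu] := local_unit nD lD mu.
    have [w [hw wE]] : exists w, gen_ideal zs w /\ pi w = pi x1 ^+ M.
      apply: gen_ideal_map_surj => //.
      have -> : pi x1 ^+ M = - v * - (u * pi x1 ^+ M) by rewrite mulrNN mulrA vu mul1r.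
      apply: idealMl => //; move: hI => /gen_ideal_cons[c [y [hy ->]]].
      rewrite mulr0 add0r.
      suff -> : map pi zs = [seq z.1 - pi x1 ^+ z.2 | z <- zip (map pi x') N'] by [].
      rewrite /zs; elim: (x') (N') => [|b t IHt] [|n N''] //=.
      by rewrite IHt rmorphB rmorphXn.
    exists (x1 ^+ M - w), w; rewrite subrK; split=> //.
    by apply/piQ; rewrite rmorphB rmorphXn wE subrr.
  (* A prime over [Q] and the remaining relations contains a power of [x1], hence all parameters.
     The height theorem then bounds the chain from [Q] to [m] by one less than its length. *)
  have hmin : minimal_prime (ideal_add (ch 1%N) (gen_ideal zs)) (ch (size x').+2).
    have chm' : ch (size x').+2 = m by rewrite -chm xE.
    rewrite chm'; have [pm _ mmin'] := mmin; split=> //.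
      apply: ideal_add_sub => //; apply: gen_ideal_sub => // _ /mapP[z zz ->].
      apply: idealB => //.
        apply: xm; rewrite xE inE; apply/orP; right.
        by rewrite -(unzip1_zip (s := x') (t := N')) ?sN // map_f.
      apply: idealX => //; first by apply: xm; rewrite xE mem_head.
      have /allP := N1; apply; rewrite -(unzip2_zip (s := x') (t := N')) ?sN //.
      by rewrite map_f.
    move=> Pr hPr addPr Prm; apply: mmin' => //.
    have iPr := prime_ideal_ideal hPr.
    have QPr : Q `<=` Pr by apply: subset_trans addPr; exact: ideal_addl.
    have Prx1 : Pr x1 by apply: (@primeX _ _ _ M) => //; exact: addPr.
    apply: gen_ideal_sub => // b; rewrite xE !inE => /or3P[/eqP->|/eqP->|bx'] //.
      exact: QPr.
    have : b \in unzip1 (zip x' N') by rewrite unzip1_zip // sN.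
    move=> /mapP[z zz ->].
    have Prz : Pr (z.1 - x1 ^+ z.2).
      apply: addPr; apply: ideal_addr => //; apply: gen_ideal_mem; exact: map_f.
    apply: (idealBl iPr Prz); apply: idealX => //.
    have /allP := N1; apply; rewrite -(unzip2_zip (s := x') (t := N')) ?sN //.
    by rewrite map_f.
  suff chP : prime_chain (size x').+1 (fun i => ch i.+1).
    by have := height_theorem noeth chP hmin; rewrite sz ltnn.
  by split=> i il; [apply: hch|apply: sch]; rewrite xE.
have [P hP PQ] := lying_over finj hQ fint.
have [L [psi psiP]] := prime_to_field hP.
have [g gE] : exists g : {rmorphism D -> L}, forall r, g (pi r) = (psi \o f) r.
  by apply: factor_rmorphism => // r /piQ Qr; apply/psiP/PQ.
have g_inj d : g d = 0 -> d = 0.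
  by have [r <-] := pi_surj d; rewrite gE => /psiP/PQ/piQ.
have pL : p \in [pchar L].
  by rewrite inE pp -(rmorph_nat g) pD rmorph0 eqxx.
have [||z||||C [h [hP0 hreg hproper]]] := @big_CM_exists A L (g \o e) p S psi ys (map f x).
- by move=> a /g_inj; exact: e_inj.
- exact: pL.
- have [n [c zn]] := fint z.
  exists [seq g a * b | a <- es, b <- [seq psi z ^+ i | i <- iota 0 n]] => j.
  apply: rspan_comp => //; apply: (integral_powers_span (c := fun i => pi (c i))).
  rewrite -rmorphXn zn rmorph_sum; apply: eq_bigr => i _.
  by rewrite rmorphM rmorphXn gE.
- rewrite (map_comp g e) ysE -!map_comp; apply: eq_map => a /=.
  by rewrite gE.
- exact: reg.
- exact: sep.
exists x, C, h; split=> //.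
- exists P; split=> // [|z Pz]; first by rewrite -(rmorph_nat f); apply/PQ.
  by apply: hP0; apply/psiP.
- move=> k kx c; have := hreg k; rewrite size_map (nth_map 0) // => /(_ kx c).
  exact.
Qed.

(** * The product algebra *)

(** An alias of [T] that records [f], so that the [S]-algebra structure can be attached to it. *)
Definition algebra_of (S T : comNzRingType) (f : {rmorphism S -> T}) : Type := T.

Section AlgebraOf.
Variables (S T : comNzRingType) (f : {rmorphism S -> T}).
Local Notation B := (algebra_of f).

HB.instance Definition _ := GRing.ComNzRing.on B.

Definition algebra_of_scale (a : S) (z : B) : B := f a * z.

Lemma algebra_of_scaleA a b z :
  algebra_of_scale a (algebra_of_scale b z) = algebra_of_scale (a * b) z.
Proof. by rewrite /algebra_of_scale rmorphM mulrA. Qed.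

Lemma algebra_of_scale1 : left_id 1 algebra_of_scale.
Proof. by move=> z; rewrite /algebra_of_scale rmorph1 mul1r. Qed.

Lemma algebra_of_scaleDr : right_distributive algebra_of_scale +%R.
Proof. by move=> a y z; rewrite /algebra_of_scale mulrDr. Qed.

Lemma algebra_of_scaleDl z : {morph algebra_of_scale^~ z : a b / a + b}.
Proof. by move=> a b; rewrite /algebra_of_scale rmorphD mulrDl. Qed.

HB.instance Definition _ := GRing.Zmodule_isLmodule.Build S B
  algebra_of_scaleA algebra_of_scale1 algebra_of_scaleDr algebra_of_scaleDl.

Lemma algebra_of_scaleAl (a : S) (y z : B) : a *: (y * z) = a *: y * z.
Proof. exact: mulrA. Qed.

HB.instance Definition _ := GRing.Lmodule_isLalgebra.Build S B algebra_of_scaleAl.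
HB.instance Definition _ := GRing.Lalgebra_isComAlgebra.Build S B.

Lemma smul_algebra_of (s : seq S) (z : B) :
  smul (gen_ideal s) (setT : set B) z <-> gen_ideal (map f s) (z : T).
Proof.
split=> [[t ts ->]|[c ->]].
  rewrite big_seq; apply: (@ideal_sum T) => // q /ts[qs _].
  by apply: idealMr => //; exact: gen_ideal_map.
exists [seq (s`_i, c i : B) | i : 'I_(size (map f s))].
  move=> _ /mapP[i _ ->]; split=> //=; apply: gen_ideal_mem; apply: mem_nth.
  by rewrite -(size_map f).
rewrite big_map big_enum; apply: eq_bigr => i _ /=.
by rewrite (nth_map 0) 1?mulrC // -(size_map f).
Qed.

End AlgebraOf.

Lemma smulD (S : comNzRingType) (N : lmodType S) (I : set S) (u w : N) :
  smul I setT u -> smul I setT w ->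
  smul I (setT : set N) (u + w).
Proof.
move=> [s sI ->] [t tI ->]; exists (s ++ t); last by rewrite big_cat.
by move=> q; rewrite mem_cat => /orP[/sI|/tI].
Qed.

Lemma smul_scale (S : comNzRingType) (N : lmodType S) (I : set S) a (w : N) :
  I a -> smul I (setT : set N) (a *: w).
Proof.
move=> Ia; exists [:: (a, w)]; last by rewrite big_seq1.
by move=> q; rewrite inE => /eqP->.
Qed.

Section RegularQuotient.
Variables (S : comNzRingType) (N : lmodType S).

Lemma modq_pi_eq0 (s : seq S) (u : N) :
  (\pi_(modq N s) u = 0) <-> smul (gen_ideal s) (setT : set N) u.
Proof.
have -> : 0 = \pi_(modq N s) 0 by rewrite (raddf0 (\pi_(Quotient.quot (modq_pred s)))).
split=> [/eqP|h]; first by rewrite -modq_eq subr0 => /asboolP.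
by apply/eqP; rewrite -modq_eq subr0; apply/asboolP.
Qed.

(** The isomorphism theorem for iterated quotients, at the level of submodules; it turns regularity
    on [B / pB] into statements about [B] with [p] added to the sequence. *)
Lemma smul_modq (s t : seq S) (u : N) :
  smul (gen_ideal t) (setT : set (modq N s)) (\pi_(modq N s) u) <->
  smul (gen_ideal (s ++ t)) (setT : set N) u.
Proof.
have piD : {morph \pi_(modq N s) : a b / a + b}.
  exact: (raddfD (\pi_(Quotient.quot (modq_pred s)))).
have piZ a w : \pi_(modq N s) (a *: w) = a *: \pi_(modq N s) w.
  by rewrite -modq_scale_pi.
have pi0 : \pi_(modq N s) 0 = 0 by exact: (raddf0 (\pi_(Quotient.quot (modq_pred s)))).
have cats : gen_ideal s `<=` gen_ideal (s ++ t).
  by apply: gen_ideal_mono => a; rewrite mem_cat => ->.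
have catt : gen_ideal t `<=` gen_ideal (s ++ t).
  by apply: gen_ideal_mono => a; rewrite mem_cat orbC => ->.
split=> [[r rt uE]|[r rst ->]].
  have [w [hw wE]] : exists w, smul (gen_ideal t) (setT : set N) w /\
      \pi_(modq N s) w = \pi_(modq N s) u.
    exists (\sum_(q <- r) q.1 *: repr q.2); split.
      exists [seq (q.1, repr q.2) | q <- r]; last by rewrite big_map.
      by move=> _ /mapP[q /rt[qt _] ->].
    rewrite uE (big_morph _ piD pi0); apply: eq_bigr => q _.
    by rewrite piZ reprK.
  rewrite -(subrK w u); apply: smulD.
    have [v vs ->] : smul (gen_ideal s) (setT : set N) (u - w).
      apply/modq_pi_eq0; rewrite -scaleN1r piD piZ scaleN1r wE; exact: subrr.
    by exists v => // q /vs[qs _]; split=> //; exact: cats.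
  by have [v vt ->] := hw; exists v => // q /vt[qt _]; split=> //; exact: catt.
elim: r rst => [|q r IH] rst.
  by rewrite big_nil pi0; exists [::]; rewrite ?big_nil.
rewrite big_cons piD; apply: smulD; last by apply: IH => a ar; apply: rst; rewrite inE ar orbT.
have [qst _] := rst _ (mem_head _ _).
have [a [b [as_ bt ->]]] : ideal_add (gen_ideal s) (gen_ideal t) q.1.
  move: qst; apply: gen_ideal_sub; first exact: ideal_add_ideal.
  move=> a; rewrite mem_cat => /orP[ast|ast].
    by apply: ideal_addl => //; exact: gen_ideal_mem.
  by apply: ideal_addr => //; exact: gen_ideal_mem.
rewrite scalerDl piD (_ : \pi_(modq N s) (a *: q.2) = 0) ?add0r; last first.
  by apply/modq_pi_eq0; exact: smul_scale.
by rewrite piZ; exact: smul_scale.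
Qed.

End RegularQuotient.

Section PairHom.
Variables (S : comNzRingType) (F : fieldType) (C : comNzRingType).
Variables (f : {rmorphism S -> F}) (h : {rmorphism S -> C}).

Definition pair_hom (a : S) : F * C := (f a, h a).

Lemma pair_hom_is_zmod_morphism : zmod_morphism pair_hom.
Proof. by move=> a b; rewrite /pair_hom !rmorphB. Qed.

Lemma pair_hom_is_monoid_morphism : monoid_morphism pair_hom.
Proof. by split=> [|a b]; rewrite /pair_hom ?rmorph1 ?rmorphM. Qed.

HB.instance Definition _ := GRing.isZmodMorphism.Build S (F * C)%type
  pair_hom pair_hom_is_zmod_morphism.
HB.instance Definition _ := GRing.isMonoidMorphism.Build S (F * C)%type
  pair_hom pair_hom_is_monoid_morphism.

(** The element [a] generates exactly [F x 0], so the first components impose no condition. *)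
Lemma gen_ideal_pair_hom a (t : seq S) (z : F * C) : f a != 0 -> h a = 0 ->
  gen_ideal (map pair_hom (a :: t)) z <-> gen_ideal (map h t) z.2.
Proof.
move=> fa ha; split.
  move=> /(gen_ideal_map (snd : {rmorphism F * C -> C})).
  rewrite -map_comp /= => /gen_ideal_cons[c [w [hw ->]]].
  by rewrite ha mulr0 add0r.
move=> hz; apply/gen_ideal_cons; exists (z.1 / f a, 0), (0, z.2); split; last first.
  rewrite /pair_hom ha; case: z {hz} => z1 z2.
  by congr (_, _); rewrite /= ?mulfVK ?mulr0 ?add0r ?addr0.
move: (z.2) hz; elim: t => [|b t IH] w.
  by move=> /gen_ideal_nil->; apply/gen_ideal_nil.
move=> /gen_ideal_cons[c [v [/IH hv ->]]]; apply/gen_ideal_cons.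
by exists (0, c), (0, v); split=> //; congr (_, _); rewrite /= ?mul0r ?addr0.
Qed.

End PairHom.

(** * Integral equations, roots and small valuations in the absolute integral closure *)

Section RplusFacts.
Variables (R : idomainType) (K : closedFieldType).
Variable iota : {rmorphism {fraction R} -> K}.

Lemma to_plus_inj : injective (to_plus iota).
Proof.
move=> x y /(congr1 val) /= /fmorph_inj E.
by apply/eqP; rewrite -tofrac_eq E.
Qed.

Lemma Rplus_integral (s : Rplus iota) : exists n (c : nat -> R),
  s ^+ n = \sum_(i < n) to_plus iota (c i) * s ^+ i.
Proof.
case: s => z zI; have /asboolP[q qm /rootP qz] := zI.
exists (size q).-1, (fun i => - q`_i); apply: val_inj.
rewrite rmorphXn rmorph_sum /=.
move: qz; rewrite horner_coef size_map_poly_id0; last first.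
  by rewrite (monicP qm) rmorph1 oner_eq0.
have q0 : (0 < size q)%N by rewrite size_poly_gt0 monic_neq0.
have q1 : q`_(size q).-1 = 1 by have /monicP := qm.
move: q1; case: (size q) q0 => // n _ /= qn; rewrite big_ord_recr /= coef_map /= qn.
rewrite rmorph1 mul1r => /eqP; rewrite addrC addr_eq0 => /eqP->.
rewrite -sumrN; apply: eq_bigr => i _.
by rewrite coef_map rmorphN mulNr -[z]/(val (MkRplus zI)) -rmorphXn.
Qed.

Lemma Rplus_root (a : R) n : (0 < n)%N -> exists b : Rplus iota, b ^+ n = to_plus iota a.
Proof.
move=> n0; pose q : {poly R} := 'X^n - a%:P.
have sq : size (map_poly (RtoK iota) q) = n.+1.
  by rewrite rmorphB /= map_polyXn map_polyC /= size_XnsubC.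
have [z zq] : exists z, root (map_poly (RtoK iota) q) z.
  by apply/closed_rootP; rewrite sq eqSS -lt0n.
have zI : z \in int_closed iota.
  by apply/asboolP; exists q => //; exact: monicXnsubC.
exists (MkRplus zI); apply: val_inj; rewrite rmorphXn /=.
move: zq; rewrite /root rmorphB /= map_polyXn map_polyC /= !hornerE subr_eq0.
by move=> /eqP.
Qed.

End RplusFacts.

Lemma valuation_root (S : comNzRingType) (v : S -> \bar rat) (b : S) (q eps : rat) n :
  valuation v -> v (b ^+ n) = q%:E -> (0 < n)%N -> q / n%:R < eps -> (v b < eps%:E)%E.
Proof.
move=> [vN v0 vM _] vq n0 qe.
have v1 : v 1 = 0%E.
  have := vM 1 1; rewrite mulr1; case E : (v 1) => [r||].
  - by move=> [/(congr1 (fun z => z - r))]; rewrite subrr addrK => <-.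
  - by move=> _; have /eqP := (v0 1).1 E; rewrite oner_eq0.
  - by case: (vN 1).
case E : (v b) => [r||].
- have vX k : v (b ^+ k) = (r *+ k)%:E.
    elim: k => [|k IH]; first by rewrite v1.
    by rewrite exprS vM IH E mulrS.
  move: vq; rewrite vX => -[rq]; rewrite lte_fin.
  by move: qe; rewrite -rq -[r *+ n]mulr_natr mulfK // pnatr_eq0 -lt0n.
- have b0 := (v0 b).1 E; move: vq; rewrite b0 expr0n gtn_eqF //.
  by rewrite ((v0 0).2 erefl).
- by case: (vN b).
Qed.

Theorem theorem1 (R : idomainType) (m : set R) (p : nat)
    (K : closedFieldType) (iota : {rmorphism {fraction R} -> K})
    (v : R -> \bar int) (vplus : Rplus iota -> \bar rat) :
  local_ring m -> noetherian R -> adically_complete m ->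
  mixed_characteristic R p ->
  is_alg_closure iota ->
  valuation v -> (forall x, (0 <= v x)%E) -> (forall x, m x -> (0 < v x)%E) ->
  valuation vplus -> (forall x, vplus (to_plus iota x) = er_map intr (v x)) ->
  exists (x : seq R) (B : comAlgType (Rplus iota)),
    system_of_parameters m (p%:R :: x) /\
    weakly_almost_CM m vplus B /\
    smul (gen_ideal (map (to_plus iota) (p%:R :: x))) (setT : set B) <> setT /\
    regular_sequence (modq B [:: p%:R]) (map (to_plus iota) x) /\
    (forall n, (p%:R : B) ^+ n <> 0) /\
    (forall eps : rat, 0 < eps -> forall c : Rplus iota,
       is_rat_power p%:R eps c -> forall b : B, p%:R * b = 0 -> c *: b = 0).
Proof.
move=> hm noeth hc [pp char0 pdvd] _ hv _ _ hvp vpE.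
have mp : m p%:R.
  have ip : is_ideal (gen_ideal [:: p%:R : R]) by [].
  apply: (local_sub noeth hm ip); last by apply: gen_ideal_mem; rewrite inE.
  move=> /(congr1 (fun I : set R => I 1%:R)) E.
  have /pdvd : gen_ideal [:: p%:R : R] 1%:R by rewrite E.
  by rewrite dvdn1 => /eqP p1; rewrite p1 in pp.
have p0 : p%:R <> 0 :> R by move=> /char0 p0; rewrite p0 in pp.
have [x [C [h [sop [P [hP Pp hP0]] hreg hproper]]]] :=
  residual_big_CM hm noeth hc pp mp p0 (@to_plus_inj _ _ iota) (@Rplus_integral _ _ iota).
pose f : {rmorphism Rplus iota -> K} := val.
pose F : {rmorphism Rplus iota -> K * C} := pair_hom f h.
pose B : comAlgType (Rplus iota) := algebra_of F.
have fp : f p%:R != 0.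
  rewrite -(rmorph_nat (to_plus iota)) -(rmorph0 f); apply/eqP => /val_inj.
  by rewrite -(rmorph0 (to_plus iota)) => /to_plus_inj.
have hp : h p%:R = 0 by exact: hP0.
have key (t : seq (Rplus iota)) (z : B) :
    smul (gen_ideal (p%:R :: t)) (setT : set B) z <-> gen_ideal (map h t) z.2.
  by apply: iff_trans (smul_algebra_of _ _) _; exact: gen_ideal_pair_hom.
have pB : (p%:R : B) = F p%:R by rewrite [RHS]rmorph_nat.
have p_tors (b : B) : p%:R * b = 0 -> b.1 = 0.
  by rewrite pB => -[/eqP]; rewrite mulf_eq0 (negbTE fp) => /eqP.
(* A rational power of [p] has a power in the prime [P], so it lies in [P] and acts as zero on
   [C]. *)
have hroot c n k : (0 < k)%N -> c ^+ n = (p%:R : Rplus iota) ^+ k -> h c = 0.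
  move=> k0 cn; apply: hP0; apply: (@primeX _ _ _ n) => //; rewrite cn.
  by apply: idealX => //; exact: prime_ideal_ideal.
have tors c (b : B) : h c = 0 -> b.1 = 0 -> c *: b = 0.
  move=> hc0 b0; have -> : c *: b = (f c * b.1, h c * b.2) by [].
  by rewrite b0 hc0 mulr0 mul0r.
have reg k : (k < size x)%N -> forall z : B,
    smul (gen_ideal (p%:R :: take k (map (to_plus iota) x))) (setT : set B)
      (to_plus iota x`_k *: z) ->
    smul (gen_ideal (p%:R :: take k (map (to_plus iota) x))) (setT : set B) z.
  move=> kx z /key h1; apply/key.
  exact: (hreg _ kx).
exists x, B; split=> //; split; last split; last split; last split.
- exists (p%:R :: x) => //; split.
    (* Properness of [mB]: a prime of [C] over the proper ideal of the [x_i] contains the image of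
       [m], because [m] is the radical of the ideal of all parameters and [p] vanishes in [C]. *)
    move=> E; have [|||a Ia a1|M [hM xM _ _]] := @prime_avoiding C
        (gen_ideal (map h (map (to_plus iota) x))) [set 1].
    - by [].
    - by [].
    - by move=> a b /= -> ->; rewrite mul1r.
    - by apply: hproper; rewrite -a1.
    have iM := prime_ideal_ideal hM.
    have hmM a : m a -> M (h (to_plus iota a)).
      move=> ma; have : radical (gen_ideal (p%:R :: x)) a by case: sop => _ ->.
      move=> [n hn]; apply: (@primeX _ _ _ n) => //; rewrite -!rmorphXn.
      have /= := gen_ideal_map (h \o to_plus iota) hn.
      move=> /gen_ideal_cons[c [w [hw ->]]]; apply: idealD => //.
        by apply: idealMl => //; rewrite rmorph_nat hp; exact: ideal0.
      by apply: xM; rewrite -map_comp.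
    have : smul (to_plus iota @` m) (setT : set B) 1 by rewrite E.
    move=> [s sm E1]; apply: (prime1 hM).
    have iM2 : is_ideal [set z : K * C | M z.2].
      split=> [|a b /= Ma Mb|a b /= Mb]; first exact: (ideal0 iM).
        exact: (idealD iM Ma Mb).
      exact: (idealMl _ iM Mb).
    have : [set z : K * C | M z.2] (1 : B).
      rewrite E1 big_seq; apply: (@ideal_sum (K * C)%type) => // q /sm[[a ma <-] _] /=.
      by apply: idealMr => //; exact: hmM.
    by [].
  move=> eps eps0.
  have [vN v0 _ _] := hv.
  have [r vr] : exists r, v p%:R = r%:E.
    case E : (v p%:R) => [r||]; first by exists r.
      by have /p0 := (v0 _).1 E.
    by case: (vN p%:R).
  (* [N] exceeds [v(p) / eps], and the successor makes it positive; an [N]-th root of [p] then has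
     value below [eps]. *)
  pose N := (Num.bound (`|r%:~R : rat| / eps)).+1.
  have Nb : r%:~R / N%:R < eps.
    rewrite ltr_pdivrMr ?ltr0n //; apply: le_lt_trans (ler_norm _) _.
    rewrite mulrC -ltr_pdivrMr //; apply: lt_le_trans (archi_boundP _) _.
      by rewrite divr_ge0 // ltW.
    by rewrite ler_nat.
  have [b bN] := Rplus_root iota p%:R (isT : (0 < N)%N).
  have hb : h b = 0 by apply: (@hroot _ N 1%N) => //; rewrite bN rmorph_nat.
  exists b; split.
    by apply: (valuation_root hvp _ _ Nb) => //; rewrite bN vpE vr.
  (* At index 0 the colon is the [p]-torsion, killed by [b]; at later indices regularity on [C]
     already makes the colon trivial. *)
  move=> [_|i] /=.
    move=> z /smul_algebra_of/gen_ideal_nil; rewrite rmorph_nat => pz.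
    rewrite (tors b z hb); first by exists [::]; rewrite ?big_nil.
    by apply: p_tors; rewrite pB.
  rewrite ltnS => ix z; rewrite rmorph_nat map_take => /(reg _ ix) /key h1.
  by apply/key; exact: idealMl.
- move=> E; apply: hproper.
  have : smul (gen_ideal (map (to_plus iota) (p%:R :: x))) (setT : set B) 1 by rewrite E.
  by rewrite /= rmorph_nat => /key.
- split=> [E|k].
    apply: hproper.
    suff /key : smul (gen_ideal (p%:R :: map (to_plus iota) x)) (setT : set B) 1 by [].
    by apply/(smul_modq [:: p%:R]); rewrite E.
  rewrite size_map => kx z; rewrite (nth_map 0) //.
  have [b ->] : exists b : B, z = \pi_(modq (modq B [:: p%:R]) _) (\pi_(modq B [:: p%:R]) b).
    by exists (repr (repr z)); rewrite !reprK.
  move=> xz; apply/modq_pi_eq0/(smul_modq [:: p%:R]); apply: reg => //.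
  apply/(smul_modq [:: p%:R])/modq_pi_eq0.
  rewrite -[RHS]xz -[RHS]/(modq_scale _ _) modq_scale_pi.
  by rewrite -[X in _ = \pi_ _ X]/(modq_scale _ _) modq_scale_pi.
- move=> n; rewrite pB -[LHS](rmorphXn F) => /(congr1 fst) fpn.
  by have /eqP[] := expf_neq0 n fp; rewrite -rmorphXn; exact: fpn.
- move=> eps _ c [k [n [k0 n0 _ cn]]] b pb; apply: tors; last exact: p_tors.
  exact: hroot cn.
Qed.
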